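(* Let $d\ge2$, $\beta>\frac12$ and $\alpha<\min\{0,\beta-1\}$. For any divergence-free initial datum $v_0\in\dot B^{-\beta-\alpha}_{\infty,\infty}(\mathbb{T}^d)$ there exists $T(v_0)>0$ such that the generalized Navier–Stokes system $$\partial_t v+\operatorname{div}(v\otimes v)+(-\Delta)^\beta v+\nabla \pi=0,\qquad \operatorname{div} v=0$$ on $\mathbb{T}^d$ with initial datum $v_0$ admits a unique solution $v\in L^\infty\big((0,T(v_0)],\dot B^{-\beta-\alpha}_{\infty,\infty}(\mathbb{T}^d)\big)$ satisfying $$\sup_{t\in(0,T(v_0)]}t^{\frac{\beta+\alpha}{2\beta}}\|v(t)\|_{L^\infty(\mathbb{T}^d)}<\infty.$$
   Context: $\mathbb{T}^d=\mathbb{R}^d/\mathbb{Z}^d$; $v$ is an $\mathbb{R}^d$-valued velocity field and $\pi$ a scalar pressure. The operator $(-\Delta)^\beta$ is the Fourier multiplier with symbol $(2\pi|\xi|)^{2\beta}$, $\xi\in\mathbb{Z}^d$, where $\hat f(\xi)=\int_{\mathbb{T}^d}f(x)e^{-2\pi i\xi\cdot x}dx$; $\mathbb{P}$ is the Leray projection onto divergence-free fields, with Fourier symbol $\mathrm{Id}-\frac{\xi\otimes\xi}{|\xi|^2}$. Solutions are understood in the mild sense: $$v(t)=e^{-t(-\Delta)^\beta}v_0-\int_0^te^{-(t-\sigma)(-\Delta)^\beta}\mathbb{P}\operatorname{div}(v\otimes v)(\sigma)\,d\sigma.$$ Homogeneous Besov spaces on the torus: fix a nonnegative radial $\varphi\in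 C_c^\infty(\mathbb{R}^d)$ with values in $[0,1]$, $\operatorname{supp}\varphi\subset\{\frac34\le|\xi|\le\frac83\}$, $\varphi\equiv1$ on $\{\frac67\le|\xi|\le\frac{12}7\}$, $\sum_{j\in\mathbb{Z}}\varphi(2^{-j}\xi)=1$ for $\xi\neq0$. For a periodic distribution $f$ put $\dot\Delta_jf=\sum_{l\in\mathbb{Z}^d}\varphi(2^{-j}l)\hat f(l)e^{2\pi i l\cdot x}$, $j\in\mathbb{Z}$. The space $\dot B^{\sigma}_{\infty,\infty}(\mathbb{T}^d)$ consists of the periodic distributions with $\|f\|_{\dot B^\sigma_{\infty,\infty}}=\sup_{j\in\mathbb{Z}}2^{j\sigma}\|\dot\Delta_jf\|_{L^\infty}<\infty$.
   Formalization: The theorem assumes in addition α > −β (for α ≤ −β existence fails, e.g. for shear data), and drops the requirement φ ≡ 1 on 6/7 ≤ |ξ| ≤ 12/7, which contradicts the partition of unity at |ξ| = 12/7. *)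

(* Defs.v *)
From HB Require Import structures.
From mathcomp Require Import all_boot all_order all_algebra.
From mathcomp Require Import all_classical all_reals all_analysis.
From mathcomp Require Import complex.

Set Implicit Arguments.
Unset Strict Implicit.
Unset Printing Implicit Defensive.
Import Order.TTheory GRing.Theory Num.Theory.
Import numFieldNormedType.Exports.

Local Open Scope classical_set_scope.
Local Open Scope ring_scope.

(* Borel sets of R^d: the sigma-algebra generated by the coordinates. *)
Section row_measurable.
Context {R : realType} (d : nat).

Definition row_coord (i : 'I_d) (x : 'rV[R]_d) : measurableTypeR R := x 0 i.

Let row_set0 : g_sigma_preimage row_coord set0.
Proof. exact: sigma_algebra0. Qed.

Let row_setC A : g_sigma_preimage row_coord A ->
  g_sigma_preimage row_coord (~` A).
Proof. exact: sigma_algebraC. Qed.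

Let row_bigcup (F : (set 'rV[R]_d)^nat) :
  (forall i, g_sigma_preimage row_coord (F i)) ->
  g_sigma_preimage row_coord (\bigcup_i (F i)).
Proof. exact: sigma_algebra_bigcup. Qed.

HB.instance Definition _ :=
  @isMeasurable.Build (sigma_display (g_sigma_preimage row_coord))
    'rV[R]_d (g_sigma_preimage row_coord) row_set0 row_setC row_bigcup.

End row_measurable.

Section torus_measure.
Context (R : realType).

Definition tuple_cons n (p : measurableTypeR R * n.-tuple (measurableTypeR R)) :
  n.+1.-tuple (measurableTypeR R) := [tuple of p.1 :: p.2].

Lemma measurable_tuple_cons n : measurable_fun setT (@tuple_cons n).
Proof. exact: measurable_cons. Qed.

HB.instance Definition _ n :=
  isMeasurableFun.Build _ _ _ _ (@tuple_cons n) (@measurable_tuple_cons n).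

(* Lebesgue measure on [0, 1]^n, as an iterated product. *)
Fixpoint cube_measure n : probability (n.-tuple (measurableTypeR R)) R :=
  match n with
  | 0 => dirac [tuple]
  | n.+1 => distribution (uniform_prob (@ltr01 R) \x cube_measure n)%E
              (@tuple_cons n)
  end.

Definition row_of_tuple d (x : d.-tuple (measurableTypeR R)) : 'rV[R]_d :=
  \row_i tnth x i.

Lemma measurable_row_of_tuple d : measurable_fun setT (@row_of_tuple d).
Proof.
move=> _ Y mY; rewrite setTI.
have : preimage_set_system setT (@row_of_tuple d)
    (g_sigma_preimage (@row_coord R d)) (@row_of_tuple d @^-1` Y).
  by exists Y => //; rewrite setTI.
rewrite -g_sigma_preimage_comp /measurable /=; congr (g_sigma_preimage _ _).
by apply/funext => i; apply/funext => x; rewrite /row_coord /= mxE.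
Qed.

HB.instance Definition _ d :=
  isMeasurableFun.Build _ _ _ _ (@row_of_tuple d) (@measurable_row_of_tuple d).

(* The normalized Haar measure of T^d = R^d / Z^d, carried by the fundamental
   domain [0, 1]^d; functions on T^d are Z^d-periodic functions on R^d. *)
Definition torus_measure d : probability 'rV[R]_d R :=
  distribution (cube_measure d) (@row_of_tuple d).

End torus_measure.

Section fields.
Context {R : realType} {d : nat}.
Local Notation point := 'rV[R]_d.
Local Notation freq := 'rV[int]_d.
Implicit Types (f g phi : point -> R) (l : freq).

(* Euclidean length; the library norm on ['rV[R]_d] is the sup norm. *)
Definition euclid (x : point) : R := Num.sqrt (\sum_(i < d) x 0 i ^+ 2).

Definition real_freq l : point := map_mx intr l.

Definition dotp l (x : point) : R := \sum_(i < d) (l 0 i)%:~R * x 0 i.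

Definition zd_periodic {T : Type} (f : point -> T) : Prop :=
  forall (x : point) l, f (x + real_freq l) = f x.

Definition partial (i : 'I_d) f : point -> R := 'D_(delta_mx 0 i) f.

Definition partials (s : seq 'I_d) f : point -> R := foldr partial f s.

Definition smooth f : Prop := forall s : seq 'I_d,
  continuous (partials s f) /\
  forall i x, derivable (partials s f) x (delta_mx 0 i).

Definition test_fun f : Prop := smooth f /\ zd_periodic f.

(* Real distributions on T^d are continuous linear forms on the Frechet space
   of smooth periodic functions; only their values on [test_fun]s matter. *)
Definition functional := (point -> R) -> R.

Definition periodic_distribution (u : functional) : Prop :=
  (forall a f g, test_fun f -> test_fun g ->
     u (fun x => a * f x + g x) = a * u f + u g) /\
  exists (N : nat) (C : R), forall f (M : R), test_fun f ->
    (forall s x, (size s <= N)%N -> `|partials s f x| <= M) -> `|u f| <= C * M.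

Definition dist_of_fun g : functional :=
  fun f => \int[torus_measure R d]_x (g x * f x).

(* The pairing of u with exp(- 2 pi i l.x). *)
Definition fourier_coef (u : functional) l : R[i] :=
  (u (fun x => cos (2 * pi * dotp l x)) -i*
   u (fun x => sin (2 * pi * dotp l x)))%C.

Definition character l (x : point) : R[i] :=
  (cos (2 * pi * dotp l x) +i* sin (2 * pi * dotp l x))%C.

Definition Linfty_norm g : \bar R := 'N[torus_measure R d]_+oo[EFin \o g]%E.

(* The Littlewood-Paley function. The identity on [6/7, 12/7] demanded in the
   source contradicts the partition of unity, which would read 1 + 1 = 1 at
   |x| = 12/7, and is omitted; the other conditions force the value 1 on
   4/3 < |x| < 3/2. *)
Definition littlewood_paley phi : Prop :=
  [/\ smooth phi,
      (forall x, 0 <= phi x <= 1),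
      (forall x y, euclid x = euclid y -> phi x = phi y),
      (forall x, phi x != 0 -> 3 / 4 <= euclid x <= 8 / 3) &
      (forall x : point, x != 0 ->
         \esum_(j in [set: int]) (phi ((2 : R) ^ (- j) *: x))%:E = 1%E)].

(* The terms of the sum vanish for |l| > 2 ^ j * 8/3: it is a finite sum. *)
Definition dyadic_block phi (j : int) (u : functional) (x : point) : R[i] :=
  \sum_(l \in [set: freq])
    ((phi ((2 : R) ^ (- j) *: real_freq l))%:C%C
       * fourier_coef u l * character l x).

Definition besov_norm phi (s : R) (u : functional) : \bar R :=
  ereal_sup [set ((2 `^ (j%:~R * s))%:E *
    Linfty_norm (fun x => ComplexField.Normc.normc (dyadic_block phi j u x)))%E
    | j in [set: int]].

Definition besov phi (s : R) (u : functional) : Prop :=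
  periodic_distribution u /\ (besov_norm phi s u < +oo)%E.

Definition divergence_free (u : 'I_d -> functional) : Prop :=
  forall f, test_fun f -> \sum_(i < d) u i (partial i f) = 0.

Definition field_dist (v : point -> point) (i : 'I_d) : functional :=
  dist_of_fun (fun x => v x 0 i).

Definition frac_laplacian (beta : R) l : R :=
  (2 * pi * euclid (real_freq l)) `^ (2 * beta).

(* At l = 0 this is the identity, since 0^-1 = 0. *)
Definition leray l (i j : 'I_d) : R :=
  (i == j)%:R - (l 0 i)%:~R * (l 0 j)%:~R / euclid (real_freq l) ^+ 2.

(* Fourier coefficients of the i-th component of P div (v (x) v). *)
Definition leray_div_coef (v : point -> point) l (i : 'I_d) : R[i] :=
  \sum_(j < d) (leray l i j)%:C%C *
    \sum_(k < d) (0 +i* (2 * pi * (l 0 k)%:~R))%C *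
      fourier_coef (dist_of_fun (fun x => v x 0 j * v x 0 k)) l.

Definition cintegrable (D : set R) (F : R -> R[i]) : Prop :=
  lebesgue_measure.-integrable D (fun s => (complex.Re (F s))%:E) /\
  lebesgue_measure.-integrable D (fun s => (complex.Im (F s))%:E).

Definition cintegral (D : set R) (F : R -> R[i]) : R[i] :=
  ((\int[lebesgue_measure]_(s in D) complex.Re (F s)) +i*
   (\int[lebesgue_measure]_(s in D) complex.Im (F s)))%C.

Definition duhamel_integrand (beta : R) (v : R -> point -> point) (t : R)
    l (i : 'I_d) (s : R) : R[i] :=
  (expR (- (t - s) * frac_laplacian beta l))%:C%C * leray_div_coef (v s) l i.

(* The mild equation on (0, T], as an identity of distributions: all its
   operators are Fourier multipliers, so it is written frequency by frequency. *)
Definition mild_solution (beta T : R) (v0 : 'I_d -> functional)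
    (v : R -> point -> point) : Prop :=
  forall t, 0 < t <= T -> forall l (i : 'I_d),
    cintegrable `]0, t[ (duhamel_integrand beta v t l i) /\
    fourier_coef (field_dist (v t) i) l =
      (expR (- t * frac_laplacian beta l))%:C%C * fourier_coef (v0 i) l
      - cintegral `]0, t[ (duhamel_integrand beta v t l i).

(* v is in L^oo((0, T]; B^s_(oo, oo)). *)
Definition Linfty_besov phi (s T : R) (v : R -> point -> point) : Prop :=
  exists M : R, {ae (@lebesgue_measure R), forall t, 0 < t <= T -> forall i,
    periodic_distribution (field_dist (v t) i) /\
    (besov_norm phi s (field_dist (v t) i) <= M%:E)%E}.

Definition weighted_sup (gamma T : R) (v : R -> point -> point) : \bar R :=
  ereal_sup [set ((t `^ gamma)%:E * Linfty_norm (fun x => euclid (v t x)))%E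
            | t in [set t : R | 0 < t <= T]].

Record gns_solution phi (beta alpha T : R) (v0 : 'I_d -> functional)
    (v : R -> point -> point) : Prop := {
  gns_measurable : measurable_fun (`]0, T] `*` setT)
    (fun p : measurableTypeR R * point => v p.1 p.2);
  gns_periodic : forall t, 0 < t <= T -> zd_periodic (v t);
  gns_divergence_free :
    forall t, 0 < t <= T -> divergence_free (field_dist (v t));
  gns_mild : mild_solution beta T v0 v;
  gns_besov : Linfty_besov phi (- beta - alpha) T v;
  gns_bounded : (weighted_sup ((beta + alpha) / (2 * beta)) T v < +oo)%E }.

End fields.

(* Main.v *)
Require Import Defs.
From HB Require Import structures.
From mathcomp Require Import all_boot all_order all_algebra.
From mathcomp Require Import all_classical all_reals all_analysis.
From mathcomp Require Import measurable_realfun complex zify ring lra.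

(** Write gamma = (beta + alpha) / (2 beta), so that the datum has dyadic blocks
    of size O(lam ^ (2 beta gamma)) at frequency lam and solutions are sought with
    |v(t)| <= K t ^ (- gamma).  The bounds alpha < 0 and alpha < beta - 1 say
    exactly that gamma < 1/2 and gamma + 1 / (2 beta) < 1: the mild equation is
    subcritical, and it is solved as a fixed point of the map [mild_map].

    Everything is computed on Fourier coefficients, one dyadic block at a time.  A
    multiplier whose symbol is a fixed smooth compactly supported function read
    at scale lam acts on bounded functions with a norm independent of lam
    ([multiplier_bounded]), because its kernel has a bounded L^1 norm
    ([kernel_L1]).  Applied to phi times the heat symbol, this shows that the
    blocks of the heat semigroup decay like 1 / (1 + t lam ^ (2 beta))
    ([heat_block_bounded]).  Hence the two terms of the mild equation:
    - the linear evolution has blocks O(lam ^ (2 beta gamma) / (1 + t lam ^ (2 beta)))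
      ([linear_block]), whose sum over lam is O(t ^ (- gamma)) ([heat_sum_le]);
    - the Leray projection and the divergence cost one factor lam, and the heat
      decay is interpolated to (t - s) ^ (- a) lam ^ (- 2 beta a).  With
      2 beta a > 1 the blocks sum geometrically, and the time integral is a Beta
      integral of exponents a + delta and 2 gamma ([duhamel_block]); it is
      O(t ^ (- gamma)) as soon as a + delta + gamma < 1.

    Functions are recovered from bounds on their blocks by summing the blocks
    ([rec], [fourier_coef_rec]), and bounded functions with the same Fourier
    coefficients agree almost everywhere ([fourier_injective]).

    The exponent delta is what remains to win: (t - s) ^ delta is at most
    T ^ delta, so the map contracts a ball for small T and the Picard iterates
    converge geometrically; and it is controlled by lambda ^ (- delta)
    exp(lambda (t - s)), so that for large lambda the map is a contraction in the
    norm weighted by exp(lambda t) on balls of any size, over the same interval.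
    Both come from [mild_map_contract].  The first gives a fixed point, which is a
    solution ([fixed_point_solution]), its Besov bound resulting from the same
    estimate of blocks with a replaced by a - gamma.  The second gives uniqueness
    among fixed points ([mild_map_unique]), to which any solution reduces after
    modification on null sets ([solution_fixed_point]). *)

Set Implicit Arguments.
Unset Strict Implicit.
Unset Printing Implicit Defensive.
Import Order.TTheory GRing.Theory Num.Theory.
Import numFieldNormedType.Exports.

Local Open Scope classical_set_scope.
Local Open Scope ring_scope.

(** * Directional derivatives *)

Lemma is_derive_ext (R : numFieldType) (V W : normedModType R) (f g : V -> W) (x v : V) df :
  f =1 g -> is_derive x v f df -> is_derive x v g df.
Proof. by move=> /funext ->. Qed.

(** A directional derivative is an ordinary one along the line through x,
    which turns the calculus rules of one variable into rules for [partial]. *)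
Lemma is_derive_line (R : realType) (V W : normedModType R) (f : V -> W) (x v : V) df :
  is_derive x v f df <-> is_derive (0 : R) 1 (fun h : R => f (h *: v + x)) df.
Proof.
have E : (fun h : R => h^-1 *: (((fun h : R => f (h *: v + x)) \o shift 0) (h *: 1) - f (0 *: v + x))) =
   (fun h : R => h^-1 *: ((f \o shift x) (h *: v) - f x)).
  by apply/funext => h /=; rewrite scale0r !add0r addr0 /GRing.scale/= mulr1.
split=> -[d e]; split.
- by rewrite /derivable E.
- by rewrite /derive E.
- by move: d; rewrite /derivable E.
- by move: e; rewrite /derive E.
Qed.

Lemma is_derive_comp_line (R : realType) (V : normedModType R) (f : R -> R) (g : V -> R) (x v : V) (a b : R) :
  is_derive (g x) 1 f a -> is_derive x v g b -> is_derive x v (f \o g) (a * b).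
Proof.
move=> df /is_derive_line dg; apply/is_derive_line.
by apply: (@is_derive1_comp _ f (fun h => g (h *: v + x))) => //; rewrite scale0r add0r.
Qed.

(** * Integrals of bounded functions on the torus *)

Section bounded_integrals.
Context d (T : measurableType d) (R : realType) (P : probability T R).
Implicit Types f g : T -> R.

Lemma bounded_integrable f (B : R) : measurable_fun setT f ->
  (forall x, `|f x| <= B) -> P.-integrable setT (EFin \o f).
Proof.
move=> mf bf; apply: measurable_bounded_integrable => //.
  by rewrite (le_lt_trans (probability_le1 _ _))// ltry.
exists B; split; first exact: num_real.
by move=> x Bx y _ /=; rewrite (le_trans (bf y))// ltW.
Qed.

Lemma Rintegral_prob_cst c : \int[P]_x c = c.
Proof.
rewrite Rintegral_cst//; have : P [set: T] = 1%E by exact: probability_setT.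
by move=> /= ->; rewrite mulr1.
Qed.

Lemma le_Rintegral_bounded f (B : R) : measurable_fun setT f ->
  (forall x, `|f x| <= B) -> `|\int[P]_x f x| <= B.
Proof.
move=> mf bf.
apply: (le_trans (le_normr_Rintegral _ (bounded_integrable mf bf))) => //.
rewrite -[leRHS]Rintegral_prob_cst; apply: le_Rintegral => //.
- apply: (@bounded_integrable _ B) => //; first exact: measurableT_comp.
  by move=> x; rewrite normr_id.
- by apply: (@bounded_integrable _ `|B|).
Qed.

End bounded_integrals.

Section row_measurability.
Context {R : realType}.

Lemma measurable_coord n (i : 'I_n) :
  measurable_fun setT (fun x : 'rV[R]_n => x 0 i : R).
Proof.
move=> _ A mA; rewrite setTI; apply: sub_sigma_algebra.
case: n i => [[]//|n] i; rewrite -bigcup_mkord_ord; exists i => //=.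
by exists A => //; rewrite setTI inord_val.
Qed.

Lemma measurable_row d (T : measurableType d) n (f : T -> 'rV[R]_n) :
  (forall i, measurable_fun setT (fun t => f t 0 i : R)) ->
  measurable_fun setT f.
Proof.
move=> mf _ A mA; rewrite setTI.
have : preimage_set_system setT f (g_sigma_preimage (@row_coord R n))
  (f @^-1` A) by exists A => //; rewrite setTI.
rewrite -g_sigma_preimage_comp.
apply: smallest_sub; first exact: sigma_algebra_measurable.
case: n f mf A mA => [|n] f mf A mA; first by rewrite big_ord0.
rewrite -bigcup_mkord_ord; apply: bigcup_sub => i Ii.
move=> _ [C mC <-]; exact: mf.
Qed.

(** The sigma-algebra on row vectors is generated by the coordinates, not
    by the open sets; a continuous function is nevertheless measurable, as a
    pointwise limit of its values on finer and finer grids. *)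
Lemma continuous_measurable_row n (f : 'rV[R]_n -> R) :
  continuous f -> measurable_fun setT f.
Proof.
move=> cf.
pose grid k (x : 'rV[R]_n) : 'rV[R]_n :=
  \row_i ((Num.floor (k.+1%:R * x 0 i))%:~R / k.+1%:R).
apply: (@measurable_fun_cvg _ _ _ _ (fun k x => f (grid k x))).
- move=> k.
  pose cell (z : 'rV[int]_n) : set 'rV[R]_n :=
    \big[setI/(setT : set 'rV[R]_n)]_(i < n)
      [set x : 'rV[R]_n | Num.floor (k.+1%:R * x 0 i) = z 0 i].
  have mcell z : measurable (cell z).
    apply: bigsetI_measurable => i _.
    rewrite [X in measurable X](_ : _ = (fun x : 'rV[R]_n => x 0 i) @^-1`
      [set` `[(z 0 i)%:~R / k.+1%:R, (z 0 i + 1)%:~R / k.+1%:R[]); last first.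
      apply/seteqP; split => x /=; rewrite in_itv/=.
        move=> <-; rewrite ler_pdivrMr// ltr_pdivlMr// [x 0 i * _]mulrC.
        by rewrite Num.Theory.real_floor_le ?num_real//=
          Num.Theory.real_floorD1_gt ?num_real.
      rewrite ler_pdivrMr// ltr_pdivlMr// [x 0 i * _]mulrC => h.
      exact: Num.Theory.floor_def.
    have := @measurable_coord n i measurableT
      [set` `[(z 0 i)%:~R / k.+1%:R, (z 0 i + 1)%:~R / k.+1%:R[].
    by rewrite setTI; apply.
  have cellP x z : cell z x <-> forall i, Num.floor (k.+1%:R * x 0 i) = z 0 i.
    rewrite /cell; split.
      move=> + i; rewrite (bigD1 i)//= => -[] //.
    by move=> h; elim/big_rec : _ => [//|j B _ hB]; split => //=; exact: h.
  move=> _ A mA; rewrite setTI.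
  rewrite [X in measurable X](_ : _ =
    \bigcup_(z : {z : 'rV[int]_n | `[< A (f (\row_i ((z 0 i)%:~R / k.+1%:R))) >]}) cell (sval z)).
    by apply: countable_bigcupT_measurable => // i; exact: mcell.
  apply/seteqP; split => x /=.
    move=> Ax.
    have h : `[< A (f (\row_i (((\row_i Num.floor (k.+1%:R * x 0 i)) 0 i)%:~R / k.+1%:R))) >].
      by apply/asboolP; congr (A (f _)): Ax; apply/rowP => i; rewrite !mxE.
    exists (exist (fun z : 'rV[int]_n => is_true `[< A (f (\row_i ((z 0 i)%:~R / k.+1%:R))) >]) _ h) => //=.
    by apply/cellP => i; rewrite mxE.
  move=> [[z /= /asboolP Az] _ /= /cellP xz]; congr (A (f _)): Az.
  by apply/rowP => i; rewrite !mxE xz.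
- move=> x _; apply: (cvg_comp (grid ^~ x) f _ (cf x)).
  apply/cvg_ballP => e e0; near=> k; split=> // i j; rewrite ord1 mxE.
  have k0 : 0 < k.+1%:R :> R by [].
  rewrite /ball/= -(@ltr_pM2l _ k.+1%:R)// -[X in X * `|_|](gtr0_norm k0) -normrM.
  rewrite mulrBr [_ * (_ / _)]mulrCA divff ?gt_eqF// mulr1.
  have := Num.Theory.real_floor_le (num_real (k.+1%:R * x 0 j)).
  have := Num.Theory.real_floorD1_gt (num_real (k.+1%:R * x 0 j)).
  rewrite intrD => h1 h2; rewrite ger0_norm ?subr_ge0//.
  apply: (@le_lt_trans _ _ 1); first by lra.
  rewrite -ltr_pdivrMr// div1r (lt_trans (_ : _ < k%:R))// ?ltr_nat//.
  by near: k; exact: nbhs_infty_gtr.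
Unshelve. all: end_near. Qed.

End row_measurability.

Section torus_basics.
Context {R : realType}.
Local Notation U := (uniform_prob (@ltr01 R)).

(** The splitting of a torus into its first circle and the other ones, for
    inductions on the dimension. *)
Definition vcons n (a : R) (x : 'rV[R]_n) : 'rV[R]_n.+1 :=
  \row_i (if unlift ord0 i is Some j then x 0 j else a).

Lemma vcons0 n a (x : 'rV[R]_n) : vcons a x 0 ord0 = a.
Proof. by rewrite mxE unlift_none. Qed.

Lemma vconsS n a (x : 'rV[R]_n) j : vcons a x 0 (lift ord0 j) = x 0 j.
Proof. by rewrite mxE liftK. Qed.

Lemma measurable_vcons n :
  measurable_fun setT (fun p : measurableTypeR R * 'rV[R]_n => vcons p.1 p.2).
Proof.
apply: measurable_row => i; rewrite /vcons.
under eq_fun do rewrite mxE.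
case: unliftP => [j|] _; last exact: measurable_fst.
exact: (measurableT_comp (measurable_coord j) measurable_snd).
Qed.

Lemma row_of_tuple_cons n (p : measurableTypeR R * n.-tuple (measurableTypeR R)) :
  row_of_tuple (tuple_cons p) = vcons p.1 (row_of_tuple p.2).
Proof.
apply/rowP => i; rewrite !mxE; case: unliftP => [j|] -> /=; last by rewrite tnth0.
by rewrite tnthS mxE.
Qed.

Lemma Rintegral_torus n (f : 'rV[R]_n -> R) (B : R) :
  measurable_fun setT f -> (forall x, `|f x| <= B) ->
  \int[torus_measure R n]_x f x = \int[cube_measure R n]_x f (row_of_tuple x).
Proof.
move=> mf bf; rewrite /Rintegral integral_distribution//.
- exact/measurable_EFinP.
- apply: (@bounded_integrable _ _ _ _ (f \o (@row_of_tuple R n)) B) => [|x].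
    exact: measurableT_comp.
  exact: bf.
Qed.

Lemma Rintegral_uniform (f : R -> R) (B : R) :
  measurable_fun setT f -> (forall x, `|f x| <= B) ->
  \int[U]_x f x = \int[lebesgue_measure]_(x in `[0, 1]) f x.
Proof.
move=> mf bf; rewrite /Rintegral; congr fine.
rewrite integralE [RHS]integralE.
rewrite !integral_uniform//; last 2 first.
  exact/measurable_funeneg/measurable_EFinP.
  exact/measurable_funepos/measurable_EFinP.
by rewrite subr0 invr1 !mul1e.
Qed.

Lemma Rintegral_torusS n (f : 'rV[R]_n.+1 -> R) (B : R) :
  measurable_fun setT f -> (forall x, `|f x| <= B) ->
  \int[torus_measure R n.+1]_x f x =
  \int[U]_a \int[torus_measure R n]_x f (vcons a x).
Proof.
move=> mf bf; rewrite (Rintegral_torus mf bf).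
have mg : measurable_fun setT
  (fun p : measurableTypeR R * n.-tuple (measurableTypeR R) =>
     f (vcons p.1 (row_of_tuple p.2))).
  apply: measurableT_comp => //; under eq_fun do rewrite -row_of_tuple_cons.
  by apply: measurableT_comp => //; exact: measurable_tuple_cons.
rewrite [LHS]/Rintegral/= integral_distribution//; last 2 first.
- by apply/measurable_EFinP; exact: measurableT_comp.
- apply: (@bounded_integrable _ _ _ _ _ B) => //.
  by under eq_fun do rewrite /= row_of_tuple_cons.
under eq_integral do rewrite /= row_of_tuple_cons.
rewrite -integral12_prod_meas1; last first.
  by apply: (@bounded_integrable _ _ _ _ _ B) => //.
rewrite /Rintegral; congr fine; apply: eq_integral => a _; rewrite /fubini_F /=.
have mfa : measurable_fun setT (fun x => f (vcons a x)).
  by apply: measurableT_comp => //; exact: (measurableT_comp (@measurable_vcons n)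
    (measurable_pair1 a)).
have := @Rintegral_torus n (fun x => f (vcons a x)) B mfa (fun x => bf _).
rewrite /Rintegral => ->; rewrite fineK//.
apply: integrable_fin_num => //; apply: (@bounded_integrable _ _ _ _ _ B) => //.
by apply: (measurableT_comp mfa).
Qed.

End torus_basics.

(** * Characters and integration of derivatives *)

Section torus_fourier.
Context {R : realType}.
Local Notation U := (uniform_prob (@ltr01 R)).

Lemma Rintegral_FTC (f F : R -> R) (a b : R) : a < b -> continuous f ->
  (forall x : R, is_derive x 1 F (f x)) ->
  \int[lebesgue_measure]_(x in `[a, b]) f x = F b - F a.
Proof.
move=> ab cf dF; rewrite /Rintegral (@continuous_FTC2 _ f F)//.
- exact: continuous_subspaceT.
- have cF : continuous F.
    by move=> x; apply/differentiable_continuous/derivable1_diffP/ex_derive.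
  split; first by move=> x _; exact: ex_derive.
  + exact/cvg_at_right_filter/cF.
  + exact/cvg_at_left_filter/cF.
- by move=> x _; rewrite derive1E; apply: derive_val.
Qed.

Lemma cos_int_period (x : R) (k : int) : cos (x + 2 * pi * k%:~R) = cos x.
Proof.
have P n (y : R) : cos (y + 2 * pi * n%:R) = cos y.
  have := periodicn (@cosD2pi R) n y.
  by rewrite -(mulr_natr (pi *+ 2)) -(mulr_natl pi 2).
case: k => n; first exact: P.
by rewrite NegzE -[RHS](P n.+1)// -[in LHS](P n.+1) mulrN subrK.
Qed.

Lemma sin_int_period (x : R) (k : int) : sin (x + 2 * pi * k%:~R) = sin x.
Proof.
have P n (y : R) : sin (y + 2 * pi * n%:R) = sin y.
  have := periodicn (@sinD2pi R) n y.
  by rewrite -(mulr_natr (pi *+ 2)) -(mulr_natl pi 2).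
case: k => n; first exact: P.
by rewrite NegzE -[RHS](P n.+1)// -[in LHS](P n.+1) mulrN subrK.
Qed.

Lemma dotpDl n (l m : 'rV[int]_n) (x : 'rV[R]_n) :
  dotp (l + m) x = dotp l x + dotp m x.
Proof. by rewrite -big_split; apply: eq_bigr => i _; rewrite mxE intrD mulrDl. Qed.

Lemma dotpNl n (l : 'rV[int]_n) (x : 'rV[R]_n) : dotp (- l) x = - dotp l x.
Proof. by rewrite -sumrN; apply: eq_bigr => i _; rewrite mxE mulrNz mulNr. Qed.

Lemma dotpDr n (l : 'rV[int]_n) (x y : 'rV[R]_n) :
  dotp l (x + y) = dotp l x + dotp l y.
Proof. by rewrite -big_split; apply: eq_bigr => i _; rewrite mxE mulrDr. Qed.

Lemma dotpNr n (l : 'rV[int]_n) (x : 'rV[R]_n) : dotp l (- x) = - dotp l x.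
Proof. by rewrite -sumrN; apply: eq_bigr => i _; rewrite mxE mulrN. Qed.

Lemma dotp0l n (x : 'rV[R]_n) : dotp 0 x = 0.
Proof. by rewrite /dotp big1// => i _; rewrite mxE mul0r. Qed.

Lemma dotp_real_freq n (l m : 'rV[int]_n) :
  dotp l (real_freq m) = (\sum_i l 0 i * m 0 i)%:~R :> R.
Proof.
by rewrite rmorph_sum; apply: eq_bigr => i _; rewrite mxE -intrM.
Qed.

Lemma dotpS n (l : 'rV[int]_n.+1) a (x : 'rV[R]_n) :
  dotp l (vcons a x) =
  (l 0 ord0)%:~R * a + dotp (\row_j l 0 (lift ord0 j)) x.
Proof.
rewrite /dotp big_ord_recl vcons0; congr (_ + _).
by apply: eq_bigr => i _; rewrite vconsS mxE.
Qed.

Lemma measurable_dotp n (l : 'rV[int]_n) :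
  measurable_fun setT (@dotp R n l).
Proof.
apply: measurable_sum => i; apply: measurable_funM => //.
exact: measurable_coord.
Qed.

Definition cosl n (l : 'rV[int]_n) (x : 'rV[R]_n) : R := cos (2 * pi * dotp l x).
Definition sinl n (l : 'rV[int]_n) (x : 'rV[R]_n) : R := sin (2 * pi * dotp l x).

Lemma measurable_cosl n (l : 'rV[int]_n) : measurable_fun setT (cosl l).
Proof.
apply: measurableT_comp; first exact: (continuous_measurable_fun (@continuous_cos R)).
by apply: measurable_funM => //; exact: measurable_dotp.
Qed.

Lemma measurable_sinl n (l : 'rV[int]_n) : measurable_fun setT (sinl l).
Proof.
apply: measurableT_comp; first exact: (continuous_measurable_fun (@continuous_sin R)).
by apply: measurable_funM => //; exact: measurable_dotp.
Qed.

Lemma norm_cosl n l (x : 'rV[R]_n) : `|cosl l x| <= 1.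
Proof. by rewrite ler_norml cos_geN1 cos_le1. Qed.

Lemma norm_sinl n l (x : 'rV[R]_n) : `|sinl l x| <= 1.
Proof. by rewrite ler_norml sin_geN1 sin_le1. Qed.

Lemma coslNl n l (x : 'rV[R]_n) : cosl (- l) x = cosl l x.
Proof. by rewrite /cosl dotpNl mulrN cosN. Qed.

Lemma sinlNl n l (x : 'rV[R]_n) : sinl (- l) x = - sinl l x.
Proof. by rewrite /sinl dotpNl mulrN sinN. Qed.

Lemma coslBl n l m (x : 'rV[R]_n) :
  cosl (l - m) x = cosl l x * cosl m x + sinl l x * sinl m x.
Proof. by rewrite /cosl dotpDl mulrDr cosD dotpNl mulrN cosN sinN mulrN opprK. Qed.

Lemma sinlBl n l m (x : 'rV[R]_n) :
  sinl (l - m) x = sinl l x * cosl m x - cosl l x * sinl m x.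
Proof. by rewrite /cosl /sinl dotpDl mulrDr sinD dotpNl mulrN cosN sinN mulrN. Qed.

Lemma coslDl n l m (x : 'rV[R]_n) :
  cosl (l + m) x = cosl l x * cosl m x - sinl l x * sinl m x.
Proof. by rewrite /cosl dotpDl mulrDr cosD. Qed.

Lemma sinlDl n l m (x : 'rV[R]_n) :
  sinl (l + m) x = sinl l x * cosl m x + cosl l x * sinl m x.
Proof. by rewrite /cosl /sinl dotpDl mulrDr sinD. Qed.

Lemma coslBr n l (x y : 'rV[R]_n) :
  cosl l (x - y) = cosl l x * cosl l y + sinl l x * sinl l y.
Proof. by rewrite /cosl dotpDr mulrDr cosD dotpNr mulrN cosN sinN mulrN opprK. Qed.

Lemma sinlBr n l (x y : 'rV[R]_n) :
  sinl l (x - y) = sinl l x * cosl l y - cosl l x * sinl l y.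
Proof. by rewrite /cosl /sinl dotpDr mulrDr sinD dotpNr mulrN cosN sinN mulrN. Qed.

Lemma cosl_periodic n (l : 'rV[int]_n) : zd_periodic (@cosl n l).
Proof. by move=> x m; rewrite /cosl dotpDr dotp_real_freq mulrDr cos_int_period. Qed.

Lemma sinl_periodic n (l : 'rV[int]_n) : zd_periodic (@sinl n l).
Proof. by move=> x m; rewrite /sinl dotpDr dotp_real_freq mulrDr sin_int_period. Qed.

Lemma Rintegral_cos01 (k : int) :
  \int[U]_a cos (2 * pi * (k%:~R * a)) = (k == 0)%:R :> R.
Proof.
have mf : measurable_fun setT (fun a : R => cos (2 * pi * (k%:~R * a))).
  apply: measurableT_comp; first exact: (continuous_measurable_fun (@continuous_cos R)).
  by apply: measurable_funM => //; apply: measurable_funM.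
rewrite (@Rintegral_uniform _ _ 1)//; last first.
  by move=> x; rewrite ler_norml cos_geN1 cos_le1.
have [->|k0] := eqVneq k 0.
  under eq_Rintegral do rewrite mul0r mulr0 cos0.
  by rewrite Rintegral_cst//= lebesgue_measure_itv/= lte01 mul1r sube0/=.
have K0 : 2 * pi * k%:~R != 0 :> R.
  by rewrite !mulf_neq0 ?intr_eq0// gt_eqF ?pi_gt0.
pose F (a : R) := sin (2 * pi * k%:~R * a) / (2 * pi * k%:~R).
transitivity (F 1 - F 0); last first.
  rewrite /F mulr0 mulr1 sin0 mul0r subr0.
  by have := sin_int_period 0 k; rewrite add0r => ->; rewrite sin0 mul0r.
apply: Rintegral_FTC => //.
- move=> x; apply: continuous_comp; last exact: continuous_cos.
  by apply: continuousM; [exact: cst_continuous|apply: continuousM; [exact: cst_continuous|]].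
- move=> x.
  have d1 : is_derive x 1 (fun a : R => 2 * pi * k%:~R * a) (2 * pi * k%:~R).
    by apply: is_derive_eq; rewrite /GRing.scale/= mulr1.
  have d2 := is_derive1_comp (is_derive_sin (2 * pi * k%:~R * x)) d1.
  have := is_deriveZ (2 * pi * k%:~R)^-1 d2.
  rewrite [X in is_derive _ _ _ X](_ : _ = cos (2 * pi * (k%:~R * x))); last first.
    by rewrite /GRing.scale/= mulrCA mulVf// mulr1 -!mulrA.
  by apply: is_derive_ext => y /=; rewrite /GRing.scale/= mulrC.
Qed.

Lemma Rintegral_sin01 (k : int) :
  \int[U]_a sin (2 * pi * (k%:~R * a)) = 0 :> R.
Proof.
have mf : measurable_fun setT (fun a : R => sin (2 * pi * (k%:~R * a))).
  apply: measurableT_comp; first exact: (continuous_measurable_fun (@continuous_sin R)).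
  by apply: measurable_funM => //; apply: measurable_funM.
rewrite (@Rintegral_uniform _ _ 1)//; last first.
  by move=> x; rewrite ler_norml sin_geN1 sin_le1.
have [->|k0] := eqVneq k 0.
  under eq_Rintegral do rewrite mul0r mulr0 sin0.
  by rewrite Rintegral_cst//= mul0r.
have K0 : 2 * pi * k%:~R != 0 :> R.
  by rewrite !mulf_neq0 ?intr_eq0// gt_eqF ?pi_gt0.
pose F (a : R) := - (cos (2 * pi * k%:~R * a) / (2 * pi * k%:~R)).
transitivity (F 1 - F 0); last first.
  rewrite /F mulr0 mulr1.
  by have := cos_int_period 0 k; rewrite add0r => ->; rewrite subrr.
apply: Rintegral_FTC => //.
- move=> x; apply: continuous_comp; last exact: continuous_sin.
  by apply: continuousM; [exact: cst_continuous|apply: continuousM; [exact: cst_continuous|]].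
- move=> x.
  have d1 : is_derive x 1 (fun a : R => 2 * pi * k%:~R * a) (2 * pi * k%:~R).
    by apply: is_derive_eq; rewrite /GRing.scale/= mulr1.
  have d2 := is_derive1_comp (is_derive_cos (2 * pi * k%:~R * x)) d1.
  have := is_deriveZ (- (2 * pi * k%:~R)^-1) d2.
  rewrite [X in is_derive _ _ _ X](_ : _ = sin (2 * pi * (k%:~R * x))); last first.
    by rewrite /GRing.scale/= mulNr mulrCA mulVf// mulr1 opprK -!mulrA.
  by apply: is_derive_ext => y /=; rewrite /GRing.scale/= mulNr mulrC.
Qed.

(** Orthogonality of the characters, by induction on the dimension: the
    addition formulas separate the first coordinate, over which the integral
    vanishes unless its frequency is 0. *)
Lemma Rintegral_character n (l : 'rV[int]_n) :
  \int[torus_measure R n]_x cosl l x = (l == 0)%:R /\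
  \int[torus_measure R n]_x sinl l x = 0.
Proof.
elim: n l => [|n IH] l.
  have -> : l = 0 by apply/rowP => -[].
  rewrite eqxx; split; rewrite /cosl /sinl; under eq_Rintegral do rewrite dotp0l mulr0.
    by rewrite cos0 Rintegral_prob_cst.
  by rewrite sin0 Rintegral_prob_cst.
have [IHc IHs] := IH (\row_j l 0 (lift ord0 j)).
pose l' := \row_j l 0 (lift ord0 j).
have ic : (torus_measure R n).-integrable setT (EFin \o cosl l').
  exact: (@bounded_integrable _ _ _ _ _ 1 (measurable_cosl _) (@norm_cosl _ _)).
have isn : (torus_measure R n).-integrable setT (EFin \o sinl l').
  exact: (@bounded_integrable _ _ _ _ _ 1 (measurable_sinl _) (@norm_sinl _ _)).
have iZ (c : R) f : (torus_measure R n).-integrable setT (EFin \o f) ->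
   (torus_measure R n).-integrable setT (EFin \o (fun x => c * f x)).
  by move=> fi; have := integrableZl measurableT c fi; apply: eq_integrable.
split.
- rewrite (Rintegral_torusS (measurable_cosl _) (@norm_cosl _ _)).
  under eq_Rintegral => a _.
    under eq_Rintegral => x _ do
      rewrite /cosl dotpS mulrDr cosD -/(cosl l' x) -/(sinl l' x).
    rewrite RintegralB//; [|exact: iZ..].
    rewrite !RintegralZl// IHc IHs mulr0 subr0.
    over.
  rewrite /= RintegralZr//; last first.
    apply: (@bounded_integrable _ _ _ _ _ 1); last first.
      by move=> x; rewrite ler_norml cos_geN1 cos_le1.
    apply: measurableT_comp; first exact: (continuous_measurable_fun (@continuous_cos R)).
    by apply: measurable_funM => //; apply: measurable_funM.
  rewrite Rintegral_cos01 -natrM mulnb; congr (nat_of_bool _)%:R.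
  apply/andP/eqP => [[/eqP l0 /eqP l1]|->].
    apply/rowP => i; rewrite [RHS]mxE; case: (unliftP ord0 i) => [j|] -> //.
    by move/rowP/(_ j) : l1; rewrite !mxE.
  by rewrite mxE; split=> //; apply/eqP/rowP => i; rewrite !mxE.
- rewrite (Rintegral_torusS (measurable_sinl _) (@norm_sinl _ _)).
  under eq_Rintegral => a _.
    under eq_Rintegral => x _ do
      rewrite /sinl dotpS mulrDr sinD -/(cosl l' x) -/(sinl l' x).
    rewrite RintegralD//; [|exact: iZ..].
    rewrite !RintegralZl// IHc IHs mulr0 addr0.
    over.
  rewrite /= RintegralZr//; last first.
    apply: (@bounded_integrable _ _ _ _ _ 1); last first.
      by move=> x; rewrite ler_norml sin_geN1 sin_le1.
    apply: measurableT_comp; first exact: (continuous_measurable_fun (@continuous_sin R)).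
    by apply: measurable_funM => //; apply: measurable_funM.
  by rewrite Rintegral_sin01 mul0r.
Qed.

Lemma delta_vcons0 n a (x : 'rV[R]_n) h :
  h *: delta_mx 0 ord0 + vcons a x = vcons (h + a) x.
Proof.
apply/rowP => i; rewrite !mxE; case: (unliftP ord0 i) => [j|] ->.
  by rewrite [lift _ _ == _]eq_sym (negbTE (neq_lift _ _)) andbF mulr0 add0r.
by rewrite !eqxx mulr1.
Qed.

Lemma delta_vconsS n a (x : 'rV[R]_n) h j :
  h *: delta_mx 0 (lift ord0 j) + vcons a x = vcons a (h *: delta_mx 0 j + x).
Proof.
apply/rowP => i; rewrite !mxE; case: (unliftP ord0 i) => [k|] ->.
  by rewrite (inj_eq lift_inj) !mxE.
by rewrite (negbTE (neq_lift _ _)) andbF mulr0 add0r.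
Qed.

(** The fundamental theorem of calculus along the i-th circle, integrated
    over the other ones. *)
Lemma Rintegral_partial0 n (i : 'I_n) (f g : 'rV[R]_n -> R) (B : R) :
  measurable_fun setT g -> (forall x, `|g x| <= B) ->
  (forall x, is_derive x (delta_mx 0 i) f (g x)) ->
  (forall x, continuous (fun h : R => g (h *: delta_mx 0 i + x))) ->
  (forall x, f (1 *: delta_mx 0 i + x) = f x) ->
  \int[torus_measure R n]_x g x = 0.
Proof.
elim: n i f g => [|n IH] i f g; first by case: i.
move=> mg bg dg cg pf.
have mgv : measurable_fun setT (fun p : measurableTypeR R * 'rV[R]_n => g (vcons p.1 p.2)).
  exact: (measurableT_comp mg (@measurable_vcons R n)).
case: (unliftP ord0 i) => [j|] ij; rewrite ij {i ij} in dg cg pf.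
- have E a : \int[torus_measure R n]_x g (vcons a x) = 0.
    apply: (IH j (fun x => f (vcons a x))).
    + exact: (measurableT_comp mgv (pair1_measurable a)).
    + by move=> x.
    + move=> x; apply/is_derive_line.
      have /is_derive_line := dg (vcons a x).
      by apply: is_derive_ext => h; rewrite delta_vconsS.
    + move=> x; rewrite (_ : (fun h : R => _) =
        (fun h : R => g (h *: delta_mx 0 (lift ord0 j) + vcons a x)))//.
      by apply/funext => h; rewrite delta_vconsS.
    + by move=> x; rewrite -delta_vconsS pf.
  rewrite (Rintegral_torusS mg bg).
  under eq_Rintegral => a _ do rewrite E.
  by rewrite Rintegral_prob_cst.
- rewrite (Rintegral_torusS mg bg).
  have F : \int[U]_a \int[torus_measure R n]_x g (vcons a x) =
    \int[torus_measure R n]_x \int[U]_a g (vcons a x).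
    have int : (U \x torus_measure R n)%E.-integrable setT
        (EFin \o (fun p => g (vcons p.1 p.2))).
      by apply: (@bounded_integrable _ _ _ _ _ B).
    have := Fubini int.
    rewrite /Rintegral => /(congr1 fine) E.
    transitivity (fine (\int[U]_x (\int[torus_measure R n]_y ((g (vcons x y))%:E)))%E).
      congr fine; apply: eq_integral => a _; rewrite fineK//.
      apply: integrable_fin_num => //; apply: (@bounded_integrable _ _ _ _ _ B) => //.
      exact: (measurableT_comp mgv (pair1_measurable a)).
    rewrite [LHS]E; congr fine; apply: eq_integral => x _; rewrite fineK//.
    apply: integrable_fin_num => //; apply: (@bounded_integrable _ _ _ _ _ B) => //.
    exact: (measurableT_comp mgv (pair2_measurable x)).
  rewrite F.
  have E x : \int[U]_a g (vcons a x) = 0.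
    rewrite (@Rintegral_uniform _ (fun a => g (vcons a x)) B)//; last first.
      exact: (measurableT_comp mgv (pair2_measurable x)).
    transitivity (f (vcons 1 x) - f (vcons 0 x)); last first.
      by have := pf (vcons 0 x); rewrite delta_vcons0 addr0 => ->; rewrite subrr.
    apply: (@Rintegral_FTC (fun a => g (vcons a x)) (fun a => f (vcons a x))) => //.
    + rewrite (_ : (fun a : R => _) = (fun h : R => g (h *: delta_mx 0 ord0 + vcons 0 x)))//.
      by apply/funext => h; rewrite delta_vcons0 addr0.
    + move=> a; have /is_derive_line := dg (vcons a x) => H.
      apply/is_derive_line; apply: is_derive_ext H => h.
      by rewrite delta_vcons0 /GRing.scale/= mulr1.
  under eq_Rintegral => x _ do rewrite E.
  by rewrite Rintegral_prob_cst.
Qed.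

End torus_fourier.

(** * Bounded measurable functions *)

Section bounded_measurable.
Context d (T : measurableType d) (R : realType) (P : probability T R).
Implicit Types f g : T -> R.

(** Bounded measurable functions, for which every integrability side
    condition over a probability space is automatic. *)
Definition bmeas f := measurable_fun setT f /\ exists B : R, forall x, `|f x| <= B.

Lemma bmeas_integrable f : bmeas f -> P.-integrable setT (EFin \o f).
Proof. by move=> [mf [B bf]]; exact: bounded_integrable bf. Qed.

Lemma bmeas_cst c : bmeas (fun=> c).
Proof. by split => //; exists `|c|. Qed.

Lemma bmeasD f g : bmeas f -> bmeas g -> bmeas (fun x => f x + g x).
Proof.
move=> [mf [A bf]] [mg [B bg]]; split; first exact: measurable_funD.
by exists (A + B) => x; rewrite (le_trans (ler_normD _ _))// lerD.
Qed.

Lemma bmeasM f g : bmeas f -> bmeas g -> bmeas (fun x => f x * g x).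
Proof.
move=> [mf [A bf]] [mg [B bg]]; split; first exact: measurable_funM.
by exists (A * B) => x; rewrite normrM ler_pM.
Qed.

Lemma bmeasZ c f : bmeas f -> bmeas (fun x => c * f x).
Proof. by move=> bf; apply: bmeasM => //; exact: bmeas_cst. Qed.

Lemma bmeasN f : bmeas f -> bmeas (fun x => - f x).
Proof.
by move=> /(bmeasZ (-1)); congr bmeas; apply/funext => x; rewrite mulN1r.
Qed.

Lemma bmeasB f g : bmeas f -> bmeas g -> bmeas (fun x => f x - g x).
Proof. by move=> bf bg; apply: bmeasD => //; exact: bmeasN. Qed.

Lemma bmeas_sum I (s : seq I) (F : I -> T -> R) :
  (forall i, bmeas (F i)) -> bmeas (fun x => \sum_(i <- s) F i x).
Proof.
move=> bF; elim: s => [|i s IH].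
  by under eq_fun do rewrite big_nil; exact: bmeas_cst.
by under eq_fun do rewrite big_cons; exact: bmeasD.
Qed.

Lemma Rintegral_sum_bmeas I (s : seq I) (F : I -> T -> R) :
  (forall i, bmeas (F i)) ->
  \int[P]_x (\sum_(i <- s) F i x) = \sum_(i <- s) \int[P]_x F i x.
Proof.
move=> bF; elim: s => [|i s IH].
  by rewrite big_nil; under eq_Rintegral do rewrite big_nil; rewrite Rintegral_prob_cst.
rewrite big_cons -IH -RintegralD//; last 2 first.
- exact/bmeas_integrable/bF.
- exact/bmeas_integrable/bmeas_sum.
by apply: eq_Rintegral => x _; rewrite big_cons.
Qed.

Lemma RintegralD_bmeas f g : bmeas f -> bmeas g ->
  \int[P]_x (f x + g x) = \int[P]_x f x + \int[P]_x g x.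
Proof. by move=> bf bg; rewrite RintegralD//; exact: bmeas_integrable. Qed.

Lemma RintegralB_bmeas f g : bmeas f -> bmeas g ->
  \int[P]_x (f x - g x) = \int[P]_x f x - \int[P]_x g x.
Proof. by move=> bf bg; rewrite RintegralB//; exact: bmeas_integrable. Qed.

Lemma RintegralZ_bmeas c f : bmeas f ->
  \int[P]_x (c * f x) = c * \int[P]_x f x.
Proof. by move=> bf; rewrite RintegralZl//; exact: bmeas_integrable. Qed.

Lemma RintegralN_bmeas f : bmeas f -> \int[P]_x (- f x) = - \int[P]_x f x.
Proof.
move=> bf; rewrite -mulN1r -RintegralZ_bmeas//.
by apply: eq_Rintegral => x _; rewrite mulN1r.
Qed.

Lemma bounded_convergence (h : nat -> T -> R) (g : T -> R) (B : R) :
  (forall k, measurable_fun setT (h k)) -> (forall k x, `|h k x| <= B) ->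
  (forall x, h ^~ x @ \oo --> g x) ->
  bmeas g /\ \int[P]_x h k x @[k --> \oo] --> \int[P]_x g x.
Proof.
move=> mh bh hg.
have mg : measurable_fun setT g by apply: (measurable_fun_cvg mh) => x _; exact: hg.
have bg x : `|g x| <= B.
  have H : (fun k => `|h k x|) @ \oo --> `|g x| by apply: cvg_norm; exact: hg.
  rewrite -(cvg_lim _ H)//.
  by apply: limr_le; [apply/cvg_ex; eexists; exact: H|exact: nearW].
split; first by split => //; exists B.
have [|||||_ _ H] := @dominated_convergence _ T R P setT measurableT
  (fun k x => (h k x)%:E) (fun x => (g x)%:E) (fun=> B%:E).
- by move=> k; exact/measurable_EFinP.
- exact/measurable_EFinP.
- by apply/aeW => x _; apply: cvg_EFin => //; [exact: nearW|exact: hg].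
- by apply: (@bounded_integrable _ _ _ _ _ `|B|).
- by apply/aeW => x k _; rewrite lee_fin.
- apply: fine_cvg; rewrite fineK//.
  by apply: integrable_fin_num => //; exact: bounded_integrable bg.
Qed.

Lemma ae_eq_Rintegral f g : measurable_fun setT f -> measurable_fun setT g ->
  {ae P, forall x, f x = g x} -> \int[P]_x f x = \int[P]_x g x.
Proof.
move=> mf mg fg; rewrite /Rintegral; congr fine; apply: ae_eq_integral => //.
- exact/measurable_EFinP.
- exact/measurable_EFinP.
- by apply: filterS fg => x /= -> _.
Qed.

End bounded_measurable.

(** * Uniqueness of Fourier coefficients *)

Section torus_open_cube.
Context {R : realType}.

Lemma uniform_prob_oo : uniform_prob (@ltr01 R) `]0, 1[ = 1%E.
Proof.
have := @integral_indic _ _ R (uniform_prob (@ltr01 R)) setT measurableT `]0, 1[%classic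
  (measurable_itv _).
rewrite setIT => <-; rewrite integral_uniform//.
- rewrite integral_indic//= subr0 invr1 mul1e.
  rewrite (_ : _ `&` _ = `]0, 1[%classic); last first.
    by apply/setIidl/subset_itv_oo_cc.
  by rewrite lebesgue_measure_itv/= lte01 sube0.
- by apply/measurable_EFinP; exact: measurable_indic.
Qed.

(** The torus is represented by the closed cube; its faces are negligible, so
    that the coordinates may be assumed to avoid the endpoint where they jump. *)
Lemma torus_open_cube n :
  {ae torus_measure R n, forall x : 'rV[R]_n, forall i, 0 < x 0 i < 1}.
Proof.
pose A n : set (n.-tuple (measurableTypeR R)) :=
  [set t | all (fun a : R => 0 < a < 1) t].
have AE m : A m = \big[setI/setT]_(i < m)
       ((fun t : m.-tuple (measurableTypeR R) => tnth t i) @^-1` `]0, 1[).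
  apply/seteqP; split => t /=; rewrite /A/=.
    move=> /all_tnthP h; elim/big_rec : _ => [//|i B _ hB]; split => //=.
    by rewrite in_itv/=; exact: h.
  move=> h; apply/all_tnthP => i; move: h; rewrite (bigD1 i)//= => -[+ _].
  by rewrite /= in_itv.
have mA m : measurable (A m).
  rewrite AE; apply: bigsetI_measurable => i _; rewrite -[X in measurable X]setTI.
  by apply: measurable_tnth.
have A1 m : cube_measure R m (A m) = 1%E.
  elim: m => [|m IH].
    have -> : A 0%N = setT by apply/seteqP; split => // t _; rewrite /A/= tuple0.
    exact: probability_setT.
  have E : @tuple_cons R m @^-1` (A m.+1) = `]0, 1[ `*` A m.
    by apply/seteqP; split => -[a t] /=; rewrite /A/= in_itv/= => /andP.
  transitivity ((uniform_prob (@ltr01 R) \x cube_measure R m)%E (`]0, 1[ `*` A m)).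
    by rewrite -E.
  rewrite product_measure1E//; last exact: mA.
  by rewrite [X in (_ * X)%E]IH mule1; exact: uniform_prob_oo.
have mD : measurable [set x : 'rV[R]_n | forall i, 0 < x 0 i < 1].
  rewrite [X in measurable X](_ : _ = \big[setI/setT]_(i < n)
     ((fun x : 'rV[R]_n => x 0 i) @^-1` `]0, 1[)).
    apply: bigsetI_measurable => i _; rewrite -[X in measurable X]setTI.
    by apply: measurable_coord.
  apply/seteqP; split => x /=.
    move=> h; elim/big_rec : _ => [//|i B _ hB]; split => //=.
    by rewrite in_itv/=; exact: h.
  by move=> h i; move: h; rewrite (bigD1 i)//= => -[+ _]; rewrite /= in_itv.
exists (~` [set x : 'rV[R]_n | forall i, 0 < x 0 i < 1]); split => //.
  exact: measurableC.
rewrite probability_setC// -(A1 n) [X in (_ - X)%E](_ : _ = cube_measure R n (A n)).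
  by rewrite A1 subee.
rewrite /torus_measure /=/pushforward; congr (cube_measure R n _).
apply/seteqP; split => t /=; rewrite /A/=.
  by move=> h; apply/all_tnthP => i; have := h i; rewrite mxE.
by move=> /all_tnthP h i; rewrite mxE.
Qed.

End torus_open_cube.

(** Indicators of sublevel sets are bounded limits of polynomials: this is
    how the class of [stabilizer]s reaches indicator functions. *)
Lemma cvg_threshold (R : realType) (z : R) : 0 <= z <= 1 ->
  (1 - z ^+ i) ^+ (i * 2 ^ i)%N @[i --> \oo] --> ((z < 1 / 2)%R%:R : R).
Proof.
move=> /andP[z0 z1].
have zi i : 0 <= z ^+ i <= 1 by rewrite exprn_ge0//= exprn_ile1.
have bern (y : R) k : -1 <= y -> 1 + y *+ k <= (1 + y) ^+ k.
  move=> y1; elim: k => [|k IH]; first by rewrite mulr0n addr0 expr0.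
  rewrite exprS; apply: (@le_trans _ _ ((1 + y) * (1 + y *+ k))); last first.
    by rewrite ler_wpM2l//; lra.
  rewrite mulrS -mulr_natr.
  have : 0 <= y * y * k%:R by rewrite mulr_ge0// -expr2 sqr_ge0.
  by nra.
have [z2|z2] := ltP z (1/2).
  (* Here z^i i 2^i = i q^(2 i) = (i q^i) q^i, where i q^i is bounded. *)
- pose q := Num.sqrt (2 * z).
  have q0 : 0 <= q by rewrite sqrtr_ge0.
  have qq : q ^+ 2 = 2 * z by rewrite sqr_sqrtr// mulr_ge0.
  have q1 : q < 1 by rewrite -(@ltr_pXn2r _ 2)// ?nnegrE// qq expr1n; lra.
  have nq i : i%:R * q ^+ i <= (1 - q)^-1.
    have [->|qp] := eqVneq q 0.
      case: i => [|i]; rewrite ?mul0r ?subr0 ?invr1// expr0n/= mulr0//.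
    have qgt : 0 < q by rewrite lt_neqAle eq_sym qp.
    rewrite -ler_pdivlMr ?exprn_gt0// -[leRHS]mulrC -exprVn.
    apply: (@le_trans _ _ ((1 + (q^-1 - 1) *+ i) / (1 - q))).
      rewrite ler_pdivlMr ?subr_gt0// -mulr_natr.
      have qV : q * q^-1 = 1 by rewrite mulfV.
      have qV1 : 0 <= q^-1 - 1 by rewrite subr_ge0 invr_ge1 // ?unitfE// ltW.
      have : 1 - q <= q^-1 - 1 by nra.
      have i0 : 0 <= i%:R :> R by [].
      by nra.
    rewrite ler_wpM2r ?invr_ge0 ?subr_ge0 ?(ltW q1)//.
    have := bern (q^-1 - 1) i; rewrite [1 + (_ - 1)]addrC subrK; apply.
    by rewrite lerBrDr addNr invr_ge0.
  apply: (@squeeze_cvgr _ _ _ _ (fun i => 1 - (1 - q)^-1 * q ^+ i) (fun=> 1)).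
  + near=> i; apply/andP; split; last first.
      by rewrite exprn_ile1 ?subr_ge0 ?lerBlDr ?lerDl//; have /andP[] := zi i.
    apply: le_trans (bern (- z ^+ i) _ _); last by rewrite lerN2; have /andP[] := zi i.
    rewrite mulNrn lerB// -mulr_natr natrM natrX.
    rewrite (_ : z ^+ i * (i%:R * 2 ^+ i) = i%:R * q ^+ i * q ^+ i).
      by rewrite ler_wpM2r ?exprn_ge0.
    rewrite -mulrA -exprMn -expr2 qq exprMn; ring.
  + rewrite -[X in _ --> X]subr0 -[X in _ --> _ - X](mulr0 (1 - q)^-1).
    apply: cvgB; first exact: cvg_cst.
    by apply: cvgMr; apply: cvg_expr; rewrite ger0_norm.
  + exact: cvg_cst.
  (* (1 - y)^K <= (1 + y)^-K <= (1 + K y)^-1 with y = z^i, and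
     K y = i (2 z)^i >= i. *)
- apply: (@squeeze_cvgr _ _ _ _ (fun=> 0) (fun i => i.+1%:R^-1)).
  + near=> i; have /andP[zi0 zi1] := zi i; apply/andP; split.
      by rewrite exprn_ge0// subr_ge0.
    set y := z ^+ i in zi0 zi1 *; set K := (i * 2 ^ i)%N.
    have h1 : (1 - y) ^+ K * (1 + y) ^+ K <= 1.
      by rewrite -exprMn exprn_ile1//; nra.
    have h2 : i.+1%:R <= (1 + y) ^+ K.
      apply: le_trans (bern y K _); last by rewrite (le_trans _ zi0).
      rewrite -natr1 addrC lerD2l -(mulr_natr y) /K natrM natrX mulrCA.
      rewrite ler_peMr// /y -exprMn exprn_ege1//; lra.
    rewrite -[leRHS]mul1r ler_pdivlMr// (le_trans _ h1)// ler_wpM2l//.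
    by rewrite exprn_ge0// subr_ge0.
  + exact: cvg_cst.
  + exact: cvg_harmonic.
Unshelve. all: end_near. Qed.

Section fourier_uniqueness.
Context {R : realType} (n : nat) (f : 'rV[R]_n -> R).
Local Notation mu := (torus_measure R n).
Hypothesis bf : bmeas f.

Definition annihilated (g : 'rV[R]_n -> R) := forall l,
  \int[mu]_x (f x * g x * cosl l x) = 0 /\ \int[mu]_x (f x * g x * sinl l x) = 0.

(** If f has no Fourier coefficient, 1 is annihilated, and so is every h in
    this class.  The class is an algebra closed under bounded pointwise limits
    and contains the trigonometric functions, whose products with characters
    are combinations of characters: a monotone class argument shows that it
    contains the indicators of all measurable sets. *)
Definition stabilizer (h : 'rV[R]_n -> R) := bmeas h /\
  forall g, bmeas g -> annihilated g -> annihilated (fun x => g x * h x).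

Lemma bmeas_cosl l : bmeas (@cosl R n l).
Proof. by split; [exact: measurable_cosl|exists 1; exact: norm_cosl]. Qed.

Lemma bmeas_sinl l : bmeas (@sinl R n l).
Proof. by split; [exact: measurable_sinl|exists 1; exact: norm_sinl]. Qed.

Let bc := bmeas_cosl.
Let bs := bmeas_sinl.

Let annihilatedE g (u : 'rV[R]_n -> R) c1 u1 c2 u2 :
  bmeas g -> bmeas u1 -> bmeas u2 ->
  (forall x, u x = c1 * u1 x + c2 * u2 x) ->
  \int[mu]_x (f x * g x * u x) = c1 * \int[mu]_x (f x * g x * u1 x) +
    c2 * \int[mu]_x (f x * g x * u2 x).
Proof.
move=> bg b1 b2 E.
have B1 : bmeas (fun x => f x * g x * u1 x) by exact/bmeasM/b1/bmeasM.
have B2 : bmeas (fun x => f x * g x * u2 x) by exact/bmeasM/b2/bmeasM.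
rewrite -!RintegralZ_bmeas// -RintegralD_bmeas//; [|exact: bmeasZ..].
by apply: eq_Rintegral => x _; rewrite E; ring.
Qed.

Lemma stabilizer_cst c : stabilizer (fun=> c).
Proof.
split; first exact: bmeas_cst.
move=> g bg ag l; have [e1 e2] := ag l; split.
- rewrite (_ : (fun x => _) = (fun x => f x * g x * (c * cosl l x))); last first.
    by apply/funext => x; ring.
  rewrite (@annihilatedE g _ c (cosl l) 0 (cosl l))// ?e1 ?mulr0 ?addr0//.
  by move=> x; rewrite mul0r addr0.
- rewrite (_ : (fun x => _) = (fun x => f x * g x * (c * sinl l x))); last first.
    by apply/funext => x; ring.
  rewrite (@annihilatedE g _ c (sinl l) 0 (sinl l))// ?e2 ?mulr0 ?addr0//.
  by move=> x; rewrite mul0r addr0.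
Qed.

Lemma stabilizer_cosl m : stabilizer (cosl m).
Proof.
split; first exact: bc.
move=> g bg ag l.
have [e1 e2] := ag (l + m); have [e3 e4] := ag (l - m); split.
- rewrite (_ : (fun x => _) = (fun x => f x * g x * (cosl m x * cosl l x))); last first.
    by apply/funext => x; ring.
  rewrite (@annihilatedE g _ (1/2) (cosl (l + m)) (1/2) (cosl (l - m)))//.
    by rewrite e1 e3; ring.
  by move=> x; rewrite coslDl coslBl; field.
- rewrite (_ : (fun x => _) = (fun x => f x * g x * (cosl m x * sinl l x))); last first.
    by apply/funext => x; ring.
  rewrite (@annihilatedE g _ (1/2) (sinl (l + m)) (1/2) (sinl (l - m)))//.
    by rewrite e2 e4; ring.
  by move=> x; rewrite sinlDl sinlBl; field.
Qed.

Lemma stabilizer_sinl m : stabilizer (sinl m).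
Proof.
split; first exact: bs.
move=> g bg ag l.
have [e1 e2] := ag (l + m); have [e3 e4] := ag (l - m); split.
- rewrite (_ : (fun x => _) = (fun x => f x * g x * (sinl m x * cosl l x))); last first.
    by apply/funext => x; ring.
  rewrite (@annihilatedE g _ (1/2) (sinl (l + m)) (- (1/2)) (sinl (l - m)))//.
    by rewrite e2 e4; ring.
  by move=> x; rewrite sinlDl sinlBl; field.
- rewrite (_ : (fun x => _) = (fun x => f x * g x * (sinl m x * sinl l x))); last first.
    by apply/funext => x; ring.
  rewrite (@annihilatedE g _ (- (1/2)) (cosl (l + m)) (1/2) (cosl (l - m)))//.
    by rewrite e1 e3; ring.
  by move=> x; rewrite coslDl coslBl; field.
Qed.

Lemma stabilizerM h k : stabilizer h -> stabilizer k ->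
  stabilizer (fun x => h x * k x).
Proof.
move=> [bh sh] [bk sk]; split; first exact: bmeasM.
move=> g bg ag l.
have [e1 e2] := sk _ (bmeasM bg bh) (sh _ bg ag) l.
by split; [rewrite -e1|rewrite -e2]; apply: eq_Rintegral => x _; ring.
Qed.

Lemma stabilizerD h k : stabilizer h -> stabilizer k ->
  stabilizer (fun x => h x + k x).
Proof.
move=> [bh sh] [bk sk]; split; first exact: bmeasD.
move=> g bg ag l; have [e1 e2] := sh _ bg ag l; have [e3 e4] := sk _ bg ag l.
have B u (v : 'rV[R]_n -> R) : bmeas u -> bmeas v -> bmeas (fun x => f x * (g x * u x) * v x).
  by move=> bu bv; do !(apply: bmeasM => //).
split.
- rewrite (_ : (fun x => _) = (fun x => f x * (g x * h x) * cosl l x +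
     f x * (g x * k x) * cosl l x)); last by apply/funext => x; ring.
  by rewrite RintegralD_bmeas ?e1 ?e3 ?addr0//; exact: B.
- rewrite (_ : (fun x => _) = (fun x => f x * (g x * h x) * sinl l x +
     f x * (g x * k x) * sinl l x)); last by apply/funext => x; ring.
  by rewrite RintegralD_bmeas ?e2 ?e4 ?addr0//; exact: B.
Qed.

Lemma stabilizerZ c h : stabilizer h -> stabilizer (fun x => c * h x).
Proof. by apply: stabilizerM; exact: stabilizer_cst. Qed.

Lemma stabilizerX h k : stabilizer h -> stabilizer (fun x => h x ^+ k).
Proof.
move=> sh; elim: k => [|k IH]; first exact: stabilizer_cst.
by under eq_fun do rewrite exprS; exact: stabilizerM.
Qed.

Lemma stabilizer_lim h k (B : R) : (forall i, stabilizer (h i)) ->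
  (forall i x, `|h i x| <= B) -> (forall x, h ^~ x @ \oo --> k x) -> stabilizer k.
Proof.
move=> sh bh hk.
have mh i : measurable_fun setT (h i) by have [[]] := sh i.
have [bk _] := bounded_convergence mu mh bh hk.
split => // g bg ag l.
have key u : bmeas u -> (forall i, \int[mu]_x (f x * (g x * h i x) * u x) = 0) ->
    \int[mu]_x (f x * (g x * k x) * u x) = 0.
  move=> bu E.
  have [mG [BG bG]] : bmeas (fun x => f x * g x * u x) by do !apply: bmeasM => //.
  have [|i x||_] := @bounded_convergence _ _ _ mu (fun i x => (f x * g x * u x) * h i x)
      (fun x => (f x * g x * u x) * k x) (BG * B).
  - by move=> i; exact: measurable_funM.
  - by rewrite normrM ler_pM.
  - by move=> x; apply: cvgMr; exact: hk.
  - rewrite (_ : (fun i => _) = (fun=> 0)).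
      move=> H.
      have <- : \int[mu]_x (f x * g x * u x * k x) = 0.
        by apply/esym/(cvg_unique _ (cvg_cst _) H).
      by under eq_Rintegral => x _ do rewrite mulrA mulrAC.
    apply/funext => i; rewrite -[RHS](E i); apply: eq_Rintegral => x _; ring.
split; apply: key => // i; have [e1 e2] := (sh i).2 _ bg ag l => //.
Qed.

Lemma stabilizer_ae h k : stabilizer h -> bmeas k ->
  {ae mu, forall x, h x = k x} -> stabilizer k.
Proof.
move=> [bh sh] bk hk; split=> // g bg ag l; have [e1 e2] := sh _ bg ag l.
have M u (v : 'rV[R]_n -> R) : bmeas u -> bmeas v ->
    measurable_fun setT (fun x => f x * (g x * u x) * v x).
  by move=> bu bv; suff [] : bmeas (fun x => f x * (g x * u x) * v x) by []; do !apply: bmeasM => //.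
split; [rewrite -e1|rewrite -e2]; apply: ae_eq_Rintegral; try exact: M.
  by apply: filterS hk => x ->.
by apply: filterS hk => x ->.
Qed.

Definition stable_set A := measurable A /\ stabilizer (\1_A : 'rV[R]_n -> R).

Lemma stable_setC A : stable_set A -> stable_set (~` A).
Proof.
move=> [mA sA]; split; first exact: measurableC.
rewrite (_ : \1_(~` A) = (fun x => 1 + (-1) * (\1_A x : R))).
  by apply: stabilizerD; [exact: stabilizer_cst|exact: stabilizerZ].
by apply/funext => x; rewrite mulN1r !indicE in_setC; case: (x \in A); rewrite /= ?subrr ?subr0.
Qed.

(** The indicator of a union is the limit of 1 minus the products of the
    complementary indicators. *)
Lemma stable_bigcup (F : nat -> set 'rV[R]_n) : (forall i, stable_set (F i)) -> stable_set (\bigcup_i F i).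
Proof.
move=> sF; split; first by apply: bigcupT_measurable => i; case: (sF i).
have sF' i : stabilizer (\1_(~` F i)) by case: (stable_setC (sF i)).
pose h i (x : 'rV[R]_n) : R := 1 + (-1) * \prod_(j < i) \1_(~` F j) x.
have P01 i (x : 'rV[R]_n) : 0 <= \prod_(j < i) (\1_(~` F j) x : R) <= 1.
  apply/andP; split; first by apply: prodr_ge0.
  by apply: prodr_ile1 => j _; rewrite indicE ler0n; case: (_ \in _) => /=.
apply: (@stabilizer_lim h _ 2).
- move=> i; apply: stabilizerD; first exact: stabilizer_cst.
  apply: stabilizerZ; elim: i => [|i IH].
    by under eq_fun do rewrite big_ord0; exact: stabilizer_cst.
  by under eq_fun do rewrite big_ord_recr/=; exact: stabilizerM.
- move=> i x; have /andP[p0 p1] := P01 i x; rewrite /h ler_norml; apply/andP; split; lra.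
- move=> x; rewrite indicE.
  have [|xF] := boolP (x \in \bigcup_i F i).
    rewrite inE => -[j _ Fj]; apply: cvg_near_cst; near=> i.
    have ji : (j < i)%N by near: i; exact: nbhs_infty_gt.
    rewrite /h (bigD1 (Ordinal ji))//= indicE in_setC (mem_set Fj)/= mul0r; ring.
  rewrite /= (_ : h ^~ x = fun=> 0); first exact: cvg_cst.
  apply/funext => i; rewrite /h big1 ?mulr1 ?subrr// => j _.
  rewrite indicE in_setC; case: (boolP (x \in F j)) => //.
  rewrite inE => Fj; case/negP : xF; rewrite inE; exists j => //.
Unshelve. all: end_near. Qed.

Lemma stable_set0 : stable_set set0.
Proof. by split => //; rewrite indic0; exact: stabilizer_cst. Qed.

Lemma dotp_delta k (x : 'rV[R]_n) : dotp (delta_mx 0 k) x = x 0 k.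
Proof.
rewrite /dotp (bigD1 k)//= mxE !eqxx mul1r big1 ?addr0// => i ik.
by rewrite mxE (negbTE ik) andbF mul0r.
Qed.

(** In the open cube the set x_k < a is a superlevel set of a trigonometric
    polynomial of degree 1, so that [cvg_threshold] applies. *)
Lemma stable_ray k a : stable_set [set x : 'rV[R]_n | x 0 k < a].
Proof.
have mA : measurable [set x : 'rV[R]_n | x 0 k < a].
  rewrite [X in measurable X](_ : _ = (fun x : 'rV[R]_n => x 0 k) @^-1` `]-oo, a[).
    by rewrite -[X in measurable X]setTI; exact: measurable_coord.
  by apply/seteqP; split => x /=; rewrite in_itv.
split => //.
have bA : bmeas (\1_[set x : 'rV[R]_n | x 0 k < a] : _ -> R).
  split; first exact: measurable_indic.
  by exists 1 => x; rewrite indicE ger0_norm//; case: (_ \in _).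
have inA (x : 'rV[R]_n) : (x \in [set x : 'rV[R]_n | x 0 k < a]) = (x 0 k < a).
  by apply/idP/idP; rewrite inE.
(* For a outside ]0, 1[ the ray is null or full in the unit cube. *)
have [a0|a0] := leP a 0.
  apply: (stabilizer_ae (stabilizer_cst 0)) => //.
  apply: filterS (torus_open_cube n) => x /(_ k)/andP[x0 _].
  by rewrite indicE inA ltNge (le_trans a0)// ltW.
have [a1|a1] := leP 1 a.
  apply: (stabilizer_ae (stabilizer_cst 1)) => //.
  apply: filterS (torus_open_cube n) => x /(_ k)/andP[_ x1].
  by rewrite indicE inA (lt_le_trans x1).
(* On the unit interval, x_k < a when cos (2 pi x_k - pi a) > cos (pi a), that is
   when z < 1/2; the factor 1/4 keeps z in [0, 1]. *)
pose c := cos (pi * a).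
pose h x := c * cosl (delta_mx 0 k) x + sin (pi * a) * sinl (delta_mx 0 k) x.
have hE (x : 'rV[R]_n) : h x = cos (2 * pi * x 0 k - pi * a).
  by rewrite cosB /h /c /cosl /sinl dotp_delta; ring.
pose z x := 1 / 2 + c / 4 + (- (1 / 4)) * h x.
have sz : stabilizer z.
  apply: stabilizerD; first exact: stabilizer_cst.
  apply: stabilizerZ; apply: stabilizerD; apply: stabilizerZ.
    exact: stabilizer_cosl.
  exact: stabilizer_sinl.
have z01 x : 0 <= z x <= 1.
  have := cos_geN1 (2 * pi * x 0 k - pi * a); have := cos_le1 (2 * pi * x 0 k - pi * a).
  have := cos_geN1 (pi * a); have := cos_le1 (pi * a).
  rewrite -hE -/c /z => *; apply/andP; split; lra.
apply: (@stabilizer_ae (fun x => (z x < 1 / 2)%R%:R)) => //.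
- apply: (@stabilizer_lim (fun i x => (1 + (-1) * z x ^+ i) ^+ (i * 2 ^ i)%N) _ 1).
  + move=> i; apply: stabilizerX; apply: stabilizerD; first exact: stabilizer_cst.
    by apply: stabilizerZ; exact: stabilizerX.
  + move=> i x; have /andP[z0 z1] := z01 x.
    have zi0 : 0 <= z x ^+ i by rewrite exprn_ge0.
    have zi1 : z x ^+ i <= 1 by rewrite exprn_ile1.
    by rewrite normrX exprn_ile1// ler_norml; apply/andP; split; lra.
  + by move=> x; under eq_fun do rewrite mulN1r; exact: cvg_threshold.
- apply: filterS (torus_open_cube n) => x /(_ k)/andP[x0 x1].
  rewrite indicE inA; congr (nat_of_bool _)%:R.
  rewrite (_ : z x < 1 / 2 = (c < h x)); last first.
    by rewrite /z; apply/idP/idP => ?; lra.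
  have E : h x - c = 2 * sin (pi * x 0 k) * sin (pi * (a - x 0 k)).
    rewrite hE /c; set u := pi * x 0 k.
    have -> : 2 * pi * x 0 k - pi * a = u - pi * (a - x 0 k) by rewrite /u; ring.
    have -> : pi * a = u + pi * (a - x 0 k) by rewrite /u; ring.
    by rewrite cosB cosD; ring.
  have s0 : 0 < sin (pi * x 0 k).
    by apply: sin_gt0_pi; rewrite mulr_gt0 ?pi_gt0//= gtr_pMr// pi_gt0.
  rewrite -subr_gt0 E pmulr_rgt0 ?mulr_gt0//.
  have p0 := @pi_gt0 R.
  have [ax|xa|->] := ltgtP (x 0 k) a.
  + apply: sin_gt0_pi; apply/andP; split; first by rewrite mulr_gt0// subr_gt0.
    by rewrite gtr_pMr//; lra.
  + apply/negbTE; rewrite -leNgt -oppr_ge0 -sinN -mulrN opprB.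
    apply: sin_ge0_pi; apply/andP; split; first by rewrite mulr_ge0// ?ltW// subr_gt0.
    by rewrite ger_pMr//; lra.
  + by rewrite subrr mulr0 sin0 ltxx.
Qed.

(** Rays generate the Borel sets of each coordinate, and coordinates generate
    the sigma-algebra of the torus. *)
Lemma stable_measurable A : measurable A -> stable_set A.
Proof.
apply: smallest_sub.
  split; first exact: stable_set0.
    by move=> B sB; rewrite setTD; exact: stable_setC.
  exact: stable_bigcup.
suff H (k : 'I_n) (C : set (measurableTypeR R)) : measurable C -> stable_set (row_coord k @^-1` C).
  elim/big_rec : _ => [//|k X _ hX]; rewrite subUset; split=> // _ [C mC <-].
  by rewrite setTI; exact: H.
rewrite RGenInftyO.measurableE.
suff : <<s @RGenInftyO.G R >> `<=` [set C : set R | stable_set (row_coord k @^-1` C)] by exact.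
apply: smallest_sub.
  split => /=.
  - by rewrite preimage_set0; exact: stable_set0.
  - by move=> B sB; rewrite setTD preimage_setC; exact: stable_setC.
  - by move=> F sF; rewrite preimage_bigcup; exact: stable_bigcup.
move=> _ [a ->] /=; rewrite (_ : _ @^-1` _ = [set x : 'rV[R]_n | x 0 k < a]).
  exact: stable_ray.
by apply/seteqP; split => x /=; rewrite in_itv.
Qed.

(** The sign of f belongs to the class of [stabilizer]s, so that the integral
    of f times its sign vanishes. *)
Lemma fourier_injective :
  (forall l, \int[mu]_x (f x * cosl l x) = 0 /\ \int[mu]_x (f x * sinl l x) = 0) ->
  {ae mu, forall x, f x = 0}.
Proof.
move=> f0.
have mf : measurable_fun setT f by case: bf.
have a1 : annihilated (fun=> 1).
  by move=> l; have [e1 e2] := f0 l; split; [rewrite -e1|rewrite -e2];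
    apply: eq_Rintegral => x _; rewrite mulr1.
pose P := [set x | 0 < f x]; pose N := [set x | f x < 0].
have mP : measurable P.
  rewrite [X in measurable X](_ : _ = f @^-1` `]0, +oo[).
    by rewrite -[X in measurable X]setTI; exact: mf.
  by apply/seteqP; split => x /=; rewrite in_itv/= andbT.
have mN : measurable N.
  rewrite [X in measurable X](_ : _ = f @^-1` `]-oo, 0[).
    by rewrite -[X in measurable X]setTI; exact: mf.
  by apply/seteqP; split => x /=; rewrite in_itv.
have [_ sP] := stable_measurable mP; have [_ sN] := stable_measurable mN.
(* The sign of f is the difference of the indicators of P and N; the frequency 0
   gives the integral of |f|. *)
have [_ /(_ _ (bmeas_cst _ _) a1 0) [+ _]] := stabilizerD sP (stabilizerZ (-1) sN).
under eq_Rintegral => x _.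
  rewrite mul1r /cosl dotp0l mulr0 cos0 mulr1 mulN1r (_ : _ * _ = `|f x|).
    over.
  have -> : \1_P x = (0 < f x)%R%:R :> R.
    by rewrite indicE; congr (nat_of_bool _)%:R; apply/idP/idP; rewrite inE.
  have -> : \1_N x = (f x < 0)%R%:R :> R.
    by rewrite indicE; congr (nat_of_bool _)%:R; apply/idP/idP; rewrite inE.
  have [fx|fx|fx] := ltgtP (f x) 0.
  - by rewrite ltr0_norm// sub0r mulrN1.
  - by rewrite gtr0_norm// subr0 mulr1.
  - by rewrite fx normr0 mul0r.
move=> int0.
have /ae_eq_integral_abs/= : (\int[mu]_(x in setT) `|(f x)%:E| = 0)%E.
  have bn : bmeas (fun x => `|f x|).
    have [_ [B fB]] := bf.
    by split; [exact: measurableT_comp|exists B => x; rewrite normr_id].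
  have /fineK <- := integrable_fin_num measurableT (bmeas_integrable mu bn).
  by congr EFin; exact: int0.
have mEf : measurable_fun setT (fun x => (f x)%:E) by exact/measurable_EFinP.
move=> /(_ measurableT mEf).
by apply: filterS => x /= /(_ I) [].
Qed.

End fourier_uniqueness.

(** * Symbols and damped differences *)

Section symbols.
Context {R : realType} {d : nat}.
Local Notation point := 'rV[R]_d.
Local Notation e_ i := (delta_mx 0 i : point).

(** Families of functions with partial derivatives bounded on D up to order n,
    uniformly in the parameter t.  The parameter carries the time of the heat
    semigroup, or the inverse of a mesh size. *)
Fixpoint symbol (T : Type) (D : set point) n (g : T -> point -> R) : Prop :=
  (exists B : R, forall t x, D x -> `|g t x| <= B) /\
  if n is n'.+1 then forall i : 'I_d, exists g' : T -> point -> R,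
    (forall t x, D x -> is_derive x (e_ i) (g t) (g' t x)) /\ symbol D n' g'
  else True.

Section basic.
Context {T : Type} {D : set point}.
Implicit Types g h : T -> point -> R.

Lemma symbol_bounded n g : symbol D n g ->
  exists2 B : R, 0 <= B & forall t x, D x -> `|g t x| <= B.
Proof.
move=> H; have [B hB] : exists B : R, forall t x, D x -> `|g t x| <= B by case: n H => [|n] [].
by exists `|B| => // t x Dx; rewrite (le_trans (hB t x Dx))// ler_norm.
Qed.

Lemma symbol_pred n g : symbol D n.+1 g -> symbol D n g.
Proof.
elim: n g => [|n IH] g; first by case.
move=> [b H]; split=> // i; have [g' [dg sg]] := H i.
by exists g'; split => //; exact: IH.
Qed.

Lemma symbol_cst n (c : R) : symbol D n (fun _ : T => fun=> c).
Proof.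
elim: n c => [|n IH] c; first by split=> //; exists `|c|.
split; first by exists `|c|.
move=> i; exists (fun _ => fun=> 0); split; last exact: IH.
by move=> t x _; exact: is_derive_cst.
Qed.

Lemma symbolD n g h : symbol D n g -> symbol D n h ->
  symbol D n (fun t x => g t x + h t x).
Proof.
elim: n g h => [|n IH] g h sg sh.
  have [A A0 hA] := symbol_bounded sg; have [B B0 hB] := symbol_bounded sh.
  by split=> //; exists (A + B) => t x Dx; rewrite (le_trans (ler_normD _ _))// lerD ?hA ?hB.
have [A A0 hA] := symbol_bounded sg; have [B B0 hB] := symbol_bounded sh.
split.
  by exists (A + B) => t x Dx; rewrite (le_trans (ler_normD _ _))// lerD ?hA ?hB.
move=> i; have [g' [dg sg']] := sg.2 i; have [h' [dh sh']] := sh.2 i.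
exists (fun t x => g' t x + h' t x); split; last exact: IH.
by move=> t x Dx; apply: is_deriveD; [exact: dg|exact: dh].
Qed.

Lemma symbolM n g h : symbol D n g -> symbol D n h ->
  symbol D n (fun t x => g t x * h t x).
Proof.
elim: n g h => [|n IH] g h sg sh.
  have [A A0 hA] := symbol_bounded sg; have [B B0 hB] := symbol_bounded sh.
  by split=> //; exists (A * B) => t x Dx; rewrite normrM ler_pM ?hA ?hB.
have [A A0 hA] := symbol_bounded sg; have [B B0 hB] := symbol_bounded sh.
split; first by exists (A * B) => t x Dx; rewrite normrM ler_pM ?hA ?hB.
move=> i; have [g' [dg sg']] := sg.2 i; have [h' [dh sh']] := sh.2 i.
exists (fun t x => g t x * h' t x + h t x * g' t x); split.
  by move=> t x Dx; apply: is_deriveM; [exact: dg|exact: dh].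
by apply: symbolD; apply: IH => //; exact: symbol_pred.
Qed.

Lemma symbolZ n (c : R) g : symbol D n g -> symbol D n (fun t x => c * g t x).
Proof. by move=> sg; apply: symbolM => //; exact: symbol_cst. Qed.

Lemma symbol_reparam T' n (k : T' -> T) g : symbol D n g -> symbol D n (g \o k).
Proof.
elim: n g => [|n IH] g [[B hB] H]; split=> //; try by exists B => t x; exact: hB.
move=> i; have [g' [dg sg]] := H i; exists (g' \o k); split; last exact: IH.
by move=> t x Dx; exact: dg.
Qed.

End basic.

Lemma is_derive_coord (x : point) (i k : 'I_d) :
  is_derive x (e_ i) (fun y : point => y 0 k) ((k == i)%:R).
Proof.
apply/is_derive_line.
have : is_derive (0 : R) 1 (fun h : R => (k == i)%:R * h + x 0 k) (k == i)%:R.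
  have -> : (fun h : R => (k == i)%:R * h + x 0 k) = ((k == i)%:R \*: id) + cst (x 0 k).
    by apply/funext.
  apply: is_derive_eq.
  by rewrite addr0 /GRing.scale/= mulr1.
by apply: is_derive_ext => h; rewrite !mxE eqxx/= mulrC.
Qed.

Lemma symbol_coord T (D : set point) n k (B : R) :
  (forall x, D x -> `|x 0 k| <= B) -> symbol D n (fun _ : T => fun x : point => x 0 k).
Proof.
move=> hB; case: n => [|n]; split=> //; try by exists B => t x; exact: hB.
move=> i; exists (fun _ => fun=> (k == i)%:R); split; last exact: symbol_cst.
by move=> t x _; exact: is_derive_coord.
Qed.

Definition sqnorm (x : point) : R := \sum_(i < d) x 0 i ^+ 2.

Lemma is_derive_sqnorm (x : point) (i : 'I_d) :
  is_derive x (e_ i) sqnorm (2 * x 0 i).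
Proof.
have -> : sqnorm = \sum_(k < d) (fun y : point => y 0 k * y 0 k).
  by apply/funext => y; rewrite fct_sumE; apply: eq_bigr => k _; rewrite expr2.
have -> : 2 * x 0 i = \sum_(k < d) (x 0 k *: (k == i)%:R + x 0 k *: (k == i)%:R : R).
  rewrite (bigD1 i)//= eqxx big1 ?addr0.
    by rewrite /GRing.scale/= mulr1; ring.
  by move=> k ki; rewrite (negbTE ki) !scaler0 addr0.
apply: is_derive_sum => k; apply: is_deriveM; exact: is_derive_coord.
Qed.

(** Powers of |x|^2 are smooth away from 0, with derivatives of the same
    form. *)
Lemma symbol_powR T (D : set point) (a b : R) n c : 0 < a ->
  (forall x, D x -> a <= sqnorm x <= b) ->
  symbol D n (fun _ : T => fun x => sqnorm x `^ c).
Proof.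
move=> a0 hD.
have bd (c' : R) x : D x -> `|sqnorm x `^ c'| <= a `^ c' + b `^ c'.
  move=> /hD /andP[ax xb]; rewrite ger0_norm ?powR_ge0//.
  have x0 : 0 < sqnorm x by rewrite (lt_le_trans a0).
  have [c0|c0] := leP 0 c'.
    rewrite (@le_trans _ _ (b `^ c'))// ?lerDr ?powR_ge0//.
    by rewrite ge0_ler_powR// nnegrE ?(le_trans (ltW x0))// ltW.
  rewrite (@le_trans _ _ (a `^ c'))// ?lerDl ?powR_ge0//.
  rewrite -(opprK c') !(powRN _ (- c')) lef_pV2 ?posrE ?powR_gt0//.
  by rewrite ge0_ler_powR// ?nnegrE ?oppr_ge0 ?ltW.
have bx x i : D x -> `|x 0 i| <= 1 + b.
  move=> /hD /andP[_ xb].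
  have : x 0 i ^+ 2 <= b.
    rewrite (le_trans _ xb)// /sqnorm (bigD1 i)//= lerDl.
    by apply: sumr_ge0 => j _; exact: sqr_ge0.
  by rewrite ler_norml => h; apply/andP; split; nra.
elim: n c => [|n IH] c; first by split=> //; eexists => t x Dx; exact: bd.
split; first by eexists => t x Dx; exact: bd.
move=> i; exists (fun _ x => c * sqnorm x `^ (c - 1) * (2 * x 0 i)); split.
  move=> t x /hD /andP[ax _].
  apply: (@is_derive_comp_line _ _ (fun y => y `^ c) sqnorm).
    by apply: is_derive1_powR; rewrite (lt_le_trans a0).
  exact: is_derive_sqnorm.
apply: symbolM; first exact: symbolZ.
by apply: symbolZ; apply: symbol_coord => x /bx; apply.
Qed.

Lemma exprn_le_expR (y : R) k : 0 <= y -> y ^+ k <= k%:R ^+ k * expR y.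
Proof.
move=> y0; case: k => [|k]; first by rewrite !expr0 mul1r -expR0 ler_expR.
have -> : y = k.+1%:R * (y / k.+1%:R) by rewrite mulrC divfK.
set u := y / _; have u0 : 0 <= u by rewrite divr_ge0.
rewrite exprMn ler_wpM2l ?exprn_ge0//.
rewrite mulrC expRM_natr -?mulr_natr ?expRM_natr//.
by rewrite lerXn2r ?nnegrE ?expR_ge0// (le_trans _ (expR_ge1Dx u))// lerDr.
Qed.

(** Each derivative of the exponential brings down one factor t, which the
    decay of the exponential absorbs since p is bounded below; the powers of |t|
    make the induction go through. *)
Lemma symbol_expR (D : set point) (p : point -> R) (p0 : R) n k : 0 < p0 ->
  (forall x, D x -> p0 <= p x) -> (forall n, symbol D n (fun _ : R => p)) ->
  symbol D n (fun (t : R) x => `|t| ^+ k * expR (- `|t| * p x)).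
Proof.
move=> p00 hp sp.
have bd j (t : R) x : D x -> `| `|t| ^+ j * expR (- `|t| * p x)| <= (j%:R / p0) ^+ j.
  move=> /hp px; rewrite ger0_norm ?mulr_ge0 ?exprn_ge0 ?expR_ge0//.
  have h := exprn_le_expR j (mulr_ge0 (normr_ge0 t) (ltW p00)).
  rewrite expr_div_n ler_pdivlMr ?exprn_gt0// mulrAC -exprMn.
  rewrite (le_trans (ler_wpM2r (expR_ge0 _) h))// -mulrA -expRD ler_piMr ?exprn_ge0//.
  by rewrite -[leRHS]expR0 ler_expR mulNr subr_le0 ler_wpM2l.
elim: n k => [|n IH] k; first by split => //; eexists => t x; exact: bd.
split; first by eexists => t x; exact: bd.
move=> i; have [p' [dp sp']] := (sp n.+1).2 i.
exists (fun (t : R) x => (- p' 0 x) * (`|t| ^+ k.+1 * expR (- `|t| * p x))); split; last first.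
  apply: symbolM; last exact: IH.
  apply: (@symbol_reparam _ _ _ _ (fun=> 0) (fun t x => - p' t x)).
  by under eq_fun do under eq_fun do rewrite -mulN1r; exact: symbolZ.
move=> t x Dx.
have d1 : is_derive x (e_ i) (fun y => - `|t| * p y) (- `|t| *: p' 0 x).
  by apply: (@is_deriveZ _ _ _ p (- `|t|)); exact: dp.
have d2 := @is_derive_comp_line _ _ expR (fun y : point => - `|t| * p y) x (e_ i) _ _
    (is_derive_expR _) d1.
have := is_deriveZ (`|t| ^+ k) d2.
congr is_derive; rewrite /GRing.scale/= exprS; ring.
Qed.

(** Derivatives of the cutoff vanish off D as well, because the complement of
    D is open; the product rule then stays within the class. *)
Lemma symbol_cutoff T (D : set point) n (f g : T -> point -> R) : closed D ->
  symbol setT n f -> (forall t x, ~ D x -> f t x = 0) -> symbol D n g ->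
  symbol setT n (fun t x => f t x * g t x).
Proof.
move=> cD; elim: n f g => [|n IH] f g sf f0 sg.
  have [A A0 hA] := symbol_bounded sf; have [B B0 hB] := symbol_bounded sg.
  split=> //; exists (A * B) => t x _; have [Dx|nDx] := pselect (D x).
    by rewrite normrM ler_pM ?hA ?hB.
  by rewrite f0// mul0r normr0 mulr_ge0.
have [A A0 hA] := symbol_bounded sf; have [B B0 hB] := symbol_bounded sg.
split.
  exists (A * B) => t x _; have [Dx|nDx] := pselect (D x).
    by rewrite normrM ler_pM ?hA ?hB.
  by rewrite f0// mul0r normr0 mulr_ge0.
move=> i; have [f' [df sf']] := sf.2 i; have [g' [dg sg']] := sg.2 i.
have nf t (x : point) : ~ D x -> \forall y \near x, f t y = 0.
  move=> nDx; have : open (~` D) by rewrite openC.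
  rewrite openE => /(_ x nDx); apply: filterS => y; exact: f0.
have f'0 t x : ~ D x -> f' t x = 0.
  move=> nDx; have dx := df t x I.
  have : is_derive x (e_ i) (f t) 0.
    apply: (@near_eq_is_derive _ _ _ (cst 0)) => //.
    by apply: filterS (nf t x nDx) => y ->.
  by move=> [_ <-]; case: dx => _ <-.
exists (fun t x => f t x * g' t x + g t x * f' t x); split.
  move=> t x _; have [Dx|nDx] := pselect (D x).
    by apply: is_deriveM; [exact: df|exact: dg].
  rewrite f0// f'0// mul0r mulr0 addr0.
  apply: (@near_eq_is_derive _ _ _ (cst 0)) => //.
  by apply: filterS (nf t x nDx) => y ->; rewrite mul0r.
apply: symbolD.
  by apply: IH => //; exact: symbol_pred.
rewrite (_ : (fun t x => g t x * f' t x) = fun t x => f' t x * g t x).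
  by apply: IH => //; exact: symbol_pred.
by apply/funext => t; apply/funext => x; rewrite mulrC.
Qed.

(** A first difference along e_k with step 2 / N, the mesh of the lattice on
    which symbols are sampled.  The damping 1 - 1/N is chosen so that the
    difference is still O(1/N), while 1 - r e(x_k) becomes invertible. *)
Definition damped_diff (N : nat) (k : 'I_d) (f : point -> R) : point -> R :=
  fun x => f x - (1 - N%:R^-1) * f (x - (2 / N%:R) *: e_ k).

Lemma is_derive_shift (f : point -> R) (y v : point) df (x : point) :
  is_derive (x - y) v f df -> is_derive x v (fun z => f (z - y)) df.
Proof.
move=> /is_derive_line h; apply/is_derive_line; apply: is_derive_ext h => s.
by rewrite addrA.
Qed.

Lemma MVT_line (f f' : point -> R) k (B : R) x (h : R) : 0 <= h ->
  (forall x, is_derive x (e_ k) f (f' x)) -> (forall x, `|f' x| <= B) ->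
  `|f x - f (x - h *: e_ k)| <= h * B.
Proof.
move=> h0 df bf.
pose F (s : R) := f (s *: e_ k + (x - h *: e_ k)).
have dF (s : R) : is_derive s 1 F (f' (s *: e_ k + (x - h *: e_ k))).
  have /is_derive_line H := df (s *: e_ k + (x - h *: e_ k)).
  apply/is_derive_line; apply: is_derive_ext H => u.
  have -> : u *: 1 + s = u + s by rewrite /GRing.scale/= mulr1.
  by rewrite /F scalerDl addrA.
have [|c _ E] := @MVT_segment _ F _ 0 h h0 (fun s _ => dF s).
  apply: continuous_subspaceT => s.
  by apply/differentiable_continuous/derivable1_diffP; case: (dF s).
have -> : f x - f (x - h *: e_ k) = F h - F 0.
  by congr (f _ - f _); [rewrite addrC subrK|rewrite scale0r add0r].
by rewrite E subr0 normrM mulrC (ger0_norm h0) ler_wpM2l.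
Qed.

(** The damped difference is O(1/N) by the mean value theorem, and commutes
    with derivatives.  Taking N into the parameter keeps all bounds uniform in
    N, so that differences can be iterated. *)
Lemma symbol_damped_diff T n k (g : T -> point -> R) : symbol setT n.+1 g ->
  symbol setT n (fun p : T * nat => fun x => p.2.+1%:R * damped_diff p.2.+1 k (g p.1) x).
Proof.
have bd m (u : T -> point -> R) : symbol setT m.+1 u -> exists B : R,
    forall (p : T * nat) x, `|p.2.+1%:R * damped_diff p.2.+1 k (u p.1) x| <= B.
  move=> su; have [B B0 hB] := symbol_bounded su; have [u' [du su']] := su.2 k.
  have [B' B'0 hB'] := symbol_bounded (su' : symbol setT m u').
  exists (B + 2 * B') => -[t N] x /=.
  have h0 : 0 <= 2 / N.+1%:R :> R by rewrite divr_ge0.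
  have := @MVT_line (u t) (u' t) k B' x _ h0 (fun x => du t x I) (fun x => hB' t x I).
  set y := x - _ => H.
  have -> : N.+1%:R * damped_diff N.+1 k (u t) x = u t y + N.+1%:R * (u t x - u t y).
    by rewrite /damped_diff -/y; field; rewrite gt_eqF.
  rewrite (le_trans (ler_normD _ _))// lerD// ?hB// normrM ger0_norm//.
  rewrite (le_trans (ler_wpM2l _ H))// mulrA mulrCA mulfV ?gt_eqF// mulr1//.
elim: n g => [|n IH] g sg.
  by have [B hB] := bd 0%N g sg; split=> //; exists B => p x _.
split; first by have [B hB] := bd _ g sg; exists B => p x _.
move=> i; have [g' [dg sg']] := sg.2 i.
exists (fun p x => p.2.+1%:R * damped_diff p.2.+1 k (g' p.1) x); split; last exact: IH.
move=> [t N] x _ /=; apply: is_deriveZ; apply: is_deriveB; first exact: dg.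
by apply: is_deriveZ; apply: is_derive_shift; exact: dg.
Qed.

Definition damped_diffs N (ks : seq 'I_d) (f : point -> R) : point -> R :=
  foldl (fun f k => damped_diff N k f) f ks.

Lemma damped_diffsZ N ks c f x :
  damped_diffs N ks (fun x => c * f x) x = c * damped_diffs N ks f x.
Proof.
rewrite /damped_diffs; elim: ks f x => [//|k ks IH] f x /=.
rewrite -IH; congr (foldl _ _ _ _); apply/funext => y.
by rewrite /damped_diff; ring.
Qed.

Lemma symbol_damped_diffs T (ks : seq 'I_d) (g : T -> point -> R) :
  symbol setT (size ks) g -> exists2 B : R, 0 <= B & forall t N x,
    `|damped_diffs N.+1 ks (g t) x| <= B / N.+1%:R ^+ size ks.
Proof.
suff : forall (T : Type) (g : T -> point -> R), symbol setT (size ks) g ->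
  exists2 B : R, 0 <= B & forall t N x,
    `|N.+1%:R ^+ size ks * damped_diffs N.+1 ks (g t) x| <= B.
  move=> /(_ T g) + sg => /(_ sg) [B B0 hB]; exists B => // t N x.
  by rewrite ler_pdivlMr ?exprn_gt0// mulrC -[X in X * _]ger0_norm ?exprn_ge0// -normrM.
elim: ks => [|k ks IH] {}T {}g sg.
  have [B B0 hB] := symbol_bounded sg.
  by exists B => // t N x; rewrite expr0 mul1r; exact: hB.
have [B B0 hB] := IH _ _ (symbol_damped_diff k sg).
exists B => // t N x; have := hB (t, N) N x.
by rewrite damped_diffsZ mulrA -exprSr.
Qed.

End symbols.

(** * Kernels of trigonometric multipliers *)

Section trigonometric_polynomials.
Context {R : realType} {d : nat}.
Local Notation point := 'rV[R]_d.
Local Notation freq := 'rV[int]_d.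
Local Notation mu := (torus_measure R d).
Local Notation normc := ComplexField.Normc.normc.

Definition box (K : nat) : seq freq :=
  [seq \row_i ((f i : nat)%:Z - K%:Z) | f : {ffun 'I_d -> 'I_(K.*2.+1)}].

Lemma size_box K : size (box K) = (K.*2.+1 ^ d)%N.
Proof. by rewrite size_image card_ffun !card_ord. Qed.

Lemma box_uniq K : uniq (box K).
Proof.
rewrite map_inj_uniq ?enum_uniq// => f g /rowP E.
apply/ffunP => i; have := E i; rewrite !mxE => /addIr [] ?; exact/val_inj.
Qed.

Definition inbox (K : nat) (l : freq) := forall i, (absz (l 0%R i) <= K)%N.

Lemma mem_box K (l : freq) : inbox K l -> l \in box K.
Proof.
move=> lK; apply/codomP.
have h i : (absz (l 0%R i + K%:Z)%R < K.*2.+1)%N by have := lK i; rewrite -addnn; lia.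
exists [ffun i => Ordinal (h i)] ; apply/rowP => i; rewrite !mxE ffunE /=.
have := lK i; lia.
Qed.

Lemma fsum_box (V : nmodType) K (F : freq -> V) :
  (forall l, F l != 0 -> inbox K l) ->
  \sum_(l \in [set: freq]) F l = \sum_(l <- box K) F l.
Proof.
move=> FK; rewrite (fsbigE (box K))//; first last.
- by move=> l _; apply: contraNeq => /FK; exact: mem_box.
- exact: box_uniq.
by apply: eq_bigl => l; rewrite mem_set.
Qed.

Lemma fsum_shift (V : nmodType) (m : freq) (F : freq -> V) :
  \sum_(l \in [set: freq]) F (l - m) = \sum_(l \in [set: freq]) F l.
Proof.
rewrite [RHS](reindex_fsbigT (fun l : freq => l - m))//.
by exists (fun l => l + m) => l; rewrite ?addrK ?subrK.
Qed.

Lemma characterD (l m : freq) (x : point) :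
  character (l + m) x = character l x * character m x.
Proof.
apply/eqP; rewrite eq_complex; apply/andP; split; apply/eqP.
  exact: coslDl.
by rewrite [RHS]addrC; exact: sinlDl.
Qed.

Lemma normc_character (l : freq) (x : point) : normc (character l x) = 1.
Proof. by rewrite /= cos2Dsin2 sqrtr1. Qed.

Lemma character0 (x : point) : character 0 x = 1.
Proof. by rewrite /character dotp0l mulr0 cos0 sin0. Qed.

Lemma characterMn (l : freq) n (x : point) : character (l *+ n) x = character l x ^+ n.
Proof.
elim: n => [|n IH]; first by rewrite mulr0n character0 expr0.
by rewrite mulrS characterD IH exprS.
Qed.

Lemma normc_sqr (z : R[i]) : normc z ^+ 2 = complex.Re z ^+ 2 + complex.Im z ^+ 2.
Proof. by case: z => a b; rewrite sqr_sqrtr// addr_ge0 ?sqr_ge0. Qed.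

Lemma normc_ge0 (z : R[i]) : 0 <= normc z.
Proof. by case: z => a b; exact: sqrtr_ge0. Qed.

Lemma normcX (z : R[i]) n : normc (z ^+ n) = normc z ^+ n.
Proof.
elim: n => [|n IH]; first by rewrite !expr0 ComplexField.Normc.normc1.
by rewrite !exprS ComplexField.Normc.normcM IH.
Qed.

Lemma normcR (a : R) : normc a%:C%C = `|a|.
Proof. by rewrite /= expr0n addr0 sqrtr_sqr. Qed.

Lemma Re_sum I (s : seq I) (F : I -> R[i]) :
  complex.Re (\sum_(i <- s) F i) = \sum_(i <- s) complex.Re (F i).
Proof.
elim: s => [|i s IH]; first by rewrite !big_nil.
by rewrite !big_cons -IH; case: (F i); case: (\sum_(_ <- _) _).
Qed.

Lemma Im_sum I (s : seq I) (F : I -> R[i]) :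
  complex.Im (\sum_(i <- s) F i) = \sum_(i <- s) complex.Im (F i).
Proof.
elim: s => [|i s IH]; first by rewrite !big_nil.
by rewrite !big_cons -IH; case: (F i); case: (\sum_(_ <- _) _).
Qed.

Lemma ReMr (a : R) (z : R[i]) : complex.Re (a%:C%C * z) = a * complex.Re z.
Proof. by case: z => u v /=; rewrite mul0r subr0. Qed.

Lemma ImMr (a : R) (z : R[i]) : complex.Im (a%:C%C * z) = a * complex.Im z.
Proof. by case: z => u v /=; rewrite mul0r addr0. Qed.

(** Stated for a kernel centred at an arbitrary point x, the form in which
    convolutions present it. *)
Lemma parseval (s : seq freq) (a : freq -> R) (x : point) : uniq s ->
  \int[mu]_y normc (\sum_(l <- s) (a l)%:C%C * character l (x - y)) ^+ 2 =
  \sum_(l <- s) a l ^+ 2.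
Proof.
move=> us.
under eq_Rintegral => y _.
  rewrite normc_sqr Re_sum Im_sum.
  rewrite (eq_bigr (fun l => a l * cosl l (x - y))); last by move=> l _; rewrite ReMr.
  rewrite [X in _ + X ^+ 2](eq_bigr (fun l => a l * sinl l (x - y))); last first.
    by move=> l _; rewrite ImMr.
  rewrite (_ : _ + _ = \sum_(l <- s) \sum_(m <- s) (a l * a m *
       (cosl (l - m) x * cosl (l - m) y + sinl (l - m) x * sinl (l - m) y))).
    over.
  rewrite !expr2 !big_distrl -big_split; apply: eq_bigr => l _.
  rewrite !big_distrr -big_split; apply: eq_bigr => m _.
  by rewrite -coslBr coslBl /=; ring.
have bF l m : bmeas (fun y => a l * a m *
   (cosl (l - m) x * cosl (l - m) y + sinl (l - m) x * sinl (l - m) y)).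
  by apply/bmeasZ/bmeasD; apply: bmeasZ; [exact: bmeas_cosl|exact: bmeas_sinl].
rewrite Rintegral_sum_bmeas; last by move=> l; exact: bmeas_sum.
apply: eq_big_seq => l ls; rewrite Rintegral_sum_bmeas//.
have E m : \int[mu]_y (a l * a m *
   (cosl (l - m) x * cosl (l - m) y + sinl (l - m) x * sinl (l - m) y)) =
   (l == m)%:R * (a l * a m).
  have bc := bmeas_cosl (R := R); have bs := bmeas_sinl (R := R).
  rewrite RintegralZ_bmeas; last by apply: bmeasD; exact: bmeasZ.
  rewrite RintegralD_bmeas; [|exact: bmeasZ..].
  rewrite !RintegralZ_bmeas//; have [-> ->] := @Rintegral_character R _ (l - m).
  rewrite mulr0 addr0 subr_eq0; case: eqP => [->|_]; last by rewrite !mulr0 mul0r.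
  by rewrite subrr /cosl dotp0l mulr0 cos0 !mulr1 mul1r.
under eq_bigr do rewrite E.
rewrite (bigD1_seq l)//= eqxx mul1r big1_seq ?addr0 ?expr2// => m /andP[ml _].
by rewrite eq_sym (negbTE ml) mul0r.
Qed.

(** The convolution kernel of the multiplier with coefficients a. *)
Definition tpoly (a : freq -> R) (x : point) : R[i] :=
  \sum_(l \in [set: freq]) (a l)%:C%C * character l x.

Lemma tpoly_box K (a : freq -> R) x : (forall l, a l != 0 -> inbox K l) ->
  tpoly a x = \sum_(l <- box K) (a l)%:C%C * character l x.
Proof.
move=> aK; apply: fsum_box => l h; apply: aK; apply: contra_neq h => ->.
by rewrite mul0r.
Qed.

(** Multiplication by a character shifts the coefficients. *)
Lemma tpoly_damp K (a : freq -> R) (r : R) (k : 'I_d) (x : point) :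
  (forall l, a l != 0 -> inbox K l) ->
  (1 - r%:C%C * character (delta_mx 0 k) x) * tpoly a x =
  tpoly (fun l => a l - r * a (l - delta_mx 0 k)) x.
Proof.
move=> aK; have K1 (l : freq) i : (absz ((l - delta_mx 0%R k)%R 0%R i) <= K)%N -> (absz (l 0%R i) <= K.+1)%N.
  by rewrite !mxE; case: (_ && _) => /=; rewrite ?mulr1n ?mulr0n; lia.
rewrite (@tpoly_box K.+1 (fun l => a l - r * a (l - delta_mx 0 k))); last first.
  move=> l + i; have [al|/aK aK'] := eqVneq (a l) 0.
    have [->|/aK h _] := eqVneq (a (l - delta_mx 0 k)) 0; first by rewrite al mulr0 subrr eqxx.
    exact: K1.
  by move=> _; exact: leqW.
rewrite mulrBl mul1r.
under eq_bigr do rewrite rmorphB rmorphM/= mulrBl.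
rewrite big_split/= sumrN; congr (_ - _).
  by apply: tpoly_box => l /aK h i; exact: leqW.
rewrite /tpoly -(fsum_shift (delta_mx 0 k)) (@fsum_box _ K.+1); last first.
  move=> l h i; apply: K1; apply: aK; apply: contra_neq h => ->.
  by rewrite mul0r.
rewrite big_distrr/=; apply: eq_bigr => l _.
by rewrite mulrACA -characterD [delta_mx _ _ + _]addrC subrK.
Qed.

(** The coefficients obtained by reading a symbol at scale 1/h. *)
Definition lattice (h : R) (f : point -> R) : freq -> R := fun l => f (h *: real_freq l).

Lemma tpoly_damped_diffs (N K : nat) (ks : seq 'I_d) (f : point -> R) (x : point) :
  (0 < N)%N -> (forall l, lattice (2 / N%:R) f l != 0 -> inbox K l) ->
  (forall l, lattice (2 / N%:R) (damped_diffs N ks f) l != 0 -> inbox (K + size ks) l) /\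
  \prod_(k <- ks) (1 - (1 - N%:R^-1)%:C%C * character (delta_mx 0 k) x) *
    tpoly (lattice (2 / N%:R) f) x =
  tpoly (lattice (2 / N%:R) (damped_diffs N ks f)) x.
Proof.
move=> N0; elim: ks K f => [|k ks IH] K f fK.
  by rewrite big_nil mul1r addn0.
have E (l : freq) : lattice (2 / N%:R) (damped_diff N k f) l =
    lattice (2 / N%:R) f l - (1 - N%:R^-1) * lattice (2 / N%:R) f (l - delta_mx 0 k).
  rewrite /lattice /damped_diff; congr (_ - _ * f _).
  apply/rowP => i; rewrite !mxE rmorphB/= mulrBr; congr (_ - _ * _).
  by case: (_ == _).
have [|h1 h2] := IH K.+1 (damped_diff N k f).
  move=> l; rewrite E => + i; have [al|/fK aK'] := eqVneq (lattice (2 / N%:R) f l) 0.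
    have [->|/fK h _] := eqVneq (lattice (2 / N%:R) f (l - delta_mx 0 k)) 0.
      by rewrite al mulr0 subrr eqxx.
    by have := h i; rewrite !mxE; case: (_ && _) => /=; rewrite ?mulr1n ?mulr0n; lia.
  by move=> _; exact: leqW.
split; first by move=> l hl; have := h1 l hl; rewrite addSnnS.
rewrite big_cons -mulrA mulrCA (tpoly_damp _ _ _ fK) -[RHS]h2; congr (_ * _).
by rewrite (_ : (fun l => _) = lattice (2 / N%:R) (damped_diff N k f))//; apply/funext => l; rewrite E.
Qed.

(** Bernoulli gives (1 + 1/N)^N >= 2, and (1 - 1/N)(1 + 1/N) <= 1. *)
Lemma damping_le_half (N : nat) : (1 - N.+1%:R^-1) ^+ N.+1 <= 1 / 2 :> R.
Proof.
set u : R := N.+1%:R^-1.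
have u0 : 0 < u by rewrite invr_gt0.
have u1 : u <= 1 by rewrite invf_le1 ?ler1n.
have h2 k : 1 + u *+ k <= (1 + u) ^+ k.
  elim: k => [|k IH]; first by rewrite mulr0n addr0 expr0.
  rewrite exprS; apply: (@le_trans _ _ ((1 + u) * (1 + u *+ k))); last first.
    by rewrite ler_wpM2l//; lra.
  rewrite mulrS; have : 0 <= u * (u *+ k) by rewrite mulr_ge0 ?mulrn_wge0 ?ltW.
  by nra.
have h3 : 2 <= (1 + u) ^+ N.+1.
  apply: le_trans (h2 N.+1); rewrite -(mulr_natr u) mulVf ?pnatr_eq0//; lra.
have h1 : (1 - u) ^+ N.+1 * (1 + u) ^+ N.+1 <= 1 by rewrite -exprMn exprn_ile1//; nra.
have h4 : 0 <= (1 - u) ^+ N.+1 by rewrite exprn_ge0// subr_ge0.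
by nra.
Qed.

(** The geometric series inverting the factors 1 - r e(x_k), truncated after N
    terms and multiplied out. *)
Definition partial_inverse (N : nat) (x : point) : R[i] :=
  \prod_(k < d) \sum_(i < N.+1)
    ((1 - N.+1%:R^-1)%:C%C * character (delta_mx 0 k) x) ^+ i.

Lemma normc_prod I (s : seq I) (F : I -> R[i]) :
  normc (\prod_(i <- s) F i) = \prod_(i <- s) normc (F i).
Proof.
elim: s => [|i s IH]; first by rewrite !big_nil ComplexField.Normc.normc1.
by rewrite !big_cons ComplexField.Normc.normcM IH.
Qed.

(** The truncated series inverts 1 - r e(x_k) up to r^N, which is at most
    1/2. *)
Lemma partial_inverse_lower N (x : point) :
  (1 / 2) ^+ d <= normc (\prod_(k <- enum 'I_d)
      (1 - (1 - N.+1%:R^-1)%:C%C * character (delta_mx 0 k) x) * partial_inverse N x).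
Proof.
rewrite big_enum /partial_inverse -big_split/= normc_prod.
have -> : (1 / 2) ^+ d = \prod_(k < d) (1 / 2 : R) by rewrite prodr_const card_ord.
apply: ler_prod => k _; apply/andP; split; first by rewrite divr_ge0.
set z : R[i] := _ * character _ x.
have E : (1 - z) * (\sum_(i < N.+1) z ^+ i) = 1 - z ^+ N.+1.
  by have := subrX1 z N.+1; set S := \sum_(i < _) _ => H; rewrite -[RHS]opprB H; ring.
rewrite [X in normc X]E.
have nz : normc (z ^+ N.+1) <= 1 / 2.
  rewrite normcX ComplexField.Normc.normcM normc_character mulr1 normcR ger0_norm.
    exact: damping_le_half.
  by rewrite subr_ge0 invf_le1 ?ler1n.
have := le_normcD (1 - z ^+ N.+1) (z ^+ N.+1).
rewrite subrK ComplexField.Normc.normc1; lra.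
Qed.

Lemma partial_inverse_sum N : exists (s : seq freq) (a : freq -> R),
  [/\ uniq s, size s = (N.+1 ^ d)%N, forall l, a l ^+ 2 <= 1 &
    forall z, partial_inverse N z = \sum_(l <- s) (a l)%:C%C * character l z].
Proof.
set r : R := 1 - N.+1%:R^-1.
have r01 : 0 <= r <= 1.
  by rewrite subr_ge0 invf_le1 ?ler1n//= lerBlDr lerDl invr_ge0.
pose s : seq freq := [seq \row_i (f i : nat)%:Z | f : {ffun 'I_d -> 'I_N.+1}].
have us : uniq s.
  rewrite map_inj_uniq ?enum_uniq// => f g /rowP E.
  by apply/ffunP => i; have := E i; rewrite !mxE => -[] ?; exact/val_inj.
exists s, (fun l => \prod_i r ^+ absz (l 0%R i)); split => //.
- by rewrite size_image card_ffun !card_ord.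
- move=> l; rewrite exprn_ile1//.
    by apply: prodr_ge0 => i _; rewrite exprn_ge0//; case/andP: r01.
  by apply: prodr_ile1 => i _; have /andP[r0 r1] := r01; rewrite exprn_ge0// exprn_ile1.
have E (z : point) : partial_inverse N z =
    \sum_(l <- s) (\prod_i r ^+ absz (l 0%R i))%:C%C * character l z.
  rewrite /partial_inverse bigA_distr_bigA/= big_map big_enum/=; apply: eq_bigr => f _.
  rewrite rmorph_prod/=.
  have -> : character (\row_i (f i : nat)%:Z) z =
      \prod_(k < d) character (delta_mx 0 k) z ^+ f k.
    under eq_bigr do rewrite -characterMn.
    rewrite -(big_morph (fun l => character l z) (fun l m => characterD l m z) (character0 z)).
    congr character; apply/rowP => i; rewrite mxE summxE (bigD1 i)//= big1 ?addr0.
      by rewrite mulmxnE mxE !eqxx/= mulr1n natz.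
    by move=> k ki; rewrite mulmxnE mxE eq_sym (negbTE ki) andbF mul0rn.
  rewrite -big_split/=; apply: eq_bigr => k _.
  by rewrite mxE/= exprMn rmorphXn.
exact: E.
Qed.

Lemma Rintegral_partial_inverse N (x : point) :
  \int[mu]_y normc (partial_inverse N (x - y)) ^+ 2 <= N.+1%:R ^+ d.
Proof.
have [s [a [us ss a1 E]]] := partial_inverse_sum N.
under eq_Rintegral do rewrite E.
rewrite parseval// (@le_trans _ _ (\sum_(l <- s) 1))//; first exact: ler_sum.
by rewrite big_const_seq count_predT iter_addr_0 ss natrX.
Qed.

Lemma bmeas_comp_sub (f : point -> R) (x : point) :
  bmeas f -> bmeas (fun y : point => f (x - y)).
Proof.
move=> [mf [B bf]]; split; last by exists B => y; exact: bf.
apply: measurableT_comp => //; apply: measurable_row => i.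
under eq_fun do rewrite !mxE.
by apply: measurable_funB => //; exact: measurable_coord.
Qed.

Lemma Re_tpoly K a x : (forall l, a l != 0 -> inbox K l) ->
  complex.Re (tpoly a x) = \sum_(l <- box K) a l * cosl l x.
Proof. by move=> aK; rewrite (tpoly_box _ aK) Re_sum; apply: eq_bigr => l _; rewrite ReMr. Qed.

Lemma Im_tpoly K a x : (forall l, a l != 0 -> inbox K l) ->
  complex.Im (tpoly a x) = \sum_(l <- box K) a l * sinl l x.
Proof. by move=> aK; rewrite (tpoly_box _ aK) Im_sum; apply: eq_bigr => l _; rewrite ImMr. Qed.

Lemma bmeas_normc (F : point -> R[i]) :
  bmeas (fun y => complex.Re (F y)) -> bmeas (fun y => complex.Im (F y)) ->
  bmeas (fun y => normc (F y)).
Proof.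
move=> bR bI.
have [mS [B bS]] : bmeas (fun y => complex.Re (F y) * complex.Re (F y) +
    complex.Im (F y) * complex.Im (F y)) by apply: bmeasD; exact: bmeasM.
have E y : normc (F y) = Num.sqrt (complex.Re (F y) * complex.Re (F y) +
    complex.Im (F y) * complex.Im (F y)) by rewrite -!expr2; case: (F y).
split.
  under eq_fun do rewrite E.
  by apply: measurableT_comp => //; apply: continuous_measurable_fun => z; exact: sqrt_continuous.
exists (Num.sqrt B) => y; rewrite ger0_norm ?normc_ge0// E ler_wsqrtr//.
by rewrite (le_trans _ (bS y))// ler_norm.
Qed.

Lemma bmeas_normc_tpoly K a : (forall l, a l != 0 -> inbox K l) ->
  bmeas (fun y => normc (tpoly a y)).
Proof.
move=> aK; apply: bmeas_normc.
  under eq_fun do rewrite (Re_tpoly _ aK).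
  by apply: bmeas_sum => l; apply: bmeasZ; exact: bmeas_cosl.
under eq_fun do rewrite (Im_tpoly _ aK).
by apply: bmeas_sum => l; apply: bmeasZ; exact: bmeas_sinl.
Qed.

Lemma bmeas_normc_sum (s : seq freq) (a : freq -> R) :
  bmeas (fun y : point => normc (\sum_(l <- s) (a l)%:C%C * character l y)).
Proof.
apply: bmeas_normc.
  under eq_fun do rewrite Re_sum.
  apply: bmeas_sum => l; under eq_fun do rewrite ReMr.
  by apply: bmeasZ; exact: bmeas_cosl.
under eq_fun do rewrite Im_sum.
apply: bmeas_sum => l; under eq_fun do rewrite ImMr.
by apply: bmeasZ; exact: bmeas_sinl.
Qed.

Lemma le_Rintegral_bmeas (f g : point -> R) : bmeas f -> bmeas g ->
  (forall x, f x <= g x) -> \int[mu]_x f x <= \int[mu]_x g x.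
Proof. by move=> bf bg fg; apply: le_Rintegral => //; exact: bmeas_integrable. Qed.

Lemma lattice_inbox c N (f : point -> R) :
  (forall x, f x != 0 -> forall i, `|x 0 i| <= c%:R) ->
  forall l, lattice (2 / N.+1%:R) f l != 0 -> inbox (c * N.+1) l.
Proof.
move=> fc l /fc h i; have := h i; rewrite !mxE normrM -intr_norm.
have N0 : 0 < 2 / N.+1%:R :> R by rewrite divr_gt0.
rewrite (gtr0_norm N0) -ler_pdivlMl// invf_div => h'.
rewrite -(ler_nat R) natrM (_ : (absz (l 0 i))%:R = (`|l 0 i|%R)%:~R); last by rewrite -abszE.
rewrite (le_trans h')// mulrC ler_wpM2l// ler_piMr// invf_le1//.
by rewrite ler1n.
Qed.

(** Let k be the kernel and Q the product of the factors 1 - r e(x_k).  The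
    coefficients of k Q are damped differences of the symbol in all d directions,
    of size O(N^-d) on O(N^d) frequencies.  As Q H is bounded below for the
    partial inverse H of Q, k is dominated by (k Q) H, a product of two functions
    whose L^2 norms are O(N^(-d/2)) and O(N^(d/2)) by Parseval. *)
Theorem kernel_L1 (T : Type) (c : nat) (g : T -> point -> R) :
  symbol setT d g ->
  (forall t x, g t x != 0 -> forall i, `|x 0 i| <= c%:R) ->
  exists2 C : R, 0 <= C & forall t N x,
    \int[mu]_y normc (tpoly (lattice (2 / N.+1%:R) (g t)) (x - y)) <= C.
Proof.
move=> sg gc.
have [|B B0 hB] := @symbol_damped_diffs R d T (enum 'I_d) g.
  by rewrite size_enum_ord.
pose D : R := (2 * (c + d) + 1)%N%:R.
exists (2 ^+ d * (2^-1 * (D ^+ d * B ^+ 2 + 1))).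
  by rewrite !mulr_ge0 ?exprn_ge0 ?addr_ge0 ?mulr_ge0 ?exprn_ge0// ler0n.
move=> t N x; set M : R := N.+1%:R.
have M0 : 0 < M by rewrite ltr0n.
set f := g t; have fK := @lattice_inbox c N f (gc t).
pose K2 := ((c + d) * N.+1)%N.
pose b := lattice (2 / M) (damped_diffs N.+1 (enum 'I_d) f).
have bK l : b l != 0 -> inbox K2 l.
  have [h _] := @tpoly_damped_diffs N.+1 (c * N.+1) (enum 'I_d) f 0 isT fK.
  move=> /h {}h i; rewrite (leq_trans (h i))// size_enum_ord /K2 mulnDl leq_add2l.
  by rewrite leq_pmulr.
(* 2^-d |k| <= |k Q| |H|, and the inequality of the means with weight M^d
   separates the two factors. *)
have key y : normc (tpoly (lattice (2 / M) f) y) <=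
    2 ^+ d * (2^-1 * (M ^+ d * normc (tpoly b y) ^+ 2 +
              M ^- d * normc (partial_inverse N y) ^+ 2)).
  have [_ E] := @tpoly_damped_diffs N.+1 (c * N.+1) (enum 'I_d) f y isT fK.
  have := partial_inverse_lower N y.
  set Q := \prod_(k <- _) _ in E *; set H := partial_inverse N y.
  rewrite -/M -/b in E; rewrite ComplexField.Normc.normcM => low.
  have E' : normc Q * normc (tpoly (lattice (2 / M) f) y) = normc (tpoly b y).
    by rewrite -ComplexField.Normc.normcM E.
  set a := normc (tpoly (lattice _ _) _) in E' *.
  have a0 : 0 <= a by exact: normc_ge0.
  have d0 : 0 < 2 ^+ d :> R by rewrite exprn_gt0.
  have -> : a = 2 ^+ d * ((1 / 2) ^+ d * a).
    by rewrite mulrA -exprMn mulrCA mulfV// mulr1 expr1n mul1r.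
  rewrite ler_pM2l// (le_trans (ler_wpM2r a0 low))// mulrAC E'.
  set u := normc (tpoly b y); set v := normc H.
  have m0 : 0 < M ^+ d by rewrite exprn_gt0.
  have mV : M ^+ d * M ^- d = 1 by rewrite mulfV// gt_eqF.
  set m := M ^+ d in m0 mV *; set m' := M ^- d in mV *.
  have m'0 : 0 <= m' by rewrite invr_ge0 ltW.
  have : 0 <= m' * (m * u - v) ^+ 2 by rewrite mulr_ge0// sqr_ge0.
  rewrite (_ : m' * _ = (m * m') * m * u ^+ 2 - 2 * (m * m') * u * v + m' * v ^+ 2); last by ring.
  rewrite mV; lra.
have bb : bmeas (fun y : point => normc (tpoly b (x - y)) ^+ 2).
  have := bmeas_comp_sub x (bmeas_normc_tpoly bK) => h.
  by under eq_fun do rewrite expr2; exact: bmeasM.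
have bH : bmeas (fun y : point => normc (partial_inverse N (x - y)) ^+ 2).
  have [s [v [_ _ _ E]]] := partial_inverse_sum N.
  under eq_fun do rewrite E expr2.
  by apply: bmeasM; exact: (bmeas_comp_sub x (bmeas_normc_sum s v)).
have bl : bmeas (fun y : point => normc (tpoly (lattice (2 / M) f) (x - y))).
  exact: bmeas_comp_sub x (bmeas_normc_tpoly fK).
apply: (le_trans (le_Rintegral_bmeas bl _ (fun y => key (x - y)))).
  by apply/bmeasZ/bmeasZ/bmeasD; exact: bmeasZ.
rewrite RintegralZ_bmeas; last by apply/bmeasZ/bmeasD; exact: bmeasZ.
rewrite RintegralZ_bmeas; last by apply/bmeasD; exact: bmeasZ.
rewrite RintegralD_bmeas; [|exact: bmeasZ..].
rewrite !RintegralZ_bmeas//.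
rewrite ler_wpM2l ?exprn_ge0// ler_wpM2l// lerD//; last first.
  rewrite mulrC ler_pdivrMr ?exprn_gt0// mul1r; exact: Rintegral_partial_inverse.
under eq_Rintegral do rewrite (tpoly_box _ bK).
rewrite parseval ?box_uniq//.
apply: (@le_trans _ _ (M ^+ d * \sum_(l <- box K2) (B / M ^+ d) ^+ 2)).
  apply: ler_wpM2l; first by rewrite exprn_ge0// ltW.
  apply: ler_sum => l _.
  rewrite -(real_normK (num_real (b l))) lerXn2r ?nnegrE ?divr_ge0 ?(ltW (exprn_gt0 _ M0))//.
  by have := hB t N ((2 / M) *: real_freq l); rewrite size_enum_ord.
rewrite big_const_seq count_predT iter_addr_0 size_box -mulr_natl.
have -> : M ^+ d * ((K2.*2.+1 ^ d)%N%:R * (B / M ^+ d) ^+ 2) =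
   (K2.*2.+1 ^ d)%N%:R / M ^+ d * B ^+ 2.
  by field; rewrite gt_eqF ?exprn_gt0.
rewrite ler_wpM2r ?sqr_ge0// ler_pdivrMr ?exprn_gt0// natrX -exprMn lerXn2r ?nnegrE//.
  by rewrite mulr_ge0 ?ler0n.
by rewrite /D /M -natrM ler_nat /K2; nia.
Qed.

End trigonometric_polynomials.

(** * Multipliers on bounded functions *)

Section multipliers.
Context {R : realType} {d : nat}.
Local Notation point := 'rV[R]_d.
Local Notation freq := 'rV[int]_d.
Local Notation mu := (torus_measure R d).
Local Notation normc := ComplexField.Normc.normc.

(** The multiplier a applied to the distribution of coefficients z. *)
Definition fmul (a : freq -> R) (z : freq -> R[i]) (x : point) : R[i] :=
  \sum_(l \in [set: freq]) (a l)%:C%C * z l * character l x.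

Definition finsupp (a : freq -> R) := exists K, forall l, a l != 0 -> inbox K l.

Lemma fmul_box K a z x : (forall l, a l != 0 -> inbox K l) ->
  fmul a z x = \sum_(l <- box K) (a l)%:C%C * z l * character l x.
Proof.
move=> aK; apply: fsum_box => l h; apply: aK; apply: contra_neq h => ->.
by rewrite !mul0r.
Qed.

Lemma Re_fmul K a z x : (forall l, a l != 0 -> inbox K l) ->
  complex.Re (fmul a z x) = \sum_(l <- box K)
    a l * (complex.Re (z l) * cosl l x - complex.Im (z l) * sinl l x).
Proof.
move=> aK; rewrite (fmul_box _ _ aK) Re_sum; apply: eq_bigr => l _.
by rewrite -mulrA ReMr; case: (z l).
Qed.

Lemma Im_fmul K a z x : (forall l, a l != 0 -> inbox K l) ->
  complex.Im (fmul a z x) = \sum_(l <- box K)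
    a l * (complex.Re (z l) * sinl l x + complex.Im (z l) * cosl l x).
Proof.
move=> aK; rewrite (fmul_box _ _ aK) Im_sum; apply: eq_bigr => l _.
by rewrite -mulrA ImMr; case: (z l).
Qed.

Lemma Re_fourier_coef (u : point -> R) l :
  complex.Re (fourier_coef (dist_of_fun u) l) = \int[mu]_y (u y * cosl l y).
Proof. by []. Qed.

Lemma Im_fourier_coef (u : point -> R) l :
  complex.Im (fourier_coef (dist_of_fun u) l) = - \int[mu]_y (u y * sinl l y).
Proof. by []. Qed.

Lemma Re_fmul_convolution a u x : finsupp a -> bmeas u ->
  complex.Re (fmul a (fourier_coef (dist_of_fun u)) x) =
  \int[mu]_y (u y * complex.Re (tpoly a (x - y))).
Proof.
move=> [K aK] bu; rewrite (Re_fmul _ _ aK).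
under [RHS]eq_Rintegral do rewrite (Re_tpoly _ aK) big_distrr/=.
rewrite Rintegral_sum_bmeas; last first.
  by move=> l; apply: bmeasM => //; apply: bmeasZ; exact: (bmeas_comp_sub x (bmeas_cosl l)).
apply: eq_bigr => l _; rewrite Re_fourier_coef Im_fourier_coef.
have bC : bmeas (fun y => u y * cosl l y) by apply: bmeasM => //; exact: bmeas_cosl.
have bS : bmeas (fun y => u y * sinl l y) by apply: bmeasM => //; exact: bmeas_sinl.
rewrite mulNr opprK [X in a l * (X + _)]mulrC [X in a l * (_ + X)]mulrC.
rewrite -!RintegralZ_bmeas// -RintegralD_bmeas; [|exact: bmeasZ..].
rewrite -RintegralZ_bmeas; last by apply: bmeasD; exact: bmeasZ.
by apply: eq_Rintegral => y _; rewrite coslBr; ring.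
Qed.

Lemma Im_fmul_convolution a u x : finsupp a -> bmeas u ->
  complex.Im (fmul a (fourier_coef (dist_of_fun u)) x) =
  \int[mu]_y (u y * complex.Im (tpoly a (x - y))).
Proof.
move=> [K aK] bu; rewrite (Im_fmul _ _ aK).
under [RHS]eq_Rintegral do rewrite (Im_tpoly _ aK) big_distrr/=.
rewrite Rintegral_sum_bmeas; last first.
  by move=> l; apply: bmeasM => //; apply: bmeasZ; exact: (bmeas_comp_sub x (bmeas_sinl l)).
apply: eq_bigr => l _; rewrite Re_fourier_coef Im_fourier_coef.
have bC : bmeas (fun y => u y * cosl l y) by apply: bmeasM => //; exact: bmeas_cosl.
have bS : bmeas (fun y => u y * sinl l y) by apply: bmeasM => //; exact: bmeas_sinl.
rewrite mulNr [X in a l * (X - _)]mulrC [X in a l * (_ - X)]mulrC.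
rewrite -!RintegralZ_bmeas// -RintegralB_bmeas; [|exact: bmeasZ..].
rewrite -RintegralZ_bmeas; last by apply: bmeasB; exact: bmeasZ.
by apply: eq_Rintegral => y _; rewrite sinlBr; ring.
Qed.

Lemma normc_Re (z : R[i]) : `|complex.Re z| <= normc z.
Proof.
by case: z => a b /=; rewrite -sqrtr_sqr ler_wsqrtr// lerDl sqr_ge0.
Qed.

Lemma normc_Im (z : R[i]) : `|complex.Im z| <= normc z.
Proof.
by case: z => a b /=; rewrite -sqrtr_sqr ler_wsqrtr// lerDr sqr_ge0.
Qed.

(** A multiplier is the convolution with its kernel. *)
Lemma fmul_le_L1 a u (U : R) x : finsupp a -> bmeas u -> (forall y, `|u y| <= U) ->
  let k := \int[mu]_y normc (tpoly a (x - y)) in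
  `|complex.Re (fmul a (fourier_coef (dist_of_fun u)) x)| <= U * k /\
  `|complex.Im (fmul a (fourier_coef (dist_of_fun u)) x)| <= U * k.
Proof.
move=> fa bu uU k; have [K aK] := fa.
have bk : bmeas (fun y : point => normc (tpoly a (x - y))).
  exact: (bmeas_comp_sub x (bmeas_normc_tpoly aK)).
have bR : bmeas (fun y : point => complex.Re (tpoly a (x - y))).
  apply: (bmeas_comp_sub (f := fun y => complex.Re (tpoly a y)) x).
  under eq_fun do rewrite (Re_tpoly _ aK).
  by apply: bmeas_sum => l; apply: bmeasZ; exact: bmeas_cosl.
have bI : bmeas (fun y : point => complex.Im (tpoly a (x - y))).
  apply: (bmeas_comp_sub (f := fun y => complex.Im (tpoly a y)) x).
  under eq_fun do rewrite (Im_tpoly _ aK).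
  by apply: bmeas_sum => l; apply: bmeasZ; exact: bmeas_sinl.
have H (v : point -> R) : bmeas v -> (forall y, `|v y| <= normc (tpoly a (x - y))) ->
    `|\int[mu]_y (u y * v y)| <= U * k.
  move=> bv vk; have [muv [B hB]] := bmeasM bu bv.
  have buv := bounded_integrable mu muv hB.
  rewrite (le_trans (le_normr_Rintegral _ buv))// /k -RintegralZ_bmeas//.
  apply: le_Rintegral_bmeas.
  - split; first exact: measurableT_comp.
    by exists B => y; rewrite normr_id.
  - exact: bmeasZ.
  - by move=> y; rewrite normrM ler_pM.
rewrite Re_fmul_convolution// Im_fmul_convolution//; split; apply: H => // y.
  exact: normc_Re.
exact: normc_Im.
Qed.

(** The multiplier is the convolution with a kernel whose L^1 norm does not
    depend on the scale, by [kernel_L1]. *)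
Theorem multiplier_bounded (T : Type) (c : nat) (g : T -> point -> R) :
  symbol setT d g ->
  (forall t x, g t x != 0 -> forall i, `|x 0 i| <= c%:R) ->
  exists2 C : R, 0 <= C & forall t n u (U : R) x, bmeas u -> (forall y, `|u y| <= U) ->
  let w := fmul (lattice (2 / 2 ^+ n) (g t)) (fourier_coef (dist_of_fun u)) x in
  `|complex.Re w| <= C * U /\ `|complex.Im w| <= C * U.
Proof.
move=> sg gc; have [C C0 hC] := kernel_L1 sg gc.
exists C => // t n u U x bu uU w.
have E : 2 ^+ n = (2 ^ n).-1.+1%:R :> R by rewrite prednK ?expn_gt0// natrX.
have U0 : 0 <= U by rewrite (le_trans _ (uU 0)).
have := hC t (2 ^ n).-1 x; rewrite -E => H.
have [|h1 h2] := @fmul_le_L1 (lattice (2 / 2 ^+ n) (g t)) u U x _ bu uU.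
  by exists (c * (2 ^ n).-1.+1)%N => l; rewrite E; apply: lattice_inbox; exact: gc.
by split; [apply: le_trans h1 _|apply: le_trans h2 _]; rewrite [C * U]mulrC ler_wpM2l.
Qed.

End multipliers.

(** * Dyadic decomposition *)

Section littlewood_paley_symbols.
Context {R : realType} {d : nat}.
Local Notation point := 'rV[R]_d.
Variable phi : point -> R.
Hypothesis lp : littlewood_paley phi.

(** The set where the Littlewood-Paley function may differ from 0, in terms of
    the squared length, which is a polynomial. *)
Definition annulus : set point := [set x | 9 / 16 <= sqnorm x <= 64 / 9].

Lemma euclid_sqnorm (x : point) : euclid x ^+ 2 = sqnorm x.
Proof. by rewrite sqr_sqrtr//; apply: sumr_ge0 => i _; exact: sqr_ge0. Qed.

Lemma sqnorm_ge0 (x : point) : 0 <= sqnorm x.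
Proof. by apply: sumr_ge0 => i _; exact: sqr_ge0. Qed.

Lemma annulusE x : annulus x <-> 3 / 4 <= euclid x <= 8 / 3.
Proof.
have e0 : 0 <= euclid x by exact: sqrtr_ge0.
rewrite /annulus/= -euclid_sqnorm; split=> /andP[h1 h2]; apply/andP; split; nra.
Qed.

Lemma phi_annulus x : phi x != 0 -> annulus x.
Proof. by move=> h; apply/annulusE; case: lp => _ _ _ /(_ x h). Qed.

Lemma annulus_coord x i : annulus x -> `|x 0 i| <= 3.
Proof.
move=> /andP[_ h]; have : x 0 i ^+ 2 <= 64 / 9.
  rewrite (le_trans _ h)// /sqnorm (bigD1 i)//= lerDl.
  by apply: sumr_ge0 => j _; exact: sqr_ge0.
by move=> h'; rewrite ler_norml; apply/andP; split; nra.
Qed.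

Lemma continuous_sqnorm : continuous (@sqnorm R d).
Proof.
rewrite (_ : @sqnorm R d = \sum_(k < d) (fun y : point => y 0 k * y 0 k)); last first.
  by apply/funext => y; rewrite fct_sumE; apply: eq_bigr => k _; rewrite expr2.
move=> x; apply: (big_ind (fun f : point -> R => {for x, continuous f})).
- exact: cst_continuous.
- by move=> f g; exact: continuousD.
- by move=> k _; apply: continuousM; exact: coord_continuous.
Qed.

Lemma closed_annulus : closed annulus.
Proof.
rewrite (_ : annulus = @sqnorm R d @^-1` `[9 / 16, 64 / 9]).
  by apply: closed_comp => [x _|]; [exact: continuous_sqnorm|exact: itv_closed].
by apply/seteqP; split => x /=; rewrite in_itv.
Qed.

Lemma compact_annulus : compact annulus.
Proof.
apply: bounded_closed_compact; last exact: closed_annulus.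
exists 3; split; first exact: num_real.
move=> M M3 x ax; rewrite /= /Num.norm/= mx_normrE; apply: bigmax_le; first by rewrite (le_trans _ (ltW M3)).
by move=> [i j] _ /=; rewrite ord1 (le_trans (annulus_coord j ax))// ltW.
Qed.

Lemma partials_phi0 s x : ~ annulus x -> partials s phi x = 0.
Proof.
elim: s x => [|i s IH] x nx /=.
  by apply/eqP; apply: contra_notT nx; exact: phi_annulus.
rewrite /partial (@near_eq_derive _ _ _ _ (cst 0)) ?derive_cst//.
have : open (~` annulus) by rewrite openC; exact: closed_annulus.
by rewrite openE => /(_ x nx); apply: filterS => y; exact: IH.
Qed.

Lemma symbol_phi T n : symbol setT n (fun _ : T => phi).
Proof.
suff H s : symbol setT n (fun _ : T => partials s phi) by exact: (H [::]).
have [sm _ _ _ _] := lp.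
have bd (u : seq 'I_d) : exists B : R, forall (t : T) x, [set: point] x -> `|partials u phi x| <= B.
  have [cu _] := sm u.
  have : compact ((fun x => `|partials u phi x|) @` annulus).
    apply: continuous_compact compact_annulus.
    apply: continuous_subspaceT => x; apply: continuous_comp; first exact: cu.
    exact: norm_continuous.
  move=> /compact_bounded [M [_ hM]].
  exists (`|M| + 1) => t x _; have [ax|/(partials_phi0 u) ->] := pselect (annulus x).
    have MM : M < `|M| + 1 by rewrite ltr_pwDr// ler_norm.
    have := hM _ MM `|partials u phi x| (ex_intro2 _ _ x ax erefl).
    by rewrite /= normr_id.
  by rewrite normr0 addr_ge0.
elim: n s => [|n IH] s; first by split.
split=> // i; exists (fun _ => partials (i :: s) phi); split; last exact: IH.
move=> t x _; have [_ du] := sm s.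
by apply: derivableP; exact: du.
Qed.

End littlewood_paley_symbols.

Section dyadic_decomposition.
Context {R : realType} {d : nat}.
Local Notation point := 'rV[R]_d.
Local Notation freq := 'rV[int]_d.
Variable phi : point -> R.
Hypothesis lp : littlewood_paley phi.

(** The frequency of the n-th block, which has dyadic index n - 1: nonzero integer
    frequencies have length at least 1, so that blocks of index less than - 1
    do not see them. *)
Definition lam (n : nat) : R := 2 ^+ n / 2.

Lemma lam_gt0 n : 0 < lam n.
Proof. by rewrite divr_gt0// exprn_gt0. Qed.

Lemma lamV n : (lam n)^-1 = 2 / 2 ^+ n.
Proof. by rewrite invf_div. Qed.

Lemma lam_mono m n : (m <= n)%N -> lam m <= lam n.
Proof. by move=> mn; rewrite ler_pM2r// ler_weXn2l// ler1n. Qed.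

Lemma lamS n : lam n.+1 = 2 * lam n.
Proof. by rewrite /lam exprS mulrA. Qed.

Definition dyadic (n : nat) (l : freq) : R := phi ((lam n)^-1 *: real_freq l).

Lemma sqnormZ h (x : point) : sqnorm (h *: x) = h ^+ 2 * sqnorm x.
Proof. by rewrite /sqnorm big_distrr/=; apply: eq_bigr => i _; rewrite mxE exprMn. Qed.

Lemma symbol_sqnorm T n c : symbol (@annulus R d) n (fun _ : T => fun x => sqnorm x `^ c).
Proof. by apply: (@symbol_powR R d T _ (9 / 16) (64 / 9)) => //; rewrite divr_gt0. Qed.

Lemma fmulZ (c : R) a z (x : point) : finsupp a ->
  fmul (fun l : freq => c * a l) z x = c%:C%C * fmul a z x.
Proof.
move=> [K aK]; rewrite (fmul_box _ _ aK) (@fmul_box _ _ K); last first.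
  by move=> l h; apply: aK; apply: contra_neq h => ->; rewrite mulr0.
by rewrite big_distrr/=; apply: eq_bigr => l _; rewrite rmorphM/= -!mulrA.
Qed.

Lemma finsupp_lattice n (f : point -> R) :
  (forall x, f x != 0 -> forall i, `|x 0 i| <= 3) -> finsupp (lattice (2 / 2 ^+ n) f).
Proof.
move=> h; exists (3 * (2 ^ n).-1.+1)%N => l.
have -> : 2 ^+ n = (2 ^ n).-1.+1%:R :> R by rewrite prednK ?expn_gt0// natrX.
exact: lattice_inbox.
Qed.

Lemma finsupp_dyadic n : finsupp (dyadic n).
Proof.
rewrite /dyadic lamV; apply: finsupp_lattice => x h i; apply: annulus_coord.
exact: (phi_annulus lp).
Qed.

(** The symbol of the Leray projection composed with the k-th derivative, up to
    a square root of - 1.  It is homogeneous of degree 1. *)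
Definition leray_symbol (i j k : 'I_d) (x : point) : R :=
  ((i == j)%:R - x 0 i * x 0 j * sqnorm x `^ (- 1)) * (2 * pi * x 0 k).

Lemma symbol_leray i j k n : symbol (@annulus R d) n (fun _ : R => leray_symbol i j k).
Proof.
have sc m : symbol (@annulus R d) n (fun (_ : R) (x : point) => x 0 m).
  by apply: (symbol_coord _ _ (B := 3)) => x; exact: annulus_coord.
apply: symbolM; last by apply: symbolZ.
rewrite (_ : (fun _ => _) = (fun (_ : R) (x : point) =>
  (i == j)%:R + (-1) * (x 0 i * x 0 j * sqnorm x `^ (- 1)))); last first.
  by apply/funext => t; apply/funext => x; rewrite mulN1r.
apply: symbolD; first exact: symbol_cst.
by apply: symbolZ; apply: symbolM; [exact: symbolM|exact: symbol_sqnorm].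
Qed.

Lemma leray_homogeneous n l i j k :
  leray l i j * (2 * pi * (l 0 k)%:~R) =
  lam n * leray_symbol i j k ((lam n)^-1 *: real_freq l).
Proof.
have L0 := lam_gt0 n.
(* At l = 0 both sides vanish because of the derivative. *)
have [->|l0] := eqVneq l 0.
  by rewrite /leray_symbol !mxE mulr0z !mulr0.
have q0 : sqnorm (real_freq l) != 0 :> R.
  apply: contra_neq l0 => /eqP; rewrite psumr_eq0; last by move=> m _; exact: sqr_ge0.
  move=> /allP h; apply/rowP => m; have := h m (mem_index_enum _).
  by rewrite !mxE sqrf_eq0 intr_eq0 => /eqP.
rewrite /leray_symbol sqnormZ powR_inv1; last by rewrite mulr_ge0 ?sqr_ge0 ?sqnorm_ge0.
rewrite /leray euclid_sqnorm !mxE; field.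
by rewrite q0 gt_eqF.
Qed.

Lemma exprz_dyadic (n : nat) : (2 : R) ^ (- (n%:Z - 1)) = (lam n)^-1.
Proof.
case: n => [|n]; first by rewrite sub0r opprK expr1z /lam expr0 div1r invrK.
have -> : - (n.+1%:Z - 1) = - n%:Z by rewrite -addn1 PoszD addrK.
by rewrite -exprz_inv -exprnP lamS /lam mulrCA mulfV// mulr1 exprVn.
Qed.

Lemma dyadicE n l : dyadic n l = phi ((2 : R) ^ (- (n%:Z - 1)) *: real_freq l).
Proof. by rewrite exprz_dyadic. Qed.

Lemma sqnorm_real_freq (l : freq) : l != 0 -> 1 <= sqnorm (real_freq l : point).
Proof.
move=> l0; have [m lm] : exists m, l 0 m != 0.
  apply/existsP; apply: contraNT l0 => /existsPn h.
  by apply/eqP/rowP => m; rewrite mxE; apply/eqP; rewrite -[_ == _]negbK h.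
rewrite /sqnorm (bigD1 m)//= mxE.
have : (1 : R) <= (l 0 m)%:~R ^+ 2.
  rewrite -rmorphXn/= ler1z; have : 0 <= l 0 m ^+ 2 by exact: sqr_ge0.
  have : l 0 m ^+ 2 != 0 by rewrite sqrf_eq0.
  lia.
move/le_trans; apply; rewrite lerDl; apply: sumr_ge0 => i _; exact: sqr_ge0.
Qed.

Lemma dyadic_annulus n l : dyadic n l != 0 ->
  9 / 16 * lam n ^+ 2 <= sqnorm (real_freq l) <= 64 / 9 * lam n ^+ 2.
Proof.
move=> /(phi_annulus lp); rewrite /annulus/= sqnormZ => h.
have L : 0 < lam n ^+ 2 by rewrite exprn_gt0// lam_gt0.
have -> : sqnorm (real_freq l) = (lam n)^-1 ^+ 2 * sqnorm (real_freq l) * lam n ^+ 2 :> R.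
  by field; rewrite gt_eqF// lam_gt0.
by rewrite !ler_pM2r.
Qed.

Lemma dyadic0 n : dyadic n 0 = 0.
Proof.
apply: contrapT => /eqP /dyadic_annulus /andP[h _].
have L : 0 < lam n ^+ 2 by rewrite exprn_gt0// lam_gt0.
suff : sqnorm (real_freq 0 : point) = 0 by move=> E; move: h; rewrite E; lra.
by rewrite /sqnorm big1// => i _; rewrite !mxE expr0n.
Qed.

Lemma dyadic_neighbours m n l : dyadic m l != 0 -> dyadic n l != 0 -> (m <= n.+1)%N.
Proof.
move=> /dyadic_annulus /andP[h1 _] /dyadic_annulus /andP[_ h2].
rewrite leqNgt; apply/negP => mn; have := lam_mono mn; rewrite !lamS => h.
have := lam_gt0 n; nra.
Qed.

(** Below the index - 1 the annulus is contained in |l| < 1. *)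
Lemma dyadic_coarse (j : int) (l : freq) : j < - 1 -> phi ((2 : R) ^ (- j) *: real_freq l) = 0.
Proof.
move=> j1; apply: contrapT => /eqP /(phi_annulus lp); rewrite /annulus/= sqnormZ.
have [->|l0] := eqVneq l 0.
  rewrite (_ : sqnorm _ = 0) ?mulr0; last by rewrite /sqnorm big1// => i _; rewrite !mxE expr0n.
  by move=> /andP[]; lra.
move=> /andP[_]; apply/negP; rewrite -ltNge.
have [k ->] : exists k : nat, - j = k.+2%:Z by exists (absz (- j)).-2; lia.
have := sqnorm_real_freq l0; have : 4 <= (2 : R) ^ k.+2.
  rewrite -exprnP !exprS; have : 1 <= (2 : R) ^+ k by rewrite exprn_ege1// ler1n.
  lra.
set u := _ ^ _; set v := sqnorm _; nra.
Qed.

(** Summation over the integers is replaced by a finite sum: the coarse blocks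
    vanish, and so do the fine ones by hypothesis. *)
Lemma dyadic_partition K l : l != 0 -> (forall m, (K <= m)%N -> dyadic m l = 0) ->
  \sum_(m < K) dyadic m l = 1.
Proof.
move=> l0 hK; have [_ phi01 _ _ pu] := lp.
have x0 : real_freq l != 0 :> point.
  apply: contra_neq l0 => /rowP h; apply/rowP => i; have := h i.
  by rewrite !mxE => /eqP; rewrite intr_eq0 => /eqP.
have := pu _ x0; pose A : seq int := [seq m%:Z - 1 | m <- iota 0 K].
have uA : uniq A by rewrite map_inj_uniq ?iota_uniq// => a b /addIr [].
have out (j : int) : j \notin A -> phi ((2 : R) ^ (- j) *: real_freq l) = 0.
  have [/dyadic_coarse -> //|j1] := ltP j (- 1).
  have [m jm] : exists m : nat, j = m%:Z - 1 by exists (absz (j + 1)); lia.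
  rewrite jm -dyadicE => /mapP mA; apply: hK; rewrite leqNgt; apply/negP => mK.
  by apply: mA; exists m => //; rewrite mem_iota.
have E : \esum_(j in [set: int]) (phi ((2 : R) ^ (- j) *: real_freq l))%:E =
    \esum_(j in [set` A]) (phi ((2 : R) ^ (- j) *: real_freq l))%:E.
  rewrite [RHS]esum_mkcond; apply: eq_esum => j _.
  by case: ifPn => //; rewrite notin_setE /= => /negP /out ->.
rewrite E esum_fset; [|exact: finite_seq|]; last by move=> j _; rewrite lee_fin; case/andP: (phi01 (2 ^ (- j) *: real_freq l)).
rewrite -fsbig_seq// sumEFin => -[].
rewrite big_map -{1}[K]subn0 -/(index_iota 0 K) big_mkord => H.
by rewrite -[RHS]H; apply: eq_bigr => m _; rewrite dyadicE.
Qed.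

Lemma dyadic_vanish l : exists K, forall m, (K <= m)%N -> dyadic m l = 0.
Proof.
(* From m >= 2 |l|^2 + 8 on, lam m ^ 2 = 4^m / 4 is too large for |l|^2, since
   4^m >= 8 2^m >= 8 m. *)
pose K := ((Num.truncn (2 * sqnorm (real_freq l : point))).+1 + 8)%N.
exists K => m Km; apply: contrapT => /eqP /dyadic_annulus /andP[h _].
have h1 : 2 * sqnorm (real_freq l : point) < (Num.truncn (2 * sqnorm (real_freq l : point))).+1%:R.
  exact: truncnS_gt.
have h2 : (m%:R : R) <= 2 ^+ m by rewrite -natrX ler_nat ltnW// ltn_expl.
have h3 : (Num.truncn (2 * sqnorm (real_freq l : point))).+1%:R + 8 <= m%:R :> R.
  by rewrite -natrD ler_nat.
have h4 : 0 <= (Num.truncn (2 * sqnorm (real_freq l : point))).+1%:R :> R by [].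
move: h; rewrite /lam (_ : (2 ^+ m / 2) ^+ 2 = 2 ^+ m * 2 ^+ m / 4); last by field.
have : 8 * 2 ^+ m <= 2 ^+ m * 2 ^+ m :> R by nra.
lra.
Qed.

(** On the support of one block the partition of unity only involves its
    neighbours. *)
Lemma dyadic_partition_near n l : dyadic n l != 0 ->
  \sum_(n.-1 <= m < n.+2) dyadic m l = 1.
Proof.
move=> hn; have l0 : l != 0 by apply: contra_neq hn => ->; exact: dyadic0.
have far m : (m < n.-1)%N || (n.+2 <= m)%N -> dyadic m l = 0.
  apply: contraTeq => hm; rewrite negb_or -!leqNgt.
  have := dyadic_neighbours hm hn; have := dyadic_neighbours hn hm.
  by move=> h1 h2; apply/andP; split; lia.
have <- : \sum_(m < n.+2) dyadic m l = 1.
  by apply: dyadic_partition => // m mn; apply: far; rewrite mn orbT.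
rewrite -(big_mkord xpredT (fun m => dyadic m l)) [RHS](big_cat_nat _ (n := n.-1))//=; last by lia.
rewrite [X in _ = X + _]big_nat_cond [X in _ = X + _]big1 ?add0r//.
by move=> m /andP[/andP[_ mn] _]; apply: far; rewrite mn.
Qed.

End dyadic_decomposition.

(** * Blocks of the heat semigroup *)

Section heat_blocks.
Context {R : realType} {d : nat}.
Local Notation point := 'rV[R]_d.
Local Notation freq := 'rV[int]_d.
Variables (beta : R) (phi : point -> R).
Hypothesis beta0 : 0 < beta.
Hypothesis lp : littlewood_paley phi.
Local Notation dyadic := (dyadic phi).

(** The symbol of (- Delta)^beta, as a power of |x|^2. *)
Definition fracp (x : point) : R := (2 * pi) `^ (2 * beta) * sqnorm x `^ beta.

Lemma frac_laplacianE l : frac_laplacian beta l = fracp (real_freq l).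
Proof.
have p0 : 0 <= 2 * pi :> R by rewrite mulr_ge0// pi_ge0.
rewrite /frac_laplacian /fracp powRM ?sqrtr_ge0//; congr (_ * _).
rewrite /euclid -powR12_sqrt ?sqnorm_ge0//.
by rewrite -powRrM mulrA mulVf// mul1r.
Qed.

Lemma fracpZ h x : 0 <= h -> fracp (h *: x) = h `^ (2 * beta) * fracp x.
Proof.
move=> h0; rewrite /fracp sqnormZ [(_ ^+ 2 * _) `^ _]powRM ?sqr_ge0 ?sqnorm_ge0//.
by rewrite -powR_mulrn// -powRrM mulrCA.
Qed.

Lemma symbol_fracp T n : symbol (@annulus R d) n (fun _ : T => fracp).
Proof. by apply: symbolZ; exact: symbol_sqnorm. Qed.

(** With the factor 1 + |t| the symbol is still bounded, uniformly in t, together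
    with its derivatives: |x| is bounded below on the annulus.  This factor
    becomes the decay of the blocks. *)
Lemma symbol_heat (s : point -> R) n :
  (forall n, symbol (@annulus R d) n (fun _ : R => s)) ->
  symbol setT n (fun (t : R) x => phi x * ((1 + `|t|) * expR (- `|t| * fracp x) * s x)).
Proof.
move=> ss; apply: (@symbol_cutoff _ _ _ (@annulus R d)); first exact: closed_annulus.
- exact: symbol_phi.
- by move=> _ x nx; apply/eqP; apply: contra_notT nx => /(phi_annulus lp).
apply: symbolM; last exact: ss.
have H k : symbol (@annulus R d) n (fun (t : R) x => `|t| ^+ k * expR (- `|t| * fracp x)).
  apply: (@symbol_expR _ _ _ _ ((2 * pi) `^ (2 * beta) * (9 / 16) `^ beta)).
  - by rewrite mulr_gt0 ?powR_gt0 ?mulr_gt0 ?pi_gt0// divr_gt0.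
  - move=> x /andP[x1 _]; rewrite /fracp ler_wpM2l ?powR_ge0// ge0_ler_powR// ?nnegrE.
    + exact: ltW.
    + by rewrite divr_ge0.
    + exact: sqnorm_ge0.
  - by move=> m; exact: symbol_fracp.
have := symbolD (H 0%N) (H 1%N); congr symbol.
by apply/funext => t; apply/funext => x; rewrite expr0 expr1; ring.
Qed.

(** By homogeneity, the heat symbol at time t and frequency lam is the one at
    time t lam^(2 beta) and frequency 1.  The additional symbol s is 1 for the
    linear evolution and [leray_symbol] for the Duhamel term. *)
Theorem heat_block_bounded (s : point -> R) :
  (forall n, symbol (@annulus R d) n (fun _ : R => s)) ->
  exists2 C : R, 0 <= C & forall t n u (U : R) x, 0 <= t -> bmeas u ->
    (forall y, `|u y| <= U) ->
  let w := fmul (fun l => dyadic n l * (expR (- t * frac_laplacian beta l) *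
      s ((lam n)^-1 *: real_freq l))) (fourier_coef (dist_of_fun u)) x in
  `|complex.Re w| <= C * U / (1 + t * lam n `^ (2 * beta)) /\
  `|complex.Im w| <= C * U / (1 + t * lam n `^ (2 * beta)).
Proof.
move=> ss.
have [|C C0 hC] := multiplier_bounded (c := 3) (symbol_heat d ss).
  move=> t x h i; apply: annulus_coord; apply: (phi_annulus lp).
  by apply: contra_neq h => ->; rewrite mul0r.
exists C => // t n u U x t0 bu uU w.
pose t' := t * lam n `^ (2 * beta).
have t'0 : 0 <= t' by rewrite mulr_ge0 ?powR_ge0.
have [h1 h2] := hC t' n u U x bu uU.
have wE : w = ((1 + t')^-1)%:C%C * fmul (lattice (2 / 2 ^+ n)
    (fun x => phi x * ((1 + `|t'|) * expR (- `|t'| * fracp x) * s x)))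
    (fourier_coef (dist_of_fun u)) x.
  rewrite -fmulZ; last first.
    apply: finsupp_lattice => y h i; apply: annulus_coord; apply: (phi_annulus lp).
    by apply: contra_neq h => ->; rewrite mul0r.
  rewrite /w; set a1 := fun l : freq => _; set a2 := fun l : freq => _.
  suff -> : a1 = a2 by [].
  apply/funext => l; rewrite /a1 /a2.
  rewrite /lattice -lamV -/(dyadic n l) (ger0_norm t'0) fracpZ ?invr_ge0 ?ltW ?lam_gt0//.
  rewrite -frac_laplacianE (_ : - t' * _ = - t * frac_laplacian beta l).
    by field; rewrite gt_eqF// ltr_pwDl.
  rewrite -powR_inv1 ?ltW ?lam_gt0// -powRrM mulrC -!mulNr.
  rewrite /t' mulN1r powRN; field.
  by rewrite gt_eqF// powR_gt0// lam_gt0.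
have i0 : 0 <= (1 + t')^-1 by rewrite invr_ge0 addr_ge0.
have N z : `|(1 + t')^-1 * z| = (1 + t')^-1 * `|z| by rewrite normrM (ger0_norm i0).
rewrite wE ReMr ImMr !N -/t' [C * U / _]mulrC.
by split; apply: ler_wpM2l.
Qed.

End heat_blocks.

(** * Singular time integrals *)

Section singular_integrals.
Context {R : realType}.
Local Notation leb := (@lebesgue_measure R).

(** The fundamental theorem of calculus on ]0, t[ for an integrand that may blow
    up at both ends, by monotone convergence from compact subintervals. *)
Lemma improper_integral_le (f F : R -> R) (t M : R) : 0 < t ->
  (forall s, 0 < s < t -> 0 <= f s) ->
  (forall s, 0 < s < t -> {for s, continuous f}) ->
  (forall s : R, 0 < s < t -> is_derive s 1 F (f s)) ->
  (forall a b, 0 < a -> a < b -> b < t -> F b - F a <= M) ->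
  measurable_fun `]0, t[ f /\ (\int[leb]_(s in `]0%R, t[) (f s)%:E <= M%:E)%E.
Proof.
move=> t0 f0 cf dF FM.
have mf : measurable_fun `]0, t[ f.
  apply: open_continuous_measurable_fun; first exact: interval_open.
  by move=> s; rewrite inE/= in_itv/=; exact: cf.
split=> //.
(* The denominator k + 3 makes a k < t/2, so that [a k, b k] is not degenerate. *)
pose a k : R := t / k.+3%:R; pose b k : R := t - a k.
have a0 k : 0 < a k by rewrite divr_gt0.
have ab k : a k < b k.
  have k3 : 3 <= k.+3%:R :> R by rewrite ler_nat.
  have : a k * 3 <= t.
    by rewrite /a mulrAC ler_pdivrMr// ler_wpM2l// ltW.
  rewrite /b; lra.
have bt k : b k < t by rewrite /b ltrBlDr ltrDl.
pose I k : set R := `[a k, b k]%classic.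
have IE k s : I k s <-> a k <= s <= b k by rewrite /I/= in_itv.
have UI : `]0, t[%classic = \bigcup_k I k.
  apply/seteqP; split => s /=.
    rewrite in_itv/= => /andP[s0 st].
    pose m := Num.min s (t - s).
    have m0 : 0 < m by rewrite lt_min s0 subr_gt0.
    exists (Num.truncn (t / m)) => //; apply/IE.
    have : a (Num.truncn (t / m)) <= m.
      rewrite /a ler_pdivrMr// mulrC -ler_pdivrMr// ltW//.
      by rewrite (lt_trans (truncnS_gt _))// ltr_nat.
    rewrite le_min => /andP[h1 h2]; rewrite h1/= /b; lra.
  move=> [k _ /IE /andP[h1 h2]]; rewrite in_itv/=.
  by rewrite (lt_le_trans (a0 k) h1) (le_lt_trans h2 (bt k)).
have ndI : nondecreasing_seq I.
  move=> m n mn; apply/subsetPset => s /IE /andP[h1 h2]; apply/IE.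
  have amn : a n <= a m.
    by apply: ler_wpM2l; [exact: ltW|rewrite lef_pV2 ?posrE// ler_nat].
  apply/andP; split; [exact: le_trans h1|apply: (le_trans h2)].
  by rewrite /b lerD2l lerN2.
have mI k : measurable (I k) by exact: measurable_itv.
have inI k s : I k s -> 0 < s < t.
  move=> /IE /andP[h1 h2].
  by rewrite (lt_le_trans (a0 k) h1) (le_lt_trans h2 (bt k)).
have mfI k : measurable_fun (I k) (fun s => (f s)%:E).
  apply/measurable_EFinP; apply: measurable_funS mf => // s /inI.
  by rewrite /= in_itv.
have f0I k s : I k s -> (0%R <= (f s)%:E)%E by move=> /inI/f0; rewrite lee_fin.
have := ge0_nondecreasing_set_cvg_integral (mu := leb) ndI mI mfI f0I.
rewrite -UI => /cvg_lim <- //.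
apply: lime_le.
  apply: ereal_nondecreasing_is_cvgn => m n mn.
  apply: ge0_subset_integral => //.
  - exact: mI.
  - exact: mI.
  - exact: mfI.
  - exact: f0I.
  - exact/subsetPset/ndI.
apply: nearW => k.
have inI' s : a k <= s <= b k -> 0 < s < t by move=> h; apply: (inI k); apply/IE.
have cF s : 0 < s < t -> {for s, continuous F}.
  move=> /dF [d _]; exact/differentiable_continuous/derivable1_diffP.
rewrite (@continuous_FTC2 _ f F)//.
- by rewrite -EFinB lee_fin FM.
- apply: continuous_in_subspaceT => s; rewrite inE/= in_itv/= => /inI'; exact: cf.
- split.
  + move=> s; rewrite in_itv/= => /andP[h1 h2].
    by have [] := dF s; rewrite // inI'// !ltW.
  + by apply: cvg_at_right_filter; apply: cF; rewrite inI'// lexx ltW.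
  + by apply: cvg_at_left_filter; apply: cF; rewrite inI'// lexx ltW.
- move=> s; rewrite in_itv/= => /andP[h1 h2]; rewrite derive1E.
  by apply: derive_val; apply: dF; rewrite inI'// !ltW.
Qed.

Lemma integral_powR_le (t c : R) : 0 < t -> c < 1 ->
  measurable_fun `]0, t[ (fun s => s `^ (- c)) /\
  (\int[leb]_(s in `]0%R, t[) (s `^ (- c))%:E <= (t `^ (1 - c) / (1 - c))%:E)%E.
Proof.
move=> t0 c1; have c0 : 0 < 1 - c by rewrite subr_gt0.
apply: (@improper_integral_le _ (fun s => (1 - c)^-1 *: (s `^ (1 - c)))) => //.
- by move=> s _; exact: powR_ge0.
- move=> s /andP[s0 _].
  apply/differentiable_continuous/derivable1_diffP.
  by have [] := is_derive1_powR (- c) s0.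
- move=> s /andP[s0 _].
  have := is_deriveZ (1 - c)^-1 (is_derive1_powR (1 - c) s0).
  rewrite (_ : 1 - c - 1 = - c); last by ring.
  rewrite [X in is_derive _ _ _ X](_ : _ = s `^ (- c))//.
  by rewrite /GRing.scale/= mulrA mulVf ?gt_eqF// mul1r.
- move=> a b a0 ab bt; rewrite /GRing.scale/= -mulrBr mulrC ler_wpM2r ?invr_ge0 ?(ltW c0)//.
  rewrite (@le_trans _ _ (b `^ (1 - c)))// ?gerBl ?powR_ge0//.
  by rewrite ge0_ler_powR ?nnegrE ?ltW// (lt_trans a0).
Qed.

Lemma integral_powR_refl_le (t c : R) : 0 < t -> c < 1 ->
  measurable_fun `]0, t[ (fun s => (t - s) `^ (- c)) /\
  (\int[leb]_(s in `]0%R, t[) ((t - s) `^ (- c))%:E <= (t `^ (1 - c) / (1 - c))%:E)%E.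
Proof.
move=> t0 c1; have c0 : 0 < 1 - c by rewrite subr_gt0.
have dts (s : R) : is_derive s 1 (fun u : R => t - u) (- 1).
  have := is_deriveB (is_derive_cst t s 1) (is_derive_id s (1 : R)).
  by rewrite sub0r.
apply: (@improper_integral_le _ (fun s => (- (1 - c)^-1) *: ((t - s) `^ (1 - c)))) => //.
- by move=> s _; exact: powR_ge0.
- move=> s /andP[_ st].
  apply/differentiable_continuous/derivable1_diffP.
  have ts0 : 0 < t - s by rewrite subr_gt0.
  by have [] := @is_derive1_comp _ (fun y => y `^ (- c)) (fun u => t - u) s _ _
    (is_derive1_powR (- c) ts0) (dts s).
- move=> s /andP[_ st]; have ts0 : 0 < t - s by rewrite subr_gt0.
  have := is_deriveZ (- (1 - c)^-1) (@is_derive1_comp _ (fun y => y `^ (1 - c)) (fun u => t - u) s _ _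
    (is_derive1_powR (1 - c) ts0) (dts s)).
  rewrite (_ : 1 - c - 1 = - c); last by ring.
  rewrite [X in is_derive _ _ _ X](_ : _ = (t - s) `^ (- c))//.
  by rewrite /GRing.scale/= mulrN1 mulrN mulNr opprK mulrA mulVf ?gt_eqF// mul1r.
- move=> a b a0 ab bt; rewrite /GRing.scale/= !mulNr opprK addrC -mulrBr mulrC.
  rewrite ler_wpM2r ?invr_ge0 ?(ltW c0)//.
  rewrite (@le_trans _ _ ((t - a) `^ (1 - c)))// ?gerBl ?powR_ge0//.
  have at' := lt_trans ab bt.
  apply: ge0_ler_powR; rewrite ?nnegrE ?subr_ge0; try exact: ltW.
  by rewrite gerBl ltW.
Qed.

(** Up to the constant, one of the two factors is at most its value at t/2,
    according to whether s or t - s exceeds t/2. *)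
Lemma beta_integral_le (t c e : R) : 0 < t -> 0 <= c < 1 -> 0 <= e < 1 ->
  measurable_fun `]0, t[ (fun s => (t - s) `^ (- c) * s `^ (- e)) /\
  (\int[leb]_(s in `]0%R, t[) ((t - s) `^ (- c) * s `^ (- e))%:E <=
    ((2 `^ e / (1 - c) + 2 `^ c / (1 - e)) * t `^ (1 - c - e))%:E)%E.
Proof.
move=> t0 /andP[c0 c1] /andP[e0 e1].
have [m1 i1] := integral_powR_refl_le t0 c1; have [m2 i2] := integral_powR_le t0 e1.
have m12 : measurable_fun `]0, t[ (fun s => (t - s) `^ (- c) * s `^ (- e)).
  exact: measurable_funM.
split=> //.
pose A := (t / 2) `^ (- e); pose B := (t / 2) `^ (- c).
have A0 : 0 <= A by exact: powR_ge0.
have B0 : 0 <= B by exact: powR_ge0.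
have powle (x y u : R) : 0 < x -> x <= y -> 0 <= u -> y `^ (- u) <= x `^ (- u).
  move=> x0 xy u0; have y0 := lt_le_trans x0 xy.
  rewrite !powRN lef_pV2 ?posrE ?powR_gt0//.
  by rewrite ge0_ler_powR// nnegrE ltW.
apply: (@le_trans _ _ (\int[leb]_(s in `]0%R, t[)
    (A%:E * ((t - s) `^ (- c))%:E + B%:E * (s `^ (- e))%:E))%E).
  apply: ge0_le_integral => //.
  - by move=> s _; rewrite lee_fin mulr_ge0 ?powR_ge0.
  - exact/measurable_EFinP.
  - by apply: emeasurable_funD; apply: emeasurable_funM => //; exact/measurable_EFinP.
  - move=> s /=; rewrite in_itv/= => /andP[s0 st]; rewrite -!EFinM -EFinD lee_fin.
    have [h|h] := leP (t / 2) s.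
      rewrite (@le_trans _ _ (A * (t - s) `^ (- c)))//.
        by rewrite mulrC ler_wpM2r ?powR_ge0// powle// divr_gt0.
      by rewrite lerDl mulr_ge0 ?powR_ge0.
    rewrite (@le_trans _ _ (B * s `^ (- e)))//.
      by rewrite ler_wpM2r ?powR_ge0// powle// ?divr_gt0//; lra.
    by rewrite lerDr mulr_ge0 ?powR_ge0.
rewrite ge0_integralD//; last 4 first.
- by move=> s _; rewrite -EFinM lee_fin mulr_ge0 ?powR_ge0.
- by apply: emeasurable_funM => //; exact/measurable_EFinP.
- by move=> s _; rewrite -EFinM lee_fin mulr_ge0 ?powR_ge0.
- by apply: emeasurable_funM => //; exact/measurable_EFinP.
rewrite !ge0_integralZl//; last 4 first.
- exact/measurable_EFinP.
- by move=> s _; rewrite lee_fin powR_ge0.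
- exact/measurable_EFinP.
- by move=> s _; rewrite lee_fin powR_ge0.
apply: (@le_trans _ _ (A%:E * (t `^ (1 - c) / (1 - c))%:E +
   B%:E * (t `^ (1 - e) / (1 - e))%:E)%E).
  by apply: leeD; apply: lee_pmul => //;
    apply: integral_ge0 => s _; rewrite lee_fin powR_ge0.
rewrite -!EFinM -EFinD lee_fin le_eqVlt; apply/orP; left; apply/eqP.
have tE (u v : R) : (t / 2) `^ (- u) * t `^ (1 - v) = 2 `^ u * t `^ (1 - v - u).
  rewrite powRM ?invr_ge0 ?ltW// mulrAC -powRD; last by rewrite (gt_eqF t0) implybT.
  rewrite mulrC; congr (_ * _ `^ _); last by ring.
  by rewrite -powR_inv1 // -powRrM mulN1r opprK.
rewrite /A /B mulrA tE mulrA tE (_ : 1 - e - c = 1 - c - e); last by ring.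
by ring.
Qed.

Definition betaC (c e : R) := 2 `^ e / (1 - c) + 2 `^ c / (1 - e).

Lemma betaC_ge0 c e : c < 1 -> e < 1 -> 0 <= betaC c e.
Proof.
by move=> c1 e1; rewrite addr_ge0// divr_ge0 ?powR_ge0// subr_ge0 ltW.
Qed.

Lemma dominated_by_beta (f : R -> R) (t c e A : R) : 0 < t -> 0 <= c < 1 ->
  0 <= e < 1 -> 0 <= A -> measurable_fun `]0, t[ f ->
  (forall s, 0 < s < t -> `|f s| <= A * ((t - s) `^ (- c) * s `^ (- e))) ->
  leb.-integrable `]0, t[ (EFin \o f) /\
  `|\int[leb]_(s in `]0, t[) f s| <= A * (betaC c e * t `^ (1 - c - e)).
Proof.
move=> t0 c01 e01 A0 mf fb.
have [mb ib] := beta_integral_le t0 c01 e01.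
have bnd : (\int[leb]_(s in `]0%R, t[) `|(f s)%:E| <=
    (A * (betaC c e * t `^ (1 - c - e)))%:E)%E.
  apply: (@le_trans _ _ (\int[leb]_(s in `]0%R, t[)
      (A%:E * ((t - s) `^ (- c) * s `^ (- e))%:E))%E).
    apply: ge0_le_integral => //.
    - by apply: measurableT_comp => //; exact/measurable_EFinP.
    - by apply: emeasurable_funM => //; exact/measurable_EFinP.
  rewrite ge0_integralZl//; last 2 first.
  - exact/measurable_EFinP.
  - by move=> s _; rewrite lee_fin mulr_ge0 ?powR_ge0.
  by rewrite EFinM; apply: lee_pmul => //; apply: integral_ge0 => s _;
    rewrite lee_fin mulr_ge0 ?powR_ge0.
have intf : leb.-integrable `]0, t[ (EFin \o f).
  apply/integrableP; split; first exact/measurable_EFinP.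
  by rewrite (le_lt_trans bnd)// ltry.
split=> //.
by rewrite -lee_fin EFin_normr_Rintegral// (le_trans _ bnd)// le_abse_integral//;
  exact/measurable_EFinP.
Qed.

End singular_integrals.

Section integral_sums.
Context d (T : measurableType d) (R : realType) (m : {measure set T -> \bar R}).

Lemma integrable_sumR (D : set T) I (s : seq I) (F : I -> T -> R) : measurable D ->
  (forall i, m.-integrable D (EFin \o F i)) ->
  m.-integrable D (EFin \o (fun x => \sum_(i <- s) F i x)).
Proof.
move=> mD iF; elim: s => [|i s IH].
  by under eq_fun do rewrite big_nil; exact: integrable0.
rewrite (_ : EFin \o _ = (EFin \o F i) \+ (EFin \o (fun x => \sum_(i <- s) F i x))).
  exact: integrableD.
by apply/funext => x /=; rewrite big_cons EFinD.
Qed.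

Lemma Rintegral_sumR (D : set T) I (s : seq I) (F : I -> T -> R) : measurable D ->
  (forall i, m.-integrable D (EFin \o F i)) ->
  \int[m]_(x in D) (\sum_(i <- s) F i x) = \sum_(i <- s) \int[m]_(x in D) F i x.
Proof.
move=> mD iF; elim: s => [|i s IH].
  under eq_Rintegral do rewrite big_nil.
  by rewrite big_nil /Rintegral integral0.
rewrite big_cons -IH -RintegralD//; last exact: integrable_sumR.
by apply: eq_Rintegral => x _; rewrite big_cons.
Qed.

Lemma integrableZR (D : set T) c (f : T -> R) : measurable D ->
  m.-integrable D (EFin \o f) -> m.-integrable D (EFin \o (fun x => c * f x)).
Proof.
move=> mD fi; rewrite (_ : EFin \o _ = (fun x => c%:E * (EFin \o f) x)%E).
  exact: integrableZl.
by apply/funext => x /=; rewrite EFinM.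
Qed.

Lemma integrableDR (D : set T) (f g : T -> R) : measurable D ->
  m.-integrable D (EFin \o f) -> m.-integrable D (EFin \o g) ->
  m.-integrable D (EFin \o (fun x => f x + g x)).
Proof.
move=> mD fi gi; rewrite (_ : EFin \o _ = (EFin \o f) \+ (EFin \o g)).
  exact: integrableD.
by apply/funext => x /=; rewrite EFinD.
Qed.

End integral_sums.

(** Measurability in the parameter of an integral, for an integrand without
    sign. *)
Lemma measurable_partial_integral (R : realType) d1 d2 (S : measurableType d1)
    (T : measurableType d2) (P : {sigma_finite_measure set T -> \bar R}) (G : S * T -> R) :
  measurable_fun setT G -> (forall s, P.-integrable setT (EFin \o (fun y => G (s, y)))) ->
  measurable_fun setT (fun s => \int[P]_y G (s, y)).
Proof.
move=> mG iG.
have mE : measurable_fun setT (EFin \o G) by exact/measurable_EFinP.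
have mp := @measurable_fun_fubini_tonelli_F _ _ _ _ _ P _ (measurable_funepos mE) (fun x => funepos_ge0 _ x).
have mn := @measurable_fun_fubini_tonelli_F _ _ _ _ _ P _ (measurable_funeneg mE) (fun x => funeneg_ge0 _ x).
have := emeasurable_funB mp mn => H.
apply/measurable_EFinP; apply: eq_measurable_fun H => s _ /=.
rewrite /Rintegral fineK; last by apply: integrable_fin_num => //; exact: iG.
rewrite integralE /fubini_F; congr (_ - _)%E; apply: eq_integral => y _.
  by rewrite !funeposE.
by rewrite !funenegE.
Qed.

(** * Reconstruction from Fourier coefficients *)

Section reconstruction.
Context {R : realType} {d : nat}.
Local Notation point := 'rV[R]_d.
Local Notation freq := 'rV[int]_d.
Local Notation mu := (torus_measure R d).

(** Conjugate symmetry, the condition that the coefficients of a real function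
    satisfy. *)
Definition csym (z : freq -> R[i]) := forall l,
  complex.Re (z (- l)) = complex.Re (z l) /\
  complex.Im (z (- l)) = - complex.Im (z l).

Lemma csym_fourier_coef (u : point -> R) : bmeas u -> csym (fourier_coef (dist_of_fun u)).
Proof.
move=> bu l; rewrite !Re_fourier_coef !Im_fourier_coef opprK; split.
  by apply: eq_Rintegral => y _; rewrite coslNl.
under eq_Rintegral do rewrite sinlNl mulrN.
by rewrite RintegralN_bmeas ?opprK//; apply: bmeasM => //; exact: bmeas_sinl.
Qed.

Lemma ReB (u w : R[i]) : complex.Re (u - w) = complex.Re u - complex.Re w.
Proof. by case: u w => ? ? []. Qed.

Lemma ImB (u w : R[i]) : complex.Im (u - w) = complex.Im u - complex.Im w.
Proof. by case: u w => ? ? []. Qed.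

Lemma csym_sub z w : csym z -> csym w -> csym (fun l => z l - w l).
Proof.
move=> cz cw l; have [h1 h2] := cz l; have [h3 h4] := cw l.
by rewrite !ReB !ImB h1 h2 h3 h4; split=> //; ring.
Qed.

Lemma Rintegral_cosl_cosl (l m : freq) :
  \int[mu]_x (cosl l x * cosl m x) = ((l == m)%:R + (l == - m)%:R) / 2.
Proof.
have E x : cosl l x * cosl m x = 2^-1 * (cosl (l - m) x + cosl (l + m) x).
  by rewrite coslBl coslDl; field.
under eq_Rintegral do rewrite E.
have bc := @bmeas_cosl R d.
rewrite RintegralZ_bmeas; last exact: bmeasD.
rewrite RintegralD_bmeas//.
have [-> _] := @Rintegral_character R _ (l - m).
have [-> _] := @Rintegral_character R _ (l + m).
by rewrite subr_eq0 addr_eq0 mulrC.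
Qed.

Lemma Rintegral_sinl_sinl (l m : freq) :
  \int[mu]_x (sinl l x * sinl m x) = ((l == m)%:R - (l == - m)%:R) / 2.
Proof.
have E x : sinl l x * sinl m x = 2^-1 * (cosl (l - m) x - cosl (l + m) x).
  by rewrite coslBl coslDl; field.
under eq_Rintegral do rewrite E.
have bc := @bmeas_cosl R d.
rewrite RintegralZ_bmeas; last exact: bmeasB.
rewrite RintegralB_bmeas//.
have [-> _] := @Rintegral_character R _ (l - m).
have [-> _] := @Rintegral_character R _ (l + m).
by rewrite subr_eq0 addr_eq0 mulrC.
Qed.

Lemma Rintegral_sinl_cosl (l m : freq) :
  \int[mu]_x (sinl l x * cosl m x) = 0.
Proof.
have E x : sinl l x * cosl m x = 2^-1 * (sinl (l - m) x + sinl (l + m) x).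
  by rewrite sinlBl sinlDl; field.
under eq_Rintegral do rewrite E.
have bs := @bmeas_sinl R d.
rewrite RintegralZ_bmeas; last exact: bmeasD.
rewrite RintegralD_bmeas//.
have [_ ->] := @Rintegral_character R _ (l - m).
have [_ ->] := @Rintegral_character R _ (l + m).
by rewrite addr0 mulr0.
Qed.

Lemma bmeas_Re_fmul a z : finsupp a -> bmeas (fun x : point => complex.Re (fmul a z x)).
Proof.
move=> [K aK]; under eq_fun do rewrite (Re_fmul _ _ aK).
apply: bmeas_sum => l; apply/bmeasZ/bmeasB; apply: bmeasZ;
  [exact: bmeas_cosl|exact: bmeas_sinl].
Qed.

Lemma big_finsupp K (a : freq -> R) (F : freq -> R) l :
  (forall l, a l != 0 -> inbox K l) ->
  \sum_(m <- box K) a m * ((m == l)%:R * F m) = a l * F l.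
Proof.
move=> aK; have [al|al] := eqVneq (a l) 0.
  rewrite al mul0r big1// => m _; have [->|_] := eqVneq m l; first by rewrite al mul0r.
  by rewrite mul0r mulr0.
rewrite (bigD1_seq l)/=; [|exact/mem_box/aK|exact: box_uniq].
rewrite eqxx mul1r big1 ?addr0// => m /negbTE ->.
by rewrite mul0r mulr0.
Qed.

(** The real part does not alter the coefficients, because a is even and z
    conjugate-symmetric. *)
Lemma fourier_coef_fmul a z l : finsupp a -> (forall l, a (- l) = a l) -> csym z ->
  fourier_coef (dist_of_fun (fun x : point => complex.Re (fmul a z x))) l =
  (a l)%:C%C * z l.
Proof.
move=> [K aK] ae cz; have bc := @bmeas_cosl R d; have bs := @bmeas_sinl R d.
have [zR zI] := cz l.
have H (g : point -> R) : bmeas g -> \int[mu]_x (complex.Re (fmul a z x) * g x) =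
    \sum_(m <- box K) a m * (complex.Re (z m) * (\int[mu]_x (cosl m x * g x))
       - complex.Im (z m) * (\int[mu]_x (sinl m x * g x))).
  move=> bg; under eq_Rintegral do rewrite (Re_fmul _ _ aK) big_distrl/=.
  rewrite Rintegral_sum_bmeas; last first.
    by move=> m; apply: bmeasM => //; apply/bmeasZ/bmeasB; exact: bmeasZ.
  apply: eq_bigr => m _.
  rewrite -!RintegralZ_bmeas; [|exact: bmeasM..].
  rewrite -RintegralB_bmeas; [|by apply: bmeasZ; exact: bmeasM..].
  rewrite -RintegralZ_bmeas; last by apply: bmeasB; apply: bmeasZ; exact: bmeasM.
  by apply: eq_Rintegral => y _; ring.
apply/eqP; rewrite eq_complex Re_fourier_coef Im_fourier_coef ReMr ImMr.
apply/andP; split; apply/eqP.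
  rewrite (H _ (bc l)).
  under eq_bigr => m _.
    rewrite Rintegral_cosl_cosl Rintegral_sinl_cosl mulr0 subr0.
    rewrite (_ : a m * _ = a m * ((m == l)%:R * (complex.Re (z m) / 2)) +
      a m * ((m == - l)%:R * (complex.Re (z m) / 2))); last by field.
    over.
  by rewrite big_split/= !(big_finsupp _ _ aK) ae zR; field.
rewrite (H _ (bs l)).
under eq_bigr => m _.
  under [X in complex.Re _ * X]eq_Rintegral do rewrite mulrC.
  rewrite Rintegral_sinl_cosl Rintegral_sinl_sinl mulr0 sub0r.
  rewrite (_ : a m * _ = a m * ((m == l)%:R * (- complex.Im (z m) / 2)) +
      a m * ((m == - l)%:R * (complex.Im (z m) / 2))); last by field.
  over.
by rewrite big_split/= !(big_finsupp _ _ aK) ae zI; field.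
Qed.

Variable phi : point -> R.
Hypothesis lp : littlewood_paley phi.
Local Notation dyadic := (dyadic phi).

Lemma dyadicN n l : dyadic n (- l) = dyadic n l.
Proof.
have [_ _ rad _ _] := lp; apply: rad; rewrite /euclid; congr (Num.sqrt _).
by apply: eq_bigr => i _; rewrite !mxE rmorphN/= mulrN sqrrN.
Qed.

Definition block z n (x : point) : R := complex.Re (fmul (dyadic n) z x).

(** The zero frequency belongs to no block and is added apart. *)
Definition partial_rec z K (x : point) : R := complex.Re (z 0) + \sum_(n < K) block z n x.

(** The function with Fourier coefficients z, as the sum of its dyadic
    blocks. *)
Definition rec z (x : point) : R := limn (fun K => partial_rec z K x).

(** Absolute uniform summability of the blocks, with an explicit bound. *)
Definition block_bound z (b : nat -> R) (S : R) :=
  (forall n x, `|block z n x| <= b n) /\ (forall K, \sum_(n < K) b n <= S).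

Lemma cvg_rec z b S x : block_bound z b S ->
  partial_rec z K x @[K --> \oo] --> rec z x.
Proof.
move=> [hb hS]; apply: (@is_cvgD _ R^o) ; first exact: is_cvg_cst.
rewrite (_ : (fun K => _) = series (block z ^~ x)); last first.
  by apply/funext => K; rewrite /series/= big_mkord.
apply: normed_cvg; apply: nondecreasing_is_cvgn.
  by apply: nondecreasing_series => n _ _ /=.
exists S => _ [K _ <-] /=; rewrite /series/= big_mkord (le_trans _ (hS K))//.
by apply: ler_sum => n _; exact: hb.
Qed.

Lemma partial_rec_le z b S K x : block_bound z b S ->
  `|partial_rec z K x| <= `|complex.Re (z 0)| + S.
Proof.
move=> [hb hS]; rewrite (le_trans (ler_normD _ _))// lerD2l (le_trans _ (hS K))//.
by rewrite (le_trans (ler_norm_sum _ _ _))//; apply: ler_sum => n _; exact: hb.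
Qed.

Lemma cvg_norm_le (u : nat -> R) (l B : R) : u n @[n --> \oo] --> l ->
  (forall n, `|u n| <= B) -> `|l| <= B.
Proof.
move=> ul uB; have cu : `|u n| @[n --> \oo] --> `|l| by exact: cvg_norm.
rewrite -(cvg_lim _ cu)//; apply: limr_le; first by apply/cvg_ex; exists `|l|.
exact: nearW.
Qed.

Lemma rec_le z b S x : block_bound z b S -> `|rec z x| <= `|complex.Re (z 0)| + S.
Proof.
move=> hz; apply: (cvg_norm_le (cvg_rec (x := x) hz)) => K.
exact: partial_rec_le hz.
Qed.

Lemma block_sub z w n x : block (fun l => z l - w l) n x = block z n x - block w n x.
Proof.
have [K aK] := finsupp_dyadic lp n.
rewrite /block !(Re_fmul _ _ aK) -sumrB; apply: eq_bigr => l _.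
by case: (z l) (w l) => a b [u v] /=; ring.
Qed.

Lemma rec_sub_le z w b S bz Sz bw Sw x :
  block_bound z bz Sz -> block_bound w bw Sw ->
  block_bound (fun l => z l - w l) b S ->
  `|rec z x - rec w x| <= `|complex.Re (z 0 - w 0)| + S.
Proof.
move=> hz hw hzw.
apply: (cvg_norm_le (cvgB (cvg_rec (x := x) hz) (cvg_rec hw))) => K.
rewrite (_ : _ - _ = partial_rec (fun l => z l - w l) K x).
  exact: partial_rec_le hzw.
rewrite /partial_rec; under [in RHS]eq_bigr do rewrite block_sub.
rewrite sumrB; case: (z 0) (w 0) => a c [u v] /=; ring.
Qed.

Lemma bmeas_partial_rec z K : bmeas (partial_rec z K).
Proof.
apply: bmeasD; first exact: bmeas_cst.
by apply: bmeas_sum => n; exact/bmeas_Re_fmul/finsupp_dyadic.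
Qed.

Lemma cvg_Rintegral_rec z b S g : block_bound z b S -> bmeas g ->
  \int[mu]_x (partial_rec z K x * g x) @[K --> \oo] --> \int[mu]_x (rec z x * g x).
Proof.
move=> hz [mg [B hB]].
have [] := @bounded_convergence _ _ _ mu (fun K x => partial_rec z K x * g x)
  (fun x => rec z x * g x) ((`|complex.Re (z 0)| + S) * B) => //.
- by move=> K; apply: measurable_funM => //; case: (bmeas_partial_rec z K).
- move=> K x; rewrite normrM ler_pM//; exact: partial_rec_le hz.
- by move=> x; apply: cvgM; [exact: cvg_rec hz|exact: cvg_cst].
Qed.

Lemma Rintegral_partial_rec z K g : bmeas g ->
  \int[mu]_x (partial_rec z K x * g x) = complex.Re (z 0) * \int[mu]_x g x +
    \sum_(n < K) \int[mu]_x (block z n x * g x).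
Proof.
move=> bg; under eq_Rintegral do rewrite mulrDl big_distrl/=.
have bb n : bmeas (fun x => block z n x * g x).
  by apply: bmeasM => //; exact/bmeas_Re_fmul/finsupp_dyadic.
by rewrite RintegralD_bmeas ?Rintegral_sum_bmeas ?RintegralZ_bmeas//;
  [exact: bmeasZ|exact: bmeas_sum].
Qed.

Lemma rec_periodic z : zd_periodic (rec z).
Proof.
move=> x l; rewrite /rec; congr (limn _); apply/funext => K; congr (_ + _).
apply: eq_bigr => n _; have [k aK] := finsupp_dyadic lp n.
by rewrite /block !(Re_fmul _ _ aK); apply: eq_bigr => m _; rewrite cosl_periodic sinl_periodic.
Qed.

Lemma Im_csym0 z : csym z -> complex.Im (z 0) = 0.
Proof. by move=> /(_ 0) [_]; rewrite oppr0; lra. Qed.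

(** For each frequency the coefficients of the partial sums are eventually
    constant, by the partition of unity, and bounded convergence passes to the
    limit. *)
Theorem fourier_coef_rec z b S l : csym z -> block_bound z b S ->
  fourier_coef (dist_of_fun (rec z)) l = z l.
Proof.
move=> cz hz.
have [K0 hK0] := dyadic_vanish lp l.
have sumK K : (K0 <= K)%N -> \sum_(n < K) dyadic n l = (l != 0)%:R.
  move=> KK; have [->|l0] := eqVneq l 0.
    by rewrite big1// => n _; exact: dyadic0.
  by apply: dyadic_partition => // m /(leq_trans KK); exact: hK0.
have [c1 c2] := @Rintegral_character R d l.
have fcb n : fourier_coef (dist_of_fun (block z n)) l = (dyadic n l)%:C%C * z l.
  by apply: fourier_coef_fmul => //; [exact: finsupp_dyadic|exact: dyadicN].
apply/eqP; rewrite eq_complex Re_fourier_coef Im_fourier_coef.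
apply/andP; split; apply/eqP.
  apply: cvg_unique (cvg_Rintegral_rec hz (bmeas_cosl l)) _ => //.
  apply: (@cvg_near_cst _ _ _ _ _ _) => //; exists K0 => // K /= KK.
  rewrite Rintegral_partial_rec; last exact: bmeas_cosl.
  under eq_bigr do rewrite -Re_fourier_coef fcb ReMr.
  rewrite -big_distrl/= sumK// c1.
  by have [->|_] := eqVneq l 0; rewrite ?mulr1 ?mulr0 ?mul0r ?mul1r ?addr0 ?add0r.
rewrite -[RHS]opprK; congr (- _).
apply: cvg_unique (cvg_Rintegral_rec hz (bmeas_sinl l)) _ => //.
apply: (@cvg_near_cst _ _ _ _ _ _) => //; exists K0 => // K /= KK.
rewrite Rintegral_partial_rec; last exact: bmeas_sinl.
under eq_bigr do rewrite -[Rintegral _ _ _]opprK -Im_fourier_coef fcb ImMr -mulNr.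
rewrite -big_distrl/= sumrN sumK// c2 mulr0 add0r.
have [->|_] := eqVneq l 0; rewrite ?mulN1r//.
by rewrite Im_csym0// mulr0 oppr0.
Qed.

End reconstruction.

Lemma powR_gt1 (R : realType) (a r : R) : 1 < a -> 0 < r -> 1 < a `^ r.
Proof.
move=> a1 r0; have a0 := lt_trans ltr01 a1.
have := @gt0_ltr_powR _ r r0 1 a; rewrite powR1.
by apply => //; rewrite nnegrE ?ler01// (ltW a0).
Qed.

(** * The Duhamel term *)

Section duhamel.
Context {R : realType} {d : nat}.
Local Notation point := 'rV[R]_d.
Local Notation freq := 'rV[int]_d.
Local Notation mu := (torus_measure R d).
Local Notation leb := (@lebesgue_measure R).
Local Notation forcing := ('I_d -> 'I_d -> point -> R).
Variables (beta : R) (phi : point -> R).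
Hypothesis beta0 : 0 < beta.
Hypothesis lp : littlewood_paley phi.
Local Notation dyadic := (dyadic phi).
Local Notation block := (block phi).
Local Notation fl := (frac_laplacian beta).

(** The coefficients of P div F for an arbitrary tensor F, of which v (x) v is one
    case; differences of such tensors are needed too. *)
Definition leray_div (F : forcing) (l : freq) (i : 'I_d) : R[i] :=
  \sum_(j < d) (leray l i j)%:C%C *
    \sum_(k < d) (0 +i* (2 * pi * (l 0 k)%:~R))%C *
      fourier_coef (dist_of_fun (F j k)) l.

Lemma Re_leray_div F l i : complex.Re (leray_div F l i) =
  \sum_(j < d) \sum_(k < d) leray l i j * (2 * pi * (l 0 k)%:~R) *
     \int[mu]_y (F j k y * sinl l y).
Proof.
rewrite Re_sum; apply: eq_bigr => j _; rewrite ReMr Re_sum big_distrr/=.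
by apply: eq_bigr => k _; rewrite mul0r sub0r -mulrN opprK; exact: mulrA.
Qed.

Lemma Im_leray_div F l i : complex.Im (leray_div F l i) =
  \sum_(j < d) \sum_(k < d) leray l i j * (2 * pi * (l 0 k)%:~R) *
     \int[mu]_y (F j k y * cosl l y).
Proof.
rewrite Im_sum; apply: eq_bigr => j _; rewrite ImMr Im_sum big_distrr/=.
by apply: eq_bigr => k _; rewrite mul0r add0r; exact: mulrA.
Qed.

Lemma leray_div_sub F G l i : (forall j k, bmeas (F j k)) -> (forall j k, bmeas (G j k)) ->
  leray_div (fun j k y => F j k y - G j k y) l i = leray_div F l i - leray_div G l i.
Proof.
move=> bF bG; apply/eqP; rewrite eq_complex.
have E (g : point -> R) j k : bmeas g -> \int[mu]_y ((F j k y - G j k y) * g y) =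
    \int[mu]_y (F j k y * g y) - \int[mu]_y (G j k y * g y).
  move=> bg; under eq_Rintegral do rewrite mulrBl.
  by rewrite RintegralB_bmeas//; exact: bmeasM.
rewrite ReB ImB !Re_leray_div !Im_leray_div -!sumrB; apply/andP; split; apply/eqP;
  apply: eq_bigr => j _; rewrite -sumrB; apply: eq_bigr => k _; rewrite E ?mulrBr//;
  [exact: bmeas_sinl|exact: bmeas_cosl].
Qed.

Lemma csym_leray_div F i : (forall j k, bmeas (F j k)) -> csym (leray_div F ^~ i).
Proof.
move=> bF l; have lE j : leray (- l) i j = leray l i j.
  by rewrite /leray (_ : euclid _ = euclid (real_freq l))//; [
    rewrite !mxE !rmorphN/= mulrNN |
    rewrite /euclid; congr (Num.sqrt _); apply: eq_bigr => k _; rewrite !mxE rmorphN/= sqrrN].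
have kE k : 2 * pi * ((- l) 0 k)%:~R = - (2 * pi * (l 0 k)%:~R) :> R.
  by rewrite !mxE rmorphN/= mulrN.
rewrite !Re_leray_div !Im_leray_div -sumrN; split; apply: eq_bigr => j _; rewrite ?sumrN -?sumrN;
  apply: eq_bigr => k _; rewrite lE kE mulrN mulNr.
  rewrite -mulrN; congr (_ * _).
  rewrite -RintegralN_bmeas; last by apply: bmeasM => //; exact: bmeas_sinl.
  by apply: eq_Rintegral => y _; rewrite sinlNl mulrN opprK.
by congr (- (_ * _)); apply: eq_Rintegral => y _; rewrite coslNl.
Qed.

Lemma leray_div0 F i : leray_div F 0 i = 0.
Proof.
rewrite /leray_div big1// => j _; rewrite big1 ?mulr0// => k _.
by rewrite mxE mulr0z mulr0 mul0r.
Qed.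

Lemma uniform_constant (I : finType) (P : I -> R -> Prop) :
  (forall i C C', C <= C' -> P i C -> P i C') ->
  (forall i, exists2 C, 0 <= C & P i C) -> exists2 C, 0 <= C & forall i, P i C.
Proof.
move=> mono hP.
have /(@choice _ _) [f hf] : forall i, exists C, 0 <= C /\ P i C.
  by move=> i; have [C C0 PC] := hP i; exists C.
exists (\sum_i f i); first by apply: sumr_ge0 => i _; case: (hf i).
move=> i; apply: (mono _ (f i)); last by case: (hf i).
by rewrite (bigD1 i)//= lerDl; apply: sumr_ge0 => j _; case: (hf j).
Qed.

(** The factor lam comes from the homogeneity of degree 1 of [leray_symbol]. *)
Lemma heat_leray_block : exists2 C : R, 0 <= C &
  forall t n (F : forcing) (U : R) x i, 0 <= t -> (forall j k, bmeas (F j k)) ->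
    (forall j k y, `|F j k y| <= U) ->
  `|complex.Re (fmul (fun l => dyadic n l * expR (- t * fl l)) (leray_div F ^~ i) x)| <=
    C * lam n * U / (1 + t * lam n `^ (2 * beta)).
Proof.
have [| |C C0 hC] := @uniform_constant ('I_d * 'I_d * 'I_d)%type (fun p C =>
   forall t n u (U : R) x, 0 <= t -> bmeas u -> (forall y, `|u y| <= U) ->
   `|complex.Im (fmul (fun l => dyadic n l * (expR (- t * fl l) *
      leray_symbol p.1.1 p.1.2 p.2 ((lam n)^-1 *: real_freq l)))
      (fourier_coef (dist_of_fun u)) x)| <= C * U / (1 + t * lam n `^ (2 * beta))).
- move=> p C C' CC' h t n u U x t0 bu uU; rewrite (le_trans (h _ _ _ _ _ t0 bu uU))//.
  rewrite ler_wpM2r ?invr_ge0 ?addr_ge0 ?mulr_ge0 ?powR_ge0// ler_wpM2r//.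
  by rewrite (le_trans _ (uU 0)).
- move=> [[i j] k]; have [C C0 hC] := heat_block_bounded beta0 lp (symbol_leray i j k).
  by exists C => // t n u U x t0 bu uU; have [] := hC t n u U x t0 bu uU.
exists (d%:R * d%:R * C); first by rewrite !mulr_ge0.
move=> t n F U x i t0 bF FU.
have [K aK] := finsupp_dyadic lp n.
have aK1 (b : freq -> R) l : dyadic n l * b l != 0 -> inbox K l.
  by move=> h; apply: aK; apply: contra_neq h => ->; rewrite mul0r.
have -> : complex.Re (fmul (fun l => dyadic n l * expR (- t * fl l)) (leray_div F ^~ i) x) =
    \sum_(j < d) \sum_(k < d) (- lam n) *
    complex.Im (fmul (fun l => dyadic n l * (expR (- t * fl l) *
      leray_symbol i j k ((lam n)^-1 *: real_freq l)))
      (fourier_coef (dist_of_fun (F j k))) x).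
  rewrite (Re_fmul _ _ (aK1 _)).
  under [RHS]eq_bigr => j _.
    under eq_bigr => k _ do rewrite (Im_fmul _ _ (aK1 _)) big_distrr/=.
    rewrite exchange_big/=; over.
  rewrite exchange_big/=; apply: eq_bigr => l _.
  rewrite Re_leray_div Im_leray_div !big_distrl/= -sumrB big_distrr/=; apply: eq_bigr => j _.
  rewrite !big_distrl/= -sumrB big_distrr/=; apply: eq_bigr => k _.
  rewrite (leray_homogeneous n).
  rewrite -[dist_of_fun _ (fun _ => cos _)]/(\int[mu]_y (F j k y * cosl l y)).
  rewrite -[dist_of_fun _ (fun _ => sin _)]/(\int[mu]_y (F j k y * sinl l y)).
  ring.
have L0 : 0 <= lam n :> R by exact/ltW/lam_gt0.
set B := _ * U / _.
have -> : B = \sum_(j < d) \sum_(k < d) lam n * (C * U / (1 + t * lam n `^ (2 * beta))).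
  rewrite !sumr_const !card_ord /B -mulrnA -[RHS]mulr_natl natrM; ring.
rewrite (le_trans (ler_norm_sum _ _ _))//; apply: ler_sum => j _.
rewrite (le_trans (ler_norm_sum _ _ _))//; apply: ler_sum => k _.
rewrite normrM normrN (ger0_norm L0) ler_wpM2l//.
exact: (hC (i, j, k)).
Qed.

(** Forcing terms with the singularity at the initial time that a product of two
    solutions may have. *)
Definition admissible (sigma : R) (F : R -> forcing) :=
  (forall j k, measurable_fun setT
    (fun p : measurableTypeR R * point => F p.1 j k p.2)) /\
  exists2 A, 0 <= A & forall s j k y, `|F s j k y| <= A * s `^ (- sigma).

Lemma admissible_bmeas sigma F s j k : admissible sigma F -> bmeas (F s j k).
Proof.
move=> [mF [A A0 hA]]; split; last by exists (A * s `^ (- sigma)) => y.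
exact: (measurable_fun_pair2 s (mF j k)).
Qed.

Lemma measurable_moment sigma F j k (g : point -> R) : admissible sigma F -> bmeas g ->
  measurable_fun setT (fun s : measurableTypeR R => \int[mu]_y (F s j k y * g y)).
Proof.
move=> aF bg; have [mF _] := aF.
apply: (@measurable_partial_integral R _ _ _ _ mu
  (fun p : measurableTypeR R * point => F p.1 j k p.2 * g p.2)).
  apply: measurable_funM => //; apply: (@measurableT_comp _ _ _ _ _ _ g) => //.
  by case: bg.
by move=> s; apply: bmeas_integrable; apply: bmeasM => //; exact: admissible_bmeas aF.
Qed.

Lemma measurable_Re_leray_div sigma F l i : admissible sigma F ->
  measurable_fun setT (fun s : measurableTypeR R => complex.Re (leray_div (F s) l i)).
Proof.
move=> aF; under eq_fun do rewrite Re_leray_div.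
apply: measurable_sum => j; apply: measurable_sum => k; apply: measurable_funM => //.
by apply: measurable_moment aF _; exact: bmeas_sinl.
Qed.

Lemma measurable_Im_leray_div sigma F l i : admissible sigma F ->
  measurable_fun setT (fun s : measurableTypeR R => complex.Im (leray_div (F s) l i)).
Proof.
move=> aF; under eq_fun do rewrite Im_leray_div.
apply: measurable_sum => j; apply: measurable_sum => k; apply: measurable_funM => //.
by apply: measurable_moment aF _; exact: bmeas_cosl.
Qed.

(** A crude bound that depends on the frequency: enough for integrability in
    time at a fixed frequency. *)
Definition leray_div_norm (l : freq) i : R :=
  \sum_(j < d) \sum_(k < d) `|leray l i j * (2 * pi * (l 0 k)%:~R)|.

Lemma leray_div_norm_ge0 l i : 0 <= leray_div_norm l i.
Proof. by apply: sumr_ge0 => j _; apply: sumr_ge0. Qed.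

Lemma leray_div_le (F : forcing) (U : R) l i : (forall j k, bmeas (F j k)) ->
  (forall j k y, `|F j k y| <= U) ->
  `|complex.Re (leray_div F l i)| <= leray_div_norm l i * U /\
  `|complex.Im (leray_div F l i)| <= leray_div_norm l i * U.
Proof.
move=> bF FU.
have H (g : point -> R) j k : bmeas g -> (forall y, `|g y| <= 1) ->
    `|\int[mu]_y (F j k y * g y)| <= U.
  move=> bg g1; apply: le_Rintegral_bounded.
    by case: (bmeasM (bF j k) bg).
  by move=> y; rewrite normrM -[U]mulr1 ler_pM.
rewrite Re_leray_div Im_leray_div /leray_div_norm big_distrl/=; split;
  rewrite (le_trans (ler_norm_sum _ _ _))//; apply: ler_sum => j _;
  rewrite big_distrl/= (le_trans (ler_norm_sum _ _ _))//; apply: ler_sum => k _;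
  rewrite normrM ler_wpM2l//; apply: H;
  [exact: bmeas_sinl|move=> y; exact: norm_sinl|exact: bmeas_cosl|move=> y; exact: norm_cosl].
Qed.

Lemma fl_ge0 (l : freq) : 0 <= fl l.
Proof. exact: powR_ge0. Qed.

Lemma flN (l : freq) : fl (- l) = fl l.
Proof.
rewrite /frac_laplacian; congr ((_ * Num.sqrt _) `^ _).
by apply: eq_bigr => k _; rewrite !mxE rmorphN/= sqrrN.
Qed.

Lemma fl0 : fl (0 : freq) = 0.
Proof.
rewrite frac_laplacianE /fracp (_ : sqnorm _ = 0).
  by rewrite powR0 ?mulr0// gt_eqF.
by rewrite /sqnorm big1// => i _; rewrite !mxE expr0n.
Qed.

Definition duhamel_term (F : R -> forcing) t l i s : R[i] :=
  (expR (- (t - s) * fl l))%:C%C * leray_div (F s) l i.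

Definition duhamel_coef (F : R -> forcing) t l i : R[i] := cintegral `]0, t[ (duhamel_term F t l i).

Lemma eq_cintegral (D : set R) (f g : R -> R[i]) : (forall s, s \in D -> f s = g s) ->
  cintegral D f = cintegral D g.
Proof.
move=> fg; rewrite /cintegral; apply/eqP; rewrite eq_complex /=.
by apply/andP; split; apply/eqP; apply: eq_Rintegral => s /fg ->.
Qed.

Lemma measurable_heat_kernel (l : freq) (t : R) :
  measurable_fun setT (fun s : measurableTypeR R => expR (- (t - s) * fl l) : R).
Proof.
apply: measurableT_comp => //; apply: measurable_funM => //.
by apply: measurableT_comp => //; exact: measurable_funB.
Qed.

Variable sigma : R.
Hypothesis sigma01 : 0 <= sigma < 1.

Lemma duhamel_term_dominated F t l i (c : R -> R) : admissible sigma F -> 0 < t ->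
  measurable_fun setT (c : measurableTypeR R -> R) ->
  (forall s (U : R), (forall j k y, `|F s j k y| <= U) -> `|c s| <= leray_div_norm l i * U) ->
  leb.-integrable `]0, t[ (EFin \o (fun s => expR (- (t - s) * fl l) * c s)).
Proof.
move=> aF t0 mc hc; have [mF [A A0 hA]] := aF.
have [|||||] := @dominated_by_beta R (fun s => expR (- (t - s) * fl l) * c s) t 0 sigma
  (leray_div_norm l i * A) t0 => //.
- by rewrite lexx ltr01.
- by rewrite mulr_ge0 ?leray_div_norm_ge0.
- by apply: measurable_funTS; apply: measurable_funM => //; exact: measurable_heat_kernel.
move=> s /andP[s0 st]; rewrite oppr0 powRr0 mul1r normrM ger0_norm ?expR_ge0//.
rewrite -mulrA -[leRHS]mul1r ler_pM ?expR_ge0//; last by apply: hc => j k y; exact: hA.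
by rewrite -expR0 ler_expR mulNr oppr_le0 mulr_ge0 ?fl_ge0// subr_ge0 ltW.
Qed.

Lemma duhamel_term_integrable F t l i : admissible sigma F -> 0 < t ->
  cintegrable `]0, t[ (duhamel_term F t l i).
Proof.
move=> aF t0; have bF s j k := admissible_bmeas s j k aF.
split.
  rewrite (_ : (fun s => _) = EFin \o (fun s => expR (- (t - s) * fl l) *
    complex.Re (leray_div (F s) l i))); last by apply/funext => s /=; rewrite ReMr.
  apply: (duhamel_term_dominated (i := i)) aF t0 (measurable_Re_leray_div l i aF) _ => s U FU.
  by have [] := leray_div_le l i (bF s) FU.
rewrite (_ : (fun s => _) = EFin \o (fun s => expR (- (t - s) * fl l) *
    complex.Im (leray_div (F s) l i))); last by apply/funext => s /=; rewrite ImMr.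
apply: (duhamel_term_dominated (i := i)) aF t0 (measurable_Im_leray_div l i aF) _ => s U FU.
by have [] := leray_div_le l i (bF s) FU.
Qed.

Lemma Re_duhamel_coef F t l i : complex.Re (duhamel_coef F t l i) =
  \int[leb]_(s in `]0, t[) (expR (- (t - s) * fl l) * complex.Re (leray_div (F s) l i)).
Proof. by congr (Rintegral _ _ _); apply/funext => s; exact: ReMr. Qed.

Lemma Im_duhamel_coef F t l i : complex.Im (duhamel_coef F t l i) =
  \int[leb]_(s in `]0, t[) (expR (- (t - s) * fl l) * complex.Im (leray_div (F s) l i)).
Proof. by congr (Rintegral _ _ _); apply/funext => s; exact: ImMr. Qed.

Lemma duhamel_coef0 F t i : duhamel_coef F t 0 i = 0.
Proof.
apply/eqP; rewrite eq_complex Re_duhamel_coef Im_duhamel_coef; apply/andP; split; apply/eqP;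
  under eq_Rintegral do rewrite leray_div0 mulr0; by rewrite Rintegral_cst ?mul0r.
Qed.

Lemma duhamel_coef_sub F G t l i : admissible sigma F -> admissible sigma G -> 0 < t ->
  duhamel_coef (fun s j k y => F s j k y - G s j k y) t l i = duhamel_coef F t l i - duhamel_coef G t l i.
Proof.
move=> aF aG t0; have bF s j k := admissible_bmeas s j k aF.
have bG s j k := admissible_bmeas s j k aG.
have [iF1 iF2] := duhamel_term_integrable l i aF t0.
have [iG1 iG2] := duhamel_term_integrable l i aG t0.
have E s : duhamel_term (fun s j k y => F s j k y - G s j k y) t l i s =
    duhamel_term F t l i s - duhamel_term G t l i s.
  by rewrite /duhamel_term (leray_div_sub _ _ (bF s) (bG s)) mulrBr.
apply/eqP; rewrite eq_complex; apply/andP; split; apply/eqP => /=; rewrite -RintegralB//;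
  apply: eq_Rintegral => s _; rewrite E;
  by case: (duhamel_term F t l i s) (duhamel_term G t l i s) => ? ? [].
Qed.

Lemma csym_duhamel_coef F t i : admissible sigma F -> 0 < t -> csym (duhamel_coef F t ^~ i).
Proof.
move=> aF t0 l; have bF s j k := admissible_bmeas s j k aF.
have [iF1 iF2] := duhamel_term_integrable l i aF t0.
split.
  apply: etrans (Re_duhamel_coef _ _ _ _) (etrans _ (esym (Re_duhamel_coef _ _ _ _))).
  rewrite flN; apply: eq_Rintegral => s _; congr (_ * _).
  by have [] := csym_leray_div i (bF s) l.
apply: etrans (Im_duhamel_coef _ _ _ _) (etrans _ (congr1 -%R (esym (Im_duhamel_coef _ _ _ _)))).
rewrite flN -[RHS]mulN1r -RintegralZl//; last first.
  by move: iF2; congr (_.-integrable _ _); apply/funext => s; rewrite /= -ImMr.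
apply: eq_Rintegral => s _.
by have [_ ->] := csym_leray_div i (bF s) l; rewrite mulrN mulN1r.
Qed.

(** Interpolation of the heat decay: y^theta <= 1 + y for theta in [0, 1]. *)
Lemma heat_interpolation (theta t : R) n : 0 < t -> 0 <= theta <= 1 ->
  lam n / (1 + t * lam n `^ (2 * beta)) <=
  t `^ (- theta) * lam n `^ (1 - 2 * beta * theta).
Proof.
move=> t0 /andP[th0 th1]; have L0 := @lam_gt0 R n; set L := lam n in L0 *.
have LB : 0 < L `^ (2 * beta) by exact: powR_gt0.
set y := t * L `^ (2 * beta); have y0 : 0 < y by rewrite mulr_gt0.
have yth : y `^ theta <= 1 + y.
  have [y1|y1] := leP y 1.
    have := @ge0_ler_powR _ theta th0 y 1; rewrite !nnegrE powR1 => /(_ (ltW y0) ler01 y1).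
    lra.
  have := ler1_powR (ltW y1) th1; lra.
rewrite ler_pdivrMr ?addr_gt0// (@le_trans _ _ (t `^ (- theta) * L `^ (1 - 2 * beta * theta) * y `^ theta))//.
  have -> : y `^ theta = t `^ theta * L `^ (2 * beta * theta).
    by rewrite /y powRM ?(ltW t0) ?(ltW LB)// -powRrM.
  rewrite mulrACA -!powRD ?(gt_eqF t0) ?(gt_eqF L0) ?implybT//.
  by rewrite addNr powRr0 mul1r subrK powRr1 ?(ltW L0).
by rewrite ler_wpM2l// mulr_ge0 ?powR_ge0.
Qed.

(** One block of the Duhamel term.  The heat decay is traded for the power theta
    of t - s, and the hypothesis on F leaves a Beta integral of exponents theta'
    and sigma.  The exponents differ so that a factor small in t - s, or a weight
    in time, can be absorbed in A. *)
Lemma duhamel_block : exists2 C : R, 0 <= C &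
  forall F t i n x (theta theta' A : R), admissible sigma F -> 0 < t ->
  0 <= theta <= 1 -> 0 <= theta' < 1 -> 0 <= A ->
  (forall s j k y, 0 < s < t -> (t - s) `^ (- theta) * `|F s j k y| <=
     A * ((t - s) `^ (- theta') * s `^ (- sigma))) ->
  `|block (duhamel_coef F t ^~ i) n x| <= C * lam n `^ (1 - 2 * beta * theta) * A *
     (betaC theta' sigma * t `^ (1 - theta' - sigma)).
Proof.
have [C C0 hC] := heat_leray_block; exists C => //.
move=> F t i n x th th' A aF t0 hth hth' A0 hA.
have bF s j k := admissible_bmeas s j k aF.
pose f s := complex.Re (fmul (fun l => dyadic n l * expR (- (t - s) * fl l))
  (leray_div (F s) ^~ i) x).
have [K aK] := finsupp_dyadic lp n.
have aK1 (b : freq -> R) l : dyadic n l * b l != 0 -> inbox K l.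
  by move=> h; apply: aK; apply: contra_neq h => ->; rewrite mul0r.
pose g l s := dyadic n l * (cosl l x * complex.Re (duhamel_term F t l i s) +
  - sinl l x * complex.Im (duhamel_term F t l i s)).
have fE s : f s = \sum_(l <- box K) g l s.
  rewrite /f (Re_fmul _ _ (aK1 _)); apply: eq_bigr => l _.
  by rewrite /g /duhamel_term ReMr ImMr; ring.
have ig l : leb.-integrable `]0, t[ (EFin \o g l).
  have [i1 i2] := duhamel_term_integrable l i aF t0.
  by apply: integrableZR => //; apply: integrableDR => //; exact: integrableZR.
have bE : block (duhamel_coef F t ^~ i) n x = \int[leb]_(s in `]0, t[) f s.
  under eq_Rintegral do rewrite fE.
  rewrite Rintegral_sumR// /block (Re_fmul _ _ aK); apply: eq_bigr => l _.
  have [i1 i2] := duhamel_term_integrable l i aF t0.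
  rewrite RintegralZl//; last by apply: integrableDR => //; exact: integrableZR.
  rewrite RintegralD//; [|exact: integrableZR..].
  by rewrite !RintegralZl//=; ring.
rewrite bE; have L0 : 0 <= lam n `^ (1 - 2 * beta * th) by exact: powR_ge0.
have [| | |_ //] := @dominated_by_beta R f t th' sigma
    (C * lam n `^ (1 - 2 * beta * th) * A) t0 hth' sigma01.
- by rewrite !mulr_ge0.
- rewrite (_ : f = fun s => \sum_(l <- box K) g l s); last exact/funext.
  apply: measurable_sum => l; apply: measurable_funTS.
  have mh := measurable_heat_kernel l t.
  apply: measurable_funM => //; apply: measurable_funD; apply: measurable_funM => //;
    rewrite /duhamel_term; [under eq_fun do rewrite ReMr|under eq_fun do rewrite ImMr];
    apply: measurable_funM => //; [exact: measurable_Re_leray_div aF|exact: measurable_Im_leray_div aF].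
move=> s st; have /andP[s0 s1] := st; have ts : 0 < t - s by rewrite subr_gt0.
pose U := (t - s) `^ th * (A * ((t - s) `^ (- th') * s `^ (- sigma))).
have U0 : 0 <= U by rewrite !mulr_ge0 ?powR_ge0.
have FU j k y : `|F s j k y| <= U.
  rewrite /U -ler_pdivrMl ?powR_gt0// -powRN; exact: hA.
rewrite (le_trans (hC _ _ _ _ _ _ (ltW ts) (bF s) FU))//.
have := heat_interpolation n ts hth; set u := lam n / _ => hu.
rewrite (_ : C * lam n * U / _ = C * U * u); last by rewrite /u; ring.
have CU : 0 <= C * U by exact: mulr_ge0.
rewrite (le_trans (ler_wpM2l CU hu))//.
rewrite le_eqVlt; apply/orP; left; apply/eqP; rewrite /U [(t - s) `^ (- th)]powRN.
field; by rewrite gt_eqF ?powR_gt0.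
Qed.

(** The upper end t is moved into the integrand as an indicator on the product
    space. *)
Lemma measurable_time_integral (c : R -> R) (p : R) :
  measurable_fun setT (c : measurableTypeR R -> R) ->
  (forall t, 0 < t -> leb.-integrable `]0, t[ (EFin \o (fun s => expR (- (t - s) * p) * c s))) ->
  measurable_fun setT (fun t : measurableTypeR R =>
    \int[leb]_(s in `]0, t[) (expR (- (t - s) * p) * c s)).
Proof.
move=> mc ic; pose G (q : measurableTypeR R * measurableTypeR R) : R :=
  if (0 < q.2) && (q.2 < q.1) then expR (- (q.1 - q.2) * p) * c q.2 else 0.
have GE (t : R) : (fun s => G (t, s)) = (fun s => expR (- (t - s) * p) * c s) \_ `]0, t[.
  apply/funext => s; rewrite /G /patch /=.
  by rewrite (_ : (s \in `]0, t[%classic) = (0 < s) && (s < t))// mem_setE in_itv.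
rewrite (_ : (fun t => _) = (fun t => \int[leb]_s G (t, s))); last first.
  by apply/funext => t; rewrite Rintegral_mkcond -GE.
apply: (@measurable_partial_integral R _ _ _ _ leb).
  have m1 : measurable_fun setT (fun q : measurableTypeR R * measurableTypeR R => q.1 : R).
    exact: measurable_fst.
  have m2 : measurable_fun setT (fun q : measurableTypeR R * measurableTypeR R => q.2 : R).
    exact: measurable_snd.
  apply: measurable_fun_ifT => //.
    by apply: measurable_and; exact: measurable_fun_ltr.
  apply: measurable_funM; last exact: (measurableT_comp mc).
  apply: measurableT_comp => //; apply: measurable_funM => //.
  by apply: measurableT_comp => //; exact: measurable_funB.
move=> t; rewrite GE; have [t0|t0] := ltP 0 t.
  by rewrite (_ : EFin \o _ = (EFin \o (fun s => expR (- (t - s) * p) * c s)) \_ `]0, t[);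
    [rewrite -integrable_mkcond//; exact: ic|rewrite restrict_EFin].
rewrite (_ : EFin \o _ = cst 0%E); first exact: integrable0.
apply/funext => s /=; rewrite patchE mem_setE in_itv/=.
by case: ifPn => // /andP[h1 h2]; have := lt_trans h1 h2; rewrite ltNge t0.
Qed.

Lemma measurable_duhamel_coef F l i : admissible sigma F ->
  measurable_fun setT (fun t : measurableTypeR R => complex.Re (duhamel_coef F t l i)) /\
  measurable_fun setT (fun t : measurableTypeR R => complex.Im (duhamel_coef F t l i)).
Proof.
move=> aF; have bF s j k := admissible_bmeas s j k aF; split.
  rewrite (_ : (fun t => _) = (fun t : R => \int[leb]_(s in `]0, t[)
     (expR (- (t - s) * fl l) * complex.Re (leray_div (F s) l i)))); last first.
    by apply/funext => t; exact: Re_duhamel_coef.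
  apply: measurable_time_integral (measurable_Re_leray_div l i aF) _ => t t0.
  apply: (duhamel_term_dominated (i := i)) aF t0 (measurable_Re_leray_div l i aF) _ => s U FU.
  by have [] := leray_div_le l i (bF s) FU.
rewrite (_ : (fun t => _) = (fun t : R => \int[leb]_(s in `]0, t[)
   (expR (- (t - s) * fl l) * complex.Im (leray_div (F s) l i)))); last first.
  by apply/funext => t; exact: Im_duhamel_coef.
apply: measurable_time_integral (measurable_Im_leray_div l i aF) _ => t t0.
apply: (duhamel_term_dominated (i := i)) aF t0 (measurable_Im_leray_div l i aF) _ => s U FU.
by have [] := leray_div_le l i (bF s) FU.
Qed.

End duhamel.

(** * The linear evolution *)

Section linear_evolution.
Context {R : realType} {d : nat}.
Local Notation point := 'rV[R]_d.
Local Notation freq := 'rV[int]_d.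
Local Notation mu := (torus_measure R d).

(** Truncation at height U, which replaces an almost everywhere bounded function
    by a bounded one. *)
Definition clamp (U u : R) : R := Num.max (- U) (Num.min U u).

Lemma clamp_le U u : 0 <= U -> `|clamp U u| <= U.
Proof.
by move=> U0; rewrite ler_norml /clamp !ge_max !le_max ge_min lexx; lra.
Qed.

Lemma clamp_id U u : `|u| <= U -> clamp U u = u.
Proof. by rewrite ler_norml => /andP[h1 h2]; rewrite /clamp (min_idPr h2) (max_idPr h1). Qed.

Lemma bmeas_clamp dT (T : measurableType dT) U (u : T -> R) : 0 <= U ->
  measurable_fun setT u -> bmeas (fun x => clamp U (u x)).
Proof.
move=> U0 mu'; split; last by exists U => x; exact: clamp_le.
apply: measurable_maxr => //; exact: measurable_minr.
Qed.

Lemma fourier_coef_ae (u v : point -> R) l : measurable_fun setT u ->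
  measurable_fun setT v -> {ae mu, forall x, u x = v x} ->
  fourier_coef (dist_of_fun u) l = fourier_coef (dist_of_fun v) l.
Proof.
move=> mu' mv uv; apply/eqP; rewrite eq_complex !Re_fourier_coef !Im_fourier_coef.
have mc := measurable_cosl (R := R) l; have ms := measurable_sinl (R := R) l.
apply/andP; split; apply/eqP; [|congr (- _)]; apply: ae_eq_Rintegral => //;
  try exact: measurable_funM; by apply: filterS uv => x ->.
Qed.

Lemma lam_powS n c : lam n.+1 `^ c = 2 `^ c * lam n `^ c :> R.
Proof. by rewrite lamS powRM// ltW// lam_gt0. Qed.

Lemma geometric_lam_sum (e : R) : 0 < e -> exists2 G : R, 0 <= G &
  forall K, \sum_(n < K) lam n `^ (- e) <= G.
Proof.
move=> e0; have r1 : (2 : R) `^ (- e) < 1.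
  by rewrite powRN invf_lt1 ?powR_gt0// powR_gt1// ltr1n.
have r1' : 0 < 1 - (2 : R) `^ (- e) by rewrite subr_gt0.
exists ((lam 0) `^ (- e) / (1 - 2 `^ (- e))); first by rewrite divr_ge0 ?powR_ge0// ltW.
suff H K : \sum_(n < K) lam n `^ (- e) =
    (lam 0 `^ (- e) - lam K `^ (- e)) / (1 - 2 `^ (- e)) :> R.
  by move=> K; rewrite H ler_pM2r ?invr_gt0// gerBl powR_ge0.
elim: K => [|K IH]; first by rewrite big_ord0 subrr mul0r.
by rewrite big_ord_recr/= IH lam_powS; field; rewrite gt_eqF.
Qed.

Variables (beta gamma : R) (phi : point -> R).
Hypothesis beta0 : 0 < beta.
Hypothesis gamma0 : 0 < gamma.
Hypothesis gamma2 : gamma <= 1 / 2.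
Hypothesis lp : littlewood_paley phi.
Local Notation dyadic := (dyadic phi).
Local Notation block := (block phi).
Local Notation fl := (frac_laplacian beta).

Definition heat_evolution (z : freq -> R[i]) (t : R) l : R[i] :=
  (expR (- t * fl l))%:C%C * z l.

(** With x = t lam^(2 beta) and y = x^gamma, the terms y / (1 + x) are dominated
    by the increments of the bounded increasing function y / (1 + y) along the
    geometric progression of the y, so that their sum telescopes. *)
Lemma heat_sum_le : exists2 C : R, 0 <= C & forall (t : R) K, 0 < t ->
  \sum_(n < K) lam n `^ (2 * beta * gamma) / (1 + t * lam n `^ (2 * beta)) <=
  C * t `^ (- gamma).
Proof.
pose Q : R := (2 `^ (2 * beta)) `^ gamma.
have Q1 : 1 < Q.
  by rewrite !powR_gt1 ?ltr1n// mulr_gt0.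
exists (4 * Q / (Q - 1)); first by rewrite divr_ge0//; lra.
move=> t K t0; pose x n : R := t * lam n `^ (2 * beta); pose y n := x n `^ gamma.
have lam0 n : 0 < lam n `^ (2 * beta) :> R by rewrite powR_gt0// lam_gt0.
have x0 n : 0 < x n by rewrite mulr_gt0.
have y0 n : 0 < y n by rewrite powR_gt0.
have yS n : y n.+1 = Q * y n.
  rewrite /y /x lam_powS mulrCA [LHS]powRM ?powR_ge0//.
  exact: (ltW (x0 n)).
have y2 n : y n ^+ 2 <= 1 + x n.
  rewrite -powR_mulrn ?(ltW (y0 n))// -powRrM; have [h|h] := leP (x n) 1.
    have := @ge0_ler_powR _ (gamma * 2%:R) _ (x n) 1; rewrite !nnegrE powR1.
    have g2 : 0 <= gamma * 2 by rewrite mulr_ge0// ltW.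
    move=> /(_ g2 (ltW (x0 n)) ler01 h) H; rewrite (le_trans H)//.
    by rewrite lerDl ltW.
  rewrite (@le_trans _ _ (x n))//; last by rewrite lerDr.
  by apply: ler1_powR; [exact: ltW|rewrite -ler_pdivlMr].
(* The increment of h is (Q - 1) y / ((1 + Q y) (1 + y)), at least
   (Q - 1) / Q times y / (1 + y)^2, and (1 + y)^2 <= 4 (1 + x) as
   y^2 <= 1 + x, which is where gamma <= 1/2 enters. *)
pose h n := y n / (1 + y n).
have step n : y n / (1 + x n) <= 4 * Q / (Q - 1) * (h n.+1 - h n).
  rewrite /h yS; have := y0 n; have := x0 n; have := y2 n; set u := y n; set v := x n.
  move=> h1 h2 h3; have Qu : 0 < Q * u by nra.
  have -> : 4 * Q / (Q - 1) * (Q * u / (1 + Q * u) - u / (1 + u)) =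
     u * (4 * Q / ((1 + Q * u) * (1 + u))).
    by field; rewrite !gt_eqF//; lra.
  rewrite ler_wpM2l// ?(ltW h3)// ler_pdivlMr ?mulr_gt0//; [|lra|lra].
  rewrite mulrC ler_pdivrMr; last lra.
  have : (1 + u) ^+ 2 <= 4 * (1 + v) by have := sqr_ge0 (u - 1); nra.
  have : (1 + Q * u) * (1 + u) <= Q * (1 + u) ^+ 2 by nra.
  nra.
have lamE n : lam n `^ (2 * beta * gamma) / (1 + t * lam n `^ (2 * beta)) =
   t `^ (- gamma) * (y n / (1 + x n)).
  rewrite /y /x powRM ?ltW// powRrM powRN; field.
  by rewrite !gt_eqF ?powR_gt0// addr_gt0// mulr_gt0.
under eq_bigr do rewrite lamE.
rewrite -big_distrr/= mulrC ler_wpM2r ?powR_ge0//.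
apply: (@le_trans _ _ (\sum_(n < K) 4 * Q / (Q - 1) * (h n.+1 - h n))).
  by apply: ler_sum => n _; exact: step.
rewrite -big_distrr/=.
have -> : \sum_(n < K) (h n.+1 - h n) = h K - h 0%N.
  by rewrite -(big_mkord xpredT (fun n => h n.+1 - h n)) telescope_sumr.
rewrite -[leRHS]mulr1 ler_wpM2l//; first by rewrite divr_ge0//; lra.
have : h K <= 1 by rewrite ler_pdivrMr ?mul1r ?lerDr// addr_gt0.
have : 0 <= h 0%N by rewrite divr_ge0// ?addr_ge0// ltW.
by move=> h0 hK; rewrite lerBlDr (le_trans hK)// lerDl.
Qed.

(** On the support of the n-th block the datum is the sum of its neighbouring
    blocks, which are bounded functions to which [heat_block_bounded]
    applies. *)
Lemma linear_block : exists2 C : R, 0 <= C & forall (z : freq -> R[i]) (B : R),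
  0 <= B -> csym z ->
  (forall m, {ae mu, forall x, `|block z m x| <= B * lam m `^ (2 * beta * gamma)}) ->
  forall t n x, 0 <= t -> `|block (heat_evolution z t) n x| <=
    C * B * (lam n `^ (2 * beta * gamma) / (1 + t * lam n `^ (2 * beta))).
Proof.
have [C C0 hC] := heat_block_bounded beta0 lp (fun n => symbol_cst n 1).
have bg0 : 0 <= 2 * beta * gamma by rewrite !mulr_ge0// ltW.
exists (3 * (C * 2 `^ (2 * beta * gamma))); first by rewrite !mulr_ge0 ?powR_ge0.
move=> z B B0 cz hz t n x t0.
pose U m := B * lam m `^ (2 * beta * gamma).
have U0 m : 0 <= U m by rewrite mulr_ge0 ?powR_ge0.
(* The bounds hold almost everywhere only; clamping makes them hold everywhere
   without changing the Fourier coefficients. *)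
pose u m (y : point) := clamp (U m) (block z m y).
have mb m : measurable_fun setT (block z m).
  by case: (bmeas_Re_fmul z (finsupp_dyadic lp m)).
have bu m : bmeas (u m) by exact: bmeas_clamp.
have fu m l : fourier_coef (dist_of_fun (u m)) l = (dyadic m l)%:C%C * z l.
  rewrite -(fourier_coef_fmul l (finsupp_dyadic lp m) (dyadicN lp m) cz).
  apply: fourier_coef_ae; [by case: (bu m)|exact: mb|].
  by apply: filterS (hz m) => y; exact: clamp_id.
pose a l := dyadic n l * (expR (- t * fl l) * 1).
have [K aK] := finsupp_dyadic lp n.
have aaK l : a l != 0 -> inbox K l.
  by move=> h; apply: aK; apply: contra_neq h => E; rewrite /a E mul0r.
have -> : block (heat_evolution z t) n x =
    \sum_(n.-1 <= m < n.+2) complex.Re (fmul a (fourier_coef (dist_of_fun (u m))) x).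
  under eq_bigr do rewrite (Re_fmul _ _ aaK).
  rewrite exchange_big /block (Re_fmul _ _ aK); apply: eq_bigr => l _.
  under eq_bigr => m _.
    rewrite fu ReMr ImMr (_ : a l * _ = dyadic m l * (a l *
      (complex.Re (z l) * cosl l x - complex.Im (z l) * sinl l x))); last by ring.
    over.
  rewrite -big_distrl/= /heat_evolution ReMr ImMr /a.
  have [->|nl] := eqVneq (dyadic n l) 0; first by rewrite !mul0r mulr0.
  by rewrite (dyadic_partition_near lp nl); ring.
set b := lam n `^ _ / _.
have near m : (n.-1 <= m < n.+2)%N ->
    `|complex.Re (fmul a (fourier_coef (dist_of_fun (u m))) x)| <=
    C * 2 `^ (2 * beta * gamma) * B * b.
  move=> /andP[_ mn].
  have [h _] := hC t n (u m) (U m) x t0 (bu m) (fun y => clamp_le _ (U0 m)).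
  rewrite (le_trans h)// /b /U.
  have lm : lam m `^ (2 * beta * gamma) <= 2 `^ (2 * beta * gamma) * lam n `^ (2 * beta * gamma) :> R.
    rewrite -lam_powS ge0_ler_powR ?nnegrE ?(ltW (lam_gt0 _))//.
    by apply: lam_mono; lia.
  rewrite -!mulrA ler_wpM2l// !mulrA ler_wpM2r//.
    by rewrite invr_ge0 addr_ge0// mulr_ge0 ?powR_ge0.
  by rewrite (le_trans (ler_wpM2l B0 lm))// mulrCA mulrA.
rewrite (le_trans (ler_norm_sum _ _ _))//.
apply: (@le_trans _ _ (\sum_(n.-1 <= m < n.+2) C * 2 `^ (2 * beta * gamma) * B * b)).
  by rewrite big_nat_cond [leRHS]big_nat_cond; apply: ler_sum => m /andP[/near].
have b0 : 0 <= b by rewrite divr_ge0 ?powR_ge0// addr_ge0// mulr_ge0 ?powR_ge0.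
rewrite sumr_const_nat; set c := C * _ * B * b.
have c0 : 0 <= c by rewrite /c mulr_ge0// mulr_ge0// mulr_ge0// powR_ge0.
rewrite -[leLHS]mulr_natl (_ : _ * b = 3 * c); last by rewrite /c; ring.
by apply: ler_wpM2r => //; rewrite ler_nat; lia.
Qed.

End linear_evolution.

(** * Test functions and integration by parts *)

Section test_functions.
Context {R : realType} {d : nat}.
Local Notation point := 'rV[R]_d.
Local Notation freq := 'rV[int]_d.
Local Notation mu := (torus_measure R d).

Lemma Linfty_norm_le (g : point -> R) (r : R) :
  (Linfty_norm g <= r%:E)%E <-> {ae mu, forall x, `|g x| <= r}.
Proof.
have m1 : (0 < mu setT)%E.
  by have -> : mu setT = 1%E by exact: probability_setT.
rewrite /Linfty_norm unlock m1; split.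
  by move=> /ess_sup_inf.ess_supP; apply: filterS => x; rewrite /= lee_fin.
by move=> h; apply/ess_sup_inf.ess_supP; apply: filterS h => x; rewrite /= lee_fin.
Qed.

Lemma dotp_delta_line i (l : freq) (x : point) h :
  dotp l (h *: delta_mx 0 i + x) = h * (l 0 i)%:~R + dotp l x.
Proof.
rewrite dotpDr; congr (_ + _); rewrite /dotp (bigD1 i)//= big1 ?addr0.
  by rewrite !mxE !eqxx mulr1 mulrC.
by move=> j ji; rewrite !mxE (negbTE ji) andbF mulr0 mulr0.
Qed.

Definition trig a b (l : freq) (x : point) : R := a * cosl l x + b * sinl l x.

Lemma is_derive_trig a b l i (x : point) : is_derive x (delta_mx 0 i) (trig a b l)
  (trig (b * (2 * pi * (l 0 i)%:~R)) (- (a * (2 * pi * (l 0 i)%:~R))) l x).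
Proof.
set c : R := 2 * pi * (l 0 i)%:~R.
have dphase : is_derive x (delta_mx 0 i) (fun y : point => 2 * pi * dotp l y) c.
  apply/is_derive_line.
  apply: (@is_derive_ext _ _ _ (fun h : R => c * h + 2 * pi * dotp l x)).
    by move=> h; rewrite dotp_delta_line /c; ring.
  have := is_deriveD (is_deriveZ c (is_derive_id (0 : R) (1 : R)))
    (is_derive_cst (2 * pi * dotp l x) (0 : R) 1).
  by rewrite addr0 /GRing.scale/= mulr1.
have dc := @is_derive_comp_line R _ cos (fun y : point => 2 * pi * dotp l y) x _ _ _
  (is_derive_cos (2 * pi * dotp l x)) dphase.
have ds := @is_derive_comp_line R _ sin (fun y : point => 2 * pi * dotp l y) x _ _ _
  (is_derive_sin (2 * pi * dotp l x)) dphase.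
have := is_deriveD (is_deriveZ a dc) (is_deriveZ b ds).
rewrite (_ : _ + _ = trig (b * c) (- (a * c)) l x); last first.
  by rewrite /trig /cosl /sinl /GRing.scale/=; ring.
by [].
Qed.

Lemma partial_trig a b l i : partial i (trig a b l) =
  trig (b * (2 * pi * (l 0 i)%:~R)) (- (a * (2 * pi * (l 0 i)%:~R))) l.
Proof. by apply/funext => x; apply: derive_val; exact: is_derive_trig. Qed.

Lemma continuous_dotp (l : freq) : continuous (@dotp R d l).
Proof.
rewrite (_ : dotp l = \sum_(k < d) (fun y : point => (l 0 k)%:~R * y 0 k)); last first.
  by apply/funext => y; rewrite fct_sumE.
move=> x; apply: (big_ind (fun f : point -> R => {for x, continuous f})).
- exact: cst_continuous.
- by move=> f g; exact: continuousD.
- by move=> k _; apply: continuousM; [exact: cst_continuous|exact: coord_continuous].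
Qed.

Lemma continuous_trig a b l : continuous (trig a b l).
Proof.
have cp : continuous (fun x : point => 2 * pi * dotp l x).
  move=> x; apply: (@continuous_comp _ _ _ (dotp l) ( *%R (2 * pi))).
    exact: continuous_dotp.
  exact: mulrl_continuous.
have cc : continuous (cosl l : point -> R).
  by move=> x; apply: (continuous_comp (cp x)); exact: continuous_cos.
have cs : continuous (sinl l : point -> R).
  by move=> x; apply: (continuous_comp (cp x)); exact: continuous_sin.
have ca : continuous (fun y : point => a * cosl l y).
  by move=> x; apply: (@continuous_comp _ _ _ (cosl l) ( *%R a)); [exact: cc|exact: mulrl_continuous].
have cb : continuous (fun y : point => b * sinl l y).
  by move=> x; apply: (@continuous_comp _ _ _ (sinl l) ( *%R b)); [exact: cs|exact: mulrl_continuous].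
by move=> x; exact: (continuousD (ca x) (cb x)).
Qed.

Lemma test_fun_trig a b l : test_fun (trig a b l).
Proof.
split; last by move=> x m; rewrite /trig cosl_periodic sinl_periodic.
move=> s; have [a' [b' ->]] : exists a' b', partials s (trig a b l) = trig a' b' l.
  elim: s => [|i s [a' [b' IH]]]; first by exists a, b.
  by rewrite /= IH partial_trig; eexists; eexists.
split; first exact: continuous_trig.
by move=> i x; have [] := is_derive_trig a' b' l i x.
Qed.

Lemma partials_rcons s i (f : point -> R) : partials (rcons s i) f = partials s (partial i f).
Proof. by rewrite /partials foldr_rcons. Qed.

Lemma test_fun_partial i f : test_fun f -> test_fun (@partial R d i f).
Proof.
move=> [sf pf]; split.
  by move=> s; rewrite -partials_rcons; exact: sf.
move=> x l; rewrite /partial /derive.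
rewrite (_ : (fun h => h^-1 *: ((f \o shift (x + real_freq l)) (h *: 'e_i) - f (x + real_freq l))) =
  (fun h => h^-1 *: ((f \o shift x) (h *: 'e_i) - f x)))//.
by apply/funext => h /=; rewrite addrA !pf.
Qed.

Lemma continuous_test_fun f : @test_fun R d f -> continuous f.
Proof. by move=> [/(_ [::]) [] ]. Qed.

Lemma is_derive_test_fun f i x : @test_fun R d f ->
  is_derive x (delta_mx 0 i) f (partial i f x).
Proof. by move=> [/(_ [::]) [_ df] _]; apply: derivableP; exact: df. Qed.

(** Translation by integer parts brings every point into the compact unit
    cube. *)
Lemma periodic_continuous_bounded (f : point -> R) : continuous f -> zd_periodic f ->
  exists B : R, forall x : point, `|f x| <= B.
Proof.
move=> cf pf; pose Q : set point := [set x | forall i, 0 <= x 0 i <= 1].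
have cQ : compact Q.
  apply: bounded_closed_compact.
    exists 1; split; first exact: num_real.
    move=> M M1 x Qx; rewrite /= /Num.norm/= mx_normrE; apply: bigmax_le.
      by rewrite (le_trans _ (ltW M1)).
    move=> [i j] _ /=; rewrite ord1; have /andP[h1 h2] := Qx j.
    by rewrite ger0_norm// (le_trans h2)// ltW.
  rewrite (_ : Q = \bigcap_(i : 'I_d) ((fun x : point => x 0 i) @^-1` `[0, 1])).
    apply: closed_bigI => i _; apply: closed_comp => [x _|]; last exact: itv_closed.
    exact: coord_continuous.
  apply/seteqP; split => x /= h i; first by move=> _ /=; rewrite in_itv/=; exact: h.
  by have := h i I; rewrite /= in_itv.
have : compact ((fun x => `|f x|) @` Q).
  apply: continuous_compact cQ.
  apply: continuous_subspaceT => x; apply: continuous_comp; first exact: cf.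
  exact: norm_continuous.
move=> /compact_bounded [M [_ hM]].
exists (`|M| + 1) => x.
have MM : M < `|M| + 1 by rewrite ltr_pwDr// ler_norm.
pose l : freq := \row_i (- Num.floor (x 0 i)).
have Qx : Q (x + real_freq l).
  move=> i; rewrite !mxE rmorphN/=.
  have := Num.Theory.floor_itv (x 0 i).
  rewrite intrD => /andP[h1 h2]; apply/andP; split; lra.
have := hM _ MM `|f (x + real_freq l)| (ex_intro2 _ _ _ Qx erefl).
by rewrite /= normr_id pf.
Qed.

Lemma bmeas_test_fun f : @test_fun R d f -> bmeas f.
Proof.
move=> tf; have cf := continuous_test_fun tf.
split; first exact: continuous_measurable_row cf.
by case: tf => _; exact: periodic_continuous_bounded cf.
Qed.

Lemma test_fun_line i (x : point) f : @test_fun R d f ->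
  f (1 *: delta_mx 0 i + x) = f x.
Proof.
move=> [_ pf]; have -> : 1 *: delta_mx 0 i + x = x + real_freq (delta_mx 0 i).
  by apply/rowP => j; rewrite !mxE mul1r addrC; case: (_ && _).
exact: pf.
Qed.

(** The product is periodic, so that the integral of its derivative vanishes. *)
Lemma Rintegral_trig_partial a b l i f : @test_fun R d f ->
  \int[mu]_x (trig a b l x * partial i f x) =
  - \int[mu]_x (partial i (trig a b l) x * f x).
Proof.
move=> tf; have tt := test_fun_trig a b l.
have tpf := test_fun_partial i tf; have tpt := test_fun_partial i tt.
have b1 : bmeas (fun x => trig a b l x * partial i f x) by apply: bmeasM; exact: bmeas_test_fun.
have b2 : bmeas (fun x => partial i (trig a b l) x * f x) by apply: bmeasM; exact: bmeas_test_fun.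
apply/eqP; rewrite -addr_eq0 -RintegralD_bmeas//; apply/eqP.
have [m12 [B hB]] := bmeasD b1 b2.
apply: (@Rintegral_partial0 R d i (fun x => trig a b l x * f x) _ B m12 hB).
- move=> x; have d1 := is_derive_test_fun i x tt; have d2 := is_derive_test_fun i x tf.
  have := is_deriveM d1 d2; rewrite (_ : _ + _ = trig a b l x * partial i f x + partial i (trig a b l) x * f x)//.
  by rewrite /GRing.scale/= [f x * _]mulrC.
- move=> x; have cline : continuous (fun h : R => h *: delta_mx 0 i + x : point).
    move=> h; apply: cvgD; last exact: cvg_cst.
    by apply: cvgZr_tmp; exact: cvg_id.
  have cl g : test_fun g -> continuous (fun h : R => g (h *: delta_mx 0 i + x)).
    by move=> tg h; apply: continuous_comp; [exact: cline|exact: continuous_test_fun].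
  move=> h; apply: cvgD; apply: cvgM; exact: cl.
- by move=> x; rewrite (test_fun_line i x tt) (test_fun_line i x tf).
Qed.

End test_functions.

(** * Distributions, Besov norms and divergence *)

Section besov_data.
Context {R : realType} {d : nat}.
Local Notation point := 'rV[R]_d.
Local Notation freq := 'rV[int]_d.
Local Notation mu := (torus_measure R d).
Local Notation normc := ComplexField.Normc.normc.
Implicit Types u : @functional R d.

Lemma periodic_distributionZ u a f : periodic_distribution u -> test_fun f ->
  u (fun x => a * f x) = a * u f.
Proof.
move=> [lin _] tf; have t0 : test_fun (fun _ : point => 0 : R).
  rewrite (_ : (fun _ => _) = trig 0 0 0); first exact: test_fun_trig.
  by apply/funext => x; rewrite /trig !mul0r addr0.
have u0 : u (fun _ => 0) = 0.
  have := lin (-1) f f tf tf; rewrite (mulN1r (u f)) addNr => E.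
  by apply: etrans E; congr (u _); apply/funext => x; rewrite mulN1r addNr.
have := lin a f _ tf t0; rewrite u0 addr0 => <-.
by congr u; apply/funext => x; rewrite addr0.
Qed.

Lemma cosl_trig l : cosl l = @trig R d 1 0 l.
Proof. by apply/funext => x; rewrite /trig mul1r mul0r addr0. Qed.

Lemma sinl_trig l : sinl l = @trig R d 0 1 l.
Proof. by apply/funext => x; rewrite /trig mul1r mul0r add0r. Qed.

Lemma test_fun_cosl (l : freq) : @test_fun R d (cosl l).
Proof. by rewrite cosl_trig; exact: test_fun_trig. Qed.

Lemma test_fun_sinl (l : freq) : @test_fun R d (sinl l).
Proof. by rewrite sinl_trig; exact: test_fun_trig. Qed.

(** Distributions are real: they take real values on real test functions. *)
Lemma csym_distribution u : periodic_distribution u -> csym (fourier_coef u).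
Proof.
move=> pu l; split.
  by rewrite /=; congr u; apply/funext => x; exact: coslNl.
rewrite [LHS]/= [complex.Im (fourier_coef u l)]/=; congr (- _).
rewrite -[RHS]mulN1r -(periodic_distributionZ (-1) pu (test_fun_sinl l)).
by congr u; apply/funext => x; rewrite mulN1r; exact: sinlNl.
Qed.

(** The condition l . z(l) = 0 that the divergence imposes on coefficients. *)
Definition solenoidal (z : 'I_d -> freq -> R[i]) := forall l : freq,
  \sum_(i < d) (l 0 i)%:~R * complex.Re (z i l) = 0 /\
  \sum_(i < d) (l 0 i)%:~R * complex.Im (z i l) = 0.

Lemma solenoidal_distribution (v0 : 'I_d -> @functional R d) :
  (forall i, periodic_distribution (v0 i)) -> divergence_free v0 ->
  solenoidal (fun i => fourier_coef (v0 i)).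
Proof.
move=> pv dv l; have p2 : 2 * pi != 0 :> R by rewrite mulf_neq0// gt_eqF// pi_gt0.
have dc i : partial i (cosl l) = (fun x : point => - (2 * pi * (l 0 i)%:~R) * sinl l x).
  rewrite cosl_trig partial_trig; apply/funext => x; rewrite /trig; ring.
have ds i : partial i (sinl l) = (fun x : point => 2 * pi * (l 0 i)%:~R * cosl l x).
  rewrite sinl_trig partial_trig; apply/funext => x; rewrite /trig; ring.
have h1 := dv _ (test_fun_cosl l); have h2 := dv _ (test_fun_sinl l).
split; apply: (mulfI p2); rewrite mulr0.
  rewrite -[RHS]h2 big_distrr/=; apply: eq_bigr => i _.
  by rewrite ds periodic_distributionZ ?mulrA//; exact: test_fun_cosl.
rewrite -[RHS]h1 big_distrr/=; apply: eq_bigr => i _.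
rewrite dc periodic_distributionZ//; last exact: test_fun_sinl.
by rewrite mulrN mulrN mulNr mulrA.
Qed.

Variable phi : point -> R.
Hypothesis lp : littlewood_paley phi.

Lemma dyadic_block_fmul u n x :
  dyadic_block phi (n%:Z - 1) u x = fmul (dyadic phi n) (fourier_coef u) x.
Proof. by apply: eq_fsbigr => l _; rewrite dyadicE. Qed.

Lemma powR_dyadic (n : nat) (s : R) : 2 `^ ((n%:Z - 1)%:~R * s) = lam n `^ s :> R.
Proof.
rewrite powRrM powR_intmul//; congr (_ `^ _).
by apply: invr_inj; rewrite invr_expz exprz_dyadic.
Qed.

Lemma besov_blocks u (s : R) : (besov_norm phi (- s) u < +oo)%E ->
  exists2 B : R, 0 <= B & forall m, {ae mu, forall x,
    `|block phi (fourier_coef u) m x| <= B * lam m `^ s}.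
Proof.
move=> hu; have [B B0 hB] : exists2 B : R, 0 <= B & (besov_norm phi (- s) u <= B%:E)%E.
  case: (besov_norm phi (- s) u) hu => [r| |] //= _.
    by exists `|r|; rewrite // lee_fin ler_norm.
  by exists 0 => //; exact: leNye.
exists B => // m.
have L0 : 0 < lam m `^ s :> R by rewrite powR_gt0// lam_gt0.
have : (Linfty_norm (fun x => normc (dyadic_block phi (m%:Z - 1) u x)) <= (B * lam m `^ s)%:E)%E.
  have /ereal_supP /(_ _ (ex_intro2 _ _ (m%:Z - 1) I erefl)) := hB.
  by rewrite powR_dyadic powRN lee_pdivrMl// -EFinM mulrC.
move=> /Linfty_norm_le; apply: filterS => x.
rewrite dyadic_block_fmul ger0_norm ?normc_ge0//; exact: le_trans (normc_Re _).
Qed.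

(** The imaginary part is a sum of an odd function of the frequency. *)
Lemma Im_fmul0 a z x : finsupp a -> (forall l : freq, a (- l) = a l) -> csym z ->
  complex.Im (fmul a z x) = 0 :> R.
Proof.
move=> [K aK] ae cz; rewrite (Im_fmul _ _ aK).
pose g l := a l * (complex.Re (z l) * sinl l x + complex.Im (z l) * cosl l x).
have gN l : g (- l) = - g l.
  by have [h1 h2] := cz l; rewrite /g ae h1 h2 sinlNl coslNl; ring.
have gK l : g l != 0 -> inbox K l.
  by move=> h; apply: aK; apply: contra_neq h; rewrite /g => ->; rewrite mul0r.
rewrite -[LHS](fsum_box gK).
set s := LHS; suff : s = - s by lra.
rewrite {1}/s (reindex_fsbigT (fun l : freq => - l)) /=; last first.
  by exists (fun l => - l) => l; rewrite opprK.
rewrite /s (fsum_box gK) -sumrN (fsum_box (K := K)).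
  by apply: eq_bigr => l _.
by move=> l; rewrite -/(g (- l)) gN oppr_eq0; exact: gK.
Qed.

(** The blocks of index less than - 1 vanish, so that bounds on the blocks of
    [dyadic] are enough. *)
Lemma besov_norm_le u (s B : R) : 0 <= B -> csym (fourier_coef u) ->
  (forall n x, `|block phi (fourier_coef u) n x| <= B * lam n `^ s) ->
  (besov_norm phi (- s) u <= B%:E)%E.
Proof.
move=> B0 cu hB; apply/ereal_supP => _ [j _ <-].
have [j1|j1] := ltP j (- 1).
  rewrite (_ : (fun x => _) = (fun=> 0)); last first.
    apply/funext => x; rewrite /dyadic_block fsbig1 ?ComplexField.Normc.normc0// => l _.
    by rewrite (dyadic_coarse lp l j1) !mul0r.
  apply: (@le_trans _ _ ((2 `^ (j%:~R * - s))%:E * 0%:E)%E).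
    apply: lee_wpmul2l; first by rewrite lee_fin powR_ge0.
    by apply/Linfty_norm_le; apply: nearW => x; rewrite normr0.
  by rewrite mule0 lee_fin.
have [n ->] : exists n : nat, j = n%:Z - 1 by exists (absz (j + 1)); lia.
have L0 : 0 < lam n `^ s :> R by rewrite powR_gt0// lam_gt0.
rewrite powR_dyadic powRN lee_pdivrMl// -EFinM.
apply/Linfty_norm_le; apply: nearW => x; rewrite dyadic_block_fmul.
rewrite ger0_norm ?normc_ge0// mulrC.
have := hB n x; rewrite /block.
have := Im_fmul0 x (finsupp_dyadic lp n) (dyadicN lp n) cu.
by case: (fmul _ _ _) => p q /= -> ; rewrite expr0n addr0 sqrtr_sqr.
Qed.

Lemma periodic_distribution_of_fun (g : point -> R) : bmeas g ->
  periodic_distribution (dist_of_fun g).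
Proof.
move=> bg; split.
  move=> a f h tf th; rewrite /dist_of_fun.
  have bf := bmeas_test_fun tf; have bh := bmeas_test_fun th.
  rewrite -RintegralZ_bmeas; last exact: bmeasM.
  rewrite -RintegralD_bmeas; [|apply: bmeasZ|]; [|exact: bmeasM..].
  by apply: eq_Rintegral => x _; ring.
have [_ [B hB]] := bg.
exists 0%N, B => f M tf hf; have bf := bmeas_test_fun tf.
apply: le_Rintegral_bounded; first by case: (bmeasM bg bf).
by move=> x; rewrite normrM ler_pM//; exact: (hf [::] x).
Qed.

(** In the partial sums the derivative moves from the test function to the
    characters, where the sum over the components vanishes frequency by
    frequency. *)
Lemma divergence_free_rec (z : 'I_d -> freq -> R[i]) (b : 'I_d -> nat -> R) (S : 'I_d -> R) :
  (forall i, block_bound phi (z i) (b i) (S i)) -> solenoidal z ->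
  divergence_free (fun i => dist_of_fun (rec phi (z i))).
Proof.
move=> hz sz f tf.
have bf i : bmeas (partial i f) by exact/bmeas_test_fun/test_fun_partial.
have c : \sum_(i < d) \int[mu]_x (partial_rec phi (z i) K x * partial i f x) @[K --> \oo] -->
    \sum_(i < d) \int[mu]_x (rec phi (z i) x * partial i f x).
  apply: (cvg_big (op := +%R)); first by move=> p; exact: add_continuous.
  by move=> i _; exact: cvg_Rintegral_rec (hz i) (bf i).
apply: cvg_unique c _ => //; apply: cvg_near_cst; apply: nearW => K.
have ct a b' l : bmeas (trig a b' l : point -> R) by exact/bmeas_test_fun/test_fun_trig.
have m0 i : \int[mu]_x partial i f x = 0.
  have := Rintegral_trig_partial 1 0 0 i tf.
  rewrite partial_trig (_ : trig 1 0 0 = fun=> 1); last first.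
    by apply/funext => x; rewrite /trig /cosl dotp0l mulr0 cos0 mul0r mul1r addr0.
  under eq_Rintegral do rewrite mul1r.
  move=> ->; rewrite (_ : (fun x => _) = fun=> 0) ?Rintegral_prob_cst ?oppr0//.
  by apply/funext => x; rewrite mxE mulr0z !mulr0 oppr0 /trig !mul0r addr0 mul0r.
have E i n : \int[mu]_x (block phi (z i) n x * partial i f x) =
    \sum_(l <- box (projT1 (cid (finsupp_dyadic lp n)))) dyadic phi n l * (2 * pi) *
      ((l 0 i)%:~R * complex.Re (z i l) * (\int[mu]_x (sinl l x * f x)) +
       (l 0 i)%:~R * complex.Im (z i l) * (\int[mu]_x (cosl l x * f x))).
  case: (cid _) => N aN /=; rewrite /block.
  have bt l : bmeas (fun x => trig (complex.Re (z i l)) (- complex.Im (z i l)) l x * partial i f x).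
    exact: bmeasM.
  transitivity (\int[mu]_x (\sum_(l <- box N) dyadic phi n l *
      (trig (complex.Re (z i l)) (- complex.Im (z i l)) l x * partial i f x))).
    apply: eq_Rintegral => x _; rewrite (Re_fmul _ _ aN) big_distrl/=.
    by apply: eq_bigr => l _; rewrite /trig; ring.
  rewrite Rintegral_sum_bmeas; last by move=> l; exact: bmeasZ.
  apply: eq_bigr => l _; rewrite RintegralZ_bmeas// -mulrA; congr (_ * _).
  rewrite Rintegral_trig_partial// partial_trig.
  have bff := bmeas_test_fun tf.
  have bs : bmeas (fun x => sinl l x * f x) by apply: bmeasM => //; exact: bmeas_sinl.
  have bc : bmeas (fun x => cosl l x * f x) by apply: bmeasM => //; exact: bmeas_cosl.
  rewrite -!RintegralZ_bmeas// -RintegralD_bmeas; [|exact: bmeasZ..].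
  rewrite -RintegralZ_bmeas; last by apply: bmeasD; exact: bmeasZ.
  rewrite -RintegralN_bmeas; last by apply: bmeasM.
  by apply: eq_Rintegral => x _; rewrite /trig; ring.
under eq_bigr => i _.
  rewrite (Rintegral_partial_rec lp _ _ (bf i)) m0 mulr0 add0r.
  under eq_bigr do rewrite E.
  over.
rewrite exchange_big big1// => n _; rewrite exchange_big big1// => l _.
rewrite -big_distrr big_split/= -!big_distrl/=.
by have [-> ->] := sz l; rewrite !mul0r addr0 mulr0.
Qed.

End besov_data.

(** * Geometric convergence *)

Section geometric_convergence.
Context {R : realType}.

Lemma eq0_geometric (x M : R) : (forall k : nat, `|x| <= M * (1 / 2) ^+ k) -> x = 0.
Proof.
move=> h; apply/eqP; rewrite -normr_le0.
have c : M * (1 / 2) ^+ k @[k --> \oo] --> (0 : R).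
  rewrite -(mulr0 M); apply: cvgM; first exact: cvg_cst.
  by apply: cvg_expr; rewrite ger0_norm; lra.
rewrite -(cvg_lim _ c)//; apply: limr_ge; first by apply/cvg_ex; exists 0.
exact: nearW.
Qed.

Lemma geometric_limit (u : nat -> R) (M : R) :
  (forall k, `|u k.+1 - u k| <= M * (1 / 2) ^+ k) ->
  cvgn u /\ forall k, `|limn u - u k| <= 2 * M * (1 / 2) ^+ k.
Proof.
move=> h; have M0 : 0 <= M by have := h 0%N; rewrite expr0 mulr1; exact: le_trans.
have dist k m : `|u (k + m)%N - u k| <= 2 * M * (1 / 2) ^+ k * (1 - (1 / 2) ^+ m).
  elim: m => [|m IH]; first by rewrite addn0 subrr normr0 expr0 subrr mulr0.
  have := h (k + m)%N; rewrite addnS exprD exprS => h1.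
  have := ler_normD (u (k + m).+1 - u (k + m)%N) (u (k + m)%N - u k).
  rewrite addrA subrK; lra.
have cu : cvgn u.
  rewrite (_ : u = (fun n => u 0%N + series (fun k => u k.+1 - u k) n)); last first.
    by apply/funext => n; rewrite /series/= telescope_sumr// addrC subrK.
  apply: (@is_cvgD _ R^o); first exact: is_cvg_cst.
  apply: normed_cvg; apply: nondecreasing_is_cvgn.
    by apply: nondecreasing_series => n _ _ /=.
  exists (2 * M) => _ [K _ <-] /=; rewrite /series/=.
  suff : \sum_(0 <= k < K) `|u k.+1 - u k| <= 2 * M * (1 - (1 / 2) ^+ K).
    have : 0 <= (1 / 2 : R) ^+ K by rewrite exprn_ge0// divr_ge0.
    nra.
  elim: K => [|K IH]; first by rewrite big_nil expr0 subrr mulr0.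
  rewrite big_nat_recr//= exprS; have := h K; lra.
split=> // k.
have ck : u (k + m)%N - u k @[m --> \oo] --> limn u - u k.
  apply: cvgB; last exact: cvg_cst.
  rewrite (_ : (fun m => u (k + m)%N) = (fun m => u (m + k)%N)).
    by rewrite cvg_shiftn.
  by apply/funext => m; rewrite addnC.
apply: (cvg_norm_le ck) => m; rewrite (le_trans (dist k m))//.
have p0 n : 0 <= (1 / 2 : R) ^+ n by rewrite exprn_ge0// divr_ge0.
by rewrite ler_piMr ?mulr_ge0// gerBl.
Qed.

End geometric_convergence.

(** * The map of the mild equation *)

Section fixed_point.
Context {R : realType} {d : nat}.
Local Notation point := 'rV[R]_d.
Local Notation freq := 'rV[int]_d.
Local Notation mu := (torus_measure R d).
Local Notation field := (R -> point -> point).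
Local Notation forcing := ('I_d -> 'I_d -> point -> R).
Variables (beta gamma a delta : R) (phi : point -> R).
Hypothesis beta0 : 0 < beta.
Hypothesis gamma0 : 0 < gamma.
Hypothesis beta_a : 1 < 2 * beta * a.
Hypothesis gamma_a : gamma <= a.
Hypothesis delta01 : 0 < delta <= 1.
Hypothesis subcritical : a + delta + gamma < 1.
Hypothesis lp : littlewood_paley phi.
Local Notation block_bound := (block_bound phi).
Local Notation rec := (rec phi).
Local Notation sigma := (2 * gamma).

Lemma sigma01 : 0 <= sigma < 1.
Proof.
have := gamma0; have := gamma_a; have := subcritical; have /andP[] := delta01.
by move=> *; apply/andP; split; lra.
Qed.

Lemma powR_sigma (s : R) : s `^ (- gamma) * s `^ (- gamma) = s `^ (- sigma).
Proof.
rewrite -powRD; first by congr (_ `^ _); ring.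
by rewrite -opprD oppr_eq0 gt_eqF// addr_gt0.
Qed.

(** C controls the Duhamel term in the norm sup t^gamma |.|.  The extra power delta
    of t - s that the hypothesis grants to F is the room left by subcriticality,
    from which all the smallness comes. *)
Definition duhamel_constant (C : R) := 0 <= C /\
  forall F t i (A : R), admissible sigma F -> 0 < t <= 1 -> 0 <= A ->
  (forall s j k y, 0 < s < t -> (t - s) `^ (- a) * `|F s j k y| <=
     A * ((t - s) `^ (- (a + delta)) * s `^ (- sigma))) ->
  exists b, block_bound (duhamel_coef beta F t ^~ i) b (C * A * t `^ (- gamma)).

(** As 2 beta a > 1 the blocks sum geometrically, and the power of t left by the
    Beta integral is at least - gamma. *)
Lemma ex_duhamel_constant : exists C, duhamel_constant C.
Proof.
have /andP[dl0 dl1] := delta01.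
have [C C0 hC] := duhamel_block beta0 lp sigma01.
have e0 : 0 < 2 * beta * a - 1 by rewrite subr_gt0.
have [G G0 hG] := geometric_lam_sum e0.
have b0 : 0 <= betaC (a + delta) sigma by apply: betaC_ge0; [have := subcritical; have := gamma0; lra|case/andP: sigma01].
exists (C * G * betaC (a + delta) sigma); split; first by rewrite !mulr_ge0.
move=> F t i A aF /andP[t0 t1] A0 hF.
exists (fun n => C * lam n `^ (1 - 2 * beta * a) * A *
     (betaC (a + delta) sigma * t `^ (1 - (a + delta) - sigma))); split.
  move=> n x; have := gamma0; have := gamma_a; have := subcritical => h1 h2 h3.
  by apply: hC => //; apply/andP; split; lra.
move=> K; have -> : 1 - 2 * beta * a = - (2 * beta * a - 1) by ring.
rewrite -big_distrl/= -big_distrl/= -big_distrr/=.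
have tt : t `^ (1 - (a + delta) - sigma) <= t `^ (- gamma).
  by apply: ger_powR; [rewrite t0|have := subcritical; lra].
set p := t `^ _ in tt *; set q := t `^ _ in tt *; have p0 : 0 <= p by exact: powR_ge0.
have Bq : betaC (a + delta) sigma * p <= betaC (a + delta) sigma * q by exact: ler_wpM2l.
rewrite (_ : C * G * _ * A * q = C * G * A * (betaC (a + delta) sigma * q)); last by ring.
apply: ler_pM => //; [|exact: mulr_ge0|].
  by rewrite !mulr_ge0//; apply: sumr_ge0 => n _; exact: powR_ge0.
by rewrite ler_wpM2r// ler_wpM2l// hG.
Qed.

Variables (z : 'I_d -> freq -> R[i]) (B : R).
Hypothesis B0 : 0 <= B.
Hypothesis cz : forall i, csym (z i).
Hypothesis hz : forall i m, {ae mu, forall x,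
  `|block phi (z i) m x| <= B * lam m `^ (2 * beta * gamma)}.

Definition heat_constant (C : R) := 0 <= C /\
  forall t i, 0 < t -> exists b, block_bound (heat_evolution beta (z i) t) b (C * t `^ (- gamma)).

Lemma ex_heat_constant : exists C, heat_constant C.
Proof.
have g2 : gamma <= 1 / 2 by case/andP: sigma01; lra.
have [C C0 hC] := linear_block beta0 gamma0 g2 lp.
have [C' C'0 hC'] := heat_sum_le beta0 gamma0 g2.
exists (C * B * C'); split; first by rewrite !mulr_ge0.
move=> t i t0; exists (fun n => C * B * (lam n `^ (2 * beta * gamma) / (1 + t * lam n `^ (2 * beta)))).
split; first by move=> n x; apply: hC => //; exact: ltW.
by move=> K; rewrite -big_distrr/= -[leRHS]mulrA ler_wpM2l ?mulr_ge0//; exact: hC'.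
Qed.

Variables (C1 C2 Z T : R).
Hypothesis hC1 : heat_constant C1.
Hypothesis hC2 : duhamel_constant C2.
Hypothesis hZ : forall i, `|complex.Re (z i 0)| <= Z.
Hypothesis T01 : 0 < T <= 1.

Definition quad (v : field) (s : R) : forcing := fun j k y => v s y 0 j * v s y 0 k.

(** The Fourier coefficients of the right-hand side of the mild equation. *)
Definition mild_coef (v : field) t i l : R[i] :=
  heat_evolution beta (z i) t l - duhamel_coef beta (quad v) t l i.

(** Outside ]0, T] the value is 0, so that fields are measurable on the whole time
    axis. *)
Definition mild_map (v : field) : field := fun t x =>
  if (0 < t) && (t <= T) then \row_i rec (mild_coef v t i) x else 0.

(** The ball of the fixed-point argument.  The bound holds everywhere, not only
    almost everywhere, so that the iterates converge at every point. *)
Record tempered_field (K : R) (v : field) : Prop := {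
  tempered_measurable : forall i, measurable_fun setT
    (fun p : measurableTypeR R * point => v p.1 p.2 0 i : R);
  tempered_bound : forall s y i, `|v s y 0 i| <= K * s `^ (- gamma);
  tempered_support : forall s y, ~~ (0 < s <= T) -> v s y = 0 }.

Lemma tempered_le K K' v : K <= K' -> tempered_field K v -> tempered_field K' v.
Proof.
move=> KK [m b s]; split=> // t y i.
by rewrite (le_trans (b t y i))// ler_wpM2r// powR_ge0.
Qed.

Lemma tempered_bmeas K v t i : tempered_field K v -> bmeas (fun y : point => v t y 0 i).
Proof.
move=> [m b _]; split; last by exists (K * t `^ (- gamma)) => y.
exact: (measurable_fun_pair2 t (m i)).
Qed.

Lemma quad_le K v s j k y : tempered_field K v ->
  `|quad v s j k y| <= K * K * s `^ (- sigma).
Proof.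
move=> [_ b _]; rewrite /quad normrM -powR_sigma mulrACA.
by apply: ler_pM.
Qed.

Lemma quad_admissible K v : tempered_field K v -> admissible sigma (quad v).
Proof.
move=> tv; split.
  by move=> j k; apply: measurable_funM; exact: (tempered_measurable tv).
exists (K * K); first by rewrite -expr2 sqr_ge0.
by move=> s j k y; exact: quad_le.
Qed.

Lemma one_le_powRN (t : R) : 0 < t <= T -> 1 <= t `^ (- gamma).
Proof.
move=> /andP[t0 tT]; have /andP[_ T1] := T01.
rewrite -(powRr0 t); apply: ger_powR; last by rewrite oppr_le0 ltW.
by rewrite t0 (le_trans tT).
Qed.

Lemma heat_evolution0 i t : heat_evolution beta (z i) t 0 = z i 0.
Proof. by rewrite /heat_evolution fl0// mulr0 expR0 mul1r. Qed.

Lemma csym_heat i t : csym (heat_evolution beta (z i) t).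
Proof.
move=> l; have [h1 h2] := cz i l; rewrite /heat_evolution flN; split.
  by apply: etrans (ReMr _ _) (etrans _ (esym (ReMr _ _))); rewrite h1.
apply: etrans (ImMr _ _) (etrans _ (congr1 -%R (esym (ImMr _ _)))).
by rewrite h2 mulrN.
Qed.

Lemma csym_mild_coef K v t i : tempered_field K v -> 0 < t -> csym (mild_coef v t i).
Proof.
move=> tv t0; have aF := quad_admissible tv.
exact: csym_sub (csym_heat i t) (csym_duhamel_coef beta sigma01 i aF t0).
Qed.

Lemma block_bound_sub z1 z2 b1 b2 S1 S2 : block_bound z1 b1 S1 -> block_bound z2 b2 S2 ->
  block_bound (fun l => z1 l - z2 l) (fun n => b1 n + b2 n) (S1 + S2).
Proof.
move=> [h1 s1] [h2 s2]; split; last first.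
  by move=> K; rewrite big_split/=; apply: lerD; [exact: s1|exact: s2].
move=> n x; rewrite (block_sub lp) (le_trans (ler_normB _ _))//.
by apply: lerD; [exact: h1|exact: h2].
Qed.

(** The factor gained by restricting to short times. *)
Lemma heat_weight_le (s t : R) : 0 < s < t -> t <= T ->
  (t - s) `^ (- a) <= T `^ delta * (t - s) `^ (- (a + delta)).
Proof.
move=> /andP[s0 st] tT; have ts : 0 < t - s by rewrite subr_gt0.
have -> : (t - s) `^ (- a) = (t - s) `^ delta * (t - s) `^ (- (a + delta)).
  rewrite -powRD ?(gt_eqF ts) ?implybT//; congr (_ `^ _); ring.
rewrite ler_wpM2r ?powR_ge0//; apply: ge0_ler_powR; rewrite ?nnegrE.
- by case/andP: delta01 => /ltW.
- exact: ltW.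
- by case/andP: T01 => /ltW.
- lra.
Qed.

Lemma mild_coef_bound K v t i : tempered_field K v -> 0 < t <= T ->
  exists b, block_bound (mild_coef v t i) b
    ((C1 + C2 * (T `^ delta * (K * K))) * t `^ (- gamma)).
Proof.
move=> tv tT; have /andP[t0 t1] := tT.
have [_ /(_ t i t0)[b1 hb1]] := hC1.
have [] := hC2 => C20 /(_ (quad v) t i (T `^ delta * (K * K)) (quad_admissible tv)) [|||b2 hb2].
- by rewrite t0; case/andP: T01 => _; exact: le_trans.
- by rewrite mulr_ge0 ?powR_ge0// -expr2 sqr_ge0.
- move=> s j k y st; have h1 := heat_weight_le st t1; have h2 := quad_le s j k y tv.
  by rewrite mulrACA; apply: ler_pM => //; exact: powR_ge0.
exists (fun n => b1 n + b2 n); rewrite mulrDl; exact: block_bound_sub.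
Qed.

Lemma mild_mapE v t x i : 0 < t <= T -> mild_map v t x 0 i = rec (mild_coef v t i) x.
Proof. by move=> tT; rewrite /mild_map tT mxE. Qed.

Lemma measurable_heat_time (l : freq) : measurable_fun setT
  (fun t : measurableTypeR R => expR (- t * frac_laplacian beta l) : R).
Proof.
by apply: measurableT_comp => //; apply: measurable_funM => //.
Qed.

Lemma measurable_mild_coef K v i l : tempered_field K v ->
  measurable_fun setT (fun t : measurableTypeR R => complex.Re (mild_coef v t i l)) /\
  measurable_fun setT (fun t : measurableTypeR R => complex.Im (mild_coef v t i l)).
Proof.
move=> tv; have [m1 m2] := measurable_duhamel_coef beta sigma01 l i (quad_admissible tv).
have mh := measurable_heat_time l.
split.
  rewrite (_ : (fun t => _) = (fun t => expR (- t * frac_laplacian beta l) * complex.Re (z i l)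
     - complex.Re (duhamel_coef beta (quad v) t l i))).
    by apply: measurable_funB => //; exact: measurable_funM.
  by apply/funext => t; exact: etrans (ReB _ _) (congr1 (fun y => y - _) (ReMr _ _)).
rewrite (_ : (fun t => _) = (fun t => expR (- t * frac_laplacian beta l) * complex.Im (z i l)
   - complex.Im (duhamel_coef beta (quad v) t l i))).
  by apply: measurable_funB => //; exact: measurable_funM.
by apply/funext => t; exact: etrans (ImB _ _) (congr1 (fun y => y - _) (ImMr _ _)).
Qed.

(** Joint measurability, from the partial sums of the blocks, which are finite sums
    of products of a function of t and a function of x. *)
Lemma measurable_mild_map K v i : tempered_field K v ->
  measurable_fun setT (fun p : measurableTypeR R * point => mild_map v p.1 p.2 0 i : R).
Proof.
move=> tv; pose inside (p : measurableTypeR R * point) := (0 < p.1) && (p.1 <= T).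
have mt : measurable_fun setT (fun p : measurableTypeR R * point => p.1 : R).
  exact: measurable_fst.
have mi : measurable_fun setT inside.
  by apply: measurable_and; [exact: measurable_fun_ltr|exact: measurable_fun_ler].
pose u n (p : measurableTypeR R * point) : R :=
  if inside p then partial_rec phi (mild_coef v p.1 i) n p.2 else 0.
apply: (@measurable_fun_cvg _ _ R setT u) => //; last first.
  move=> [t x] _; rewrite /u /inside /=; have [tT|/negbTE tT] := boolP (0 < t <= T).
    have [b hb] := mild_coef_bound i tv tT.
    by rewrite mild_mapE//; exact: cvg_rec hb.
  by rewrite /mild_map tT mxE; exact: cvg_cst.
move=> n; apply: measurable_fun_ifT => //.
apply: measurable_funD.
  have [m _] := measurable_mild_coef i 0 tv.
  exact: (measurableT_comp m measurable_fst).
apply: measurable_sum => k; have [N aN] := finsupp_dyadic lp k.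
rewrite /block; under eq_fun do rewrite (Re_fmul _ _ aN).
apply: measurable_sum => l; have [m1 m2] := measurable_mild_coef i l tv.
apply: measurable_funM => //; apply: measurable_funB; apply: measurable_funM.
- exact: (measurableT_comp m1 measurable_fst).
- exact: (measurableT_comp (measurable_cosl l) measurable_snd).
- exact: (measurableT_comp m2 measurable_fst).
- exact: (measurableT_comp (measurable_sinl l) measurable_snd).
Qed.

Lemma mild_coef0 v t i : mild_coef v t i 0 = z i 0.
Proof. by rewrite /mild_coef heat_evolution0 duhamel_coef0 subr0. Qed.

(** The zero frequency contributes Z, the linear term C1 and the Duhamel term the
    rest. *)
Lemma tempered_mild_map K K' v : tempered_field K v ->
  Z + C1 + C2 * (T `^ delta * (K * K)) <= K' -> tempered_field K' (mild_map v).
Proof.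
move=> tv hK; have [C20 _] := hC2; have [C10 _] := hC1; split.
- by move=> i; exact: measurable_mild_map tv.
- have Z0 (i : 'I_d) : 0 <= Z by rewrite (le_trans _ (hZ i)).
  have K0 (i : 'I_d) : 0 <= K'.
    have KK : 0 <= K * K by rewrite -expr2 sqr_ge0.
    apply: le_trans hK; apply: addr_ge0; first by rewrite addr_ge0 ?(Z0 i).
    by rewrite mulr_ge0// mulr_ge0 ?powR_ge0.
  move=> s y i; have [sT|/negbTE sT] := boolP (0 < s <= T); last first.
    by rewrite /mild_map sT mxE normr0 mulr_ge0 ?powR_ge0 ?(K0 i).
  rewrite mild_mapE//; have [b hb] := mild_coef_bound i tv sT.
  rewrite (le_trans (rec_le y hb))// mild_coef0.
  have s1 := one_le_powRN sT; have := hZ i; have := Z0 i.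
  set S := s `^ _ in s1 *; set c := C2 * _ in hK *; move=> h1 h2.
  apply: (@le_trans _ _ ((Z + C1 + c) * S)); last by rewrite ler_wpM2r// (le_trans ler01).
  rewrite -addrA [leRHS]mulrDl lerD2r (le_trans h2)//.
  by rewrite -[leLHS]mulr1 ler_wpM2l.
- by move=> s y /negbTE sT; rewrite /mild_map sT.
Qed.

Lemma admissible_sub F G : admissible sigma F -> admissible sigma G ->
  admissible sigma (fun s j k (y : point) => F s j k y - G s j k y).
Proof.
move=> [mF [A A0 hA]] [mG [A' A'0 hA']]; split.
  by move=> j k; apply: measurable_funB.
exists (A + A'); first exact: addr_ge0.
by move=> s j k y; rewrite mulrDl (le_trans (ler_normB _ _))// lerD.
Qed.

(** The difference of the two images is a Duhamel term with forcing
    w (x) w - v (x) v.  The norm is weighted in time by a function E, and the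
    small constant rho may come from a short time or from a fast weight. *)
Lemma mild_map_contract K v w (E : R -> R) (rho D : R) : 0 <= rho -> 0 <= D ->
  0 <= K -> (forall t, 0 <= E t) ->
  (forall s t, 0 < s < t -> t <= T ->
    (t - s) `^ (- a) * E s <= rho * E t * (t - s) `^ (- (a + delta))) ->
  tempered_field K v -> tempered_field K w ->
  (forall s y i, 0 < s <= T -> `|v s y 0 i - w s y 0 i| <= D * E s * s `^ (- gamma)) ->
  forall t x i, 0 < t <= T -> `|mild_map v t x 0 i - mild_map w t x 0 i| <=
    C2 * (2 * K * rho) * D * E t * t `^ (- gamma).
Proof.
move=> rho0 D0 K0 E0 hE tv tw hvw t x i tT; have /andP[t0 t1] := tT.
have -> : mild_map v t x 0 i - mild_map w t x 0 i =
    rec (mild_coef v t i) x - rec (mild_coef w t i) x.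
  exact: (congr2 (fun p q => p - q) (mild_mapE v x i tT) (mild_mapE w x i tT)).
have [b1 hb1] := mild_coef_bound i tv tT; have [b2 hb2] := mild_coef_bound i tw tT.
have av := quad_admissible tv; have aw := quad_admissible tw.
pose G s j k y := quad w s j k y - quad v s j k y.
have aG : admissible sigma G by exact: admissible_sub.
have coefE l : mild_coef v t i l - mild_coef w t i l = duhamel_coef beta G t l i.
  have cancel (h p q : R[i]) : (h - p) - (h - q) = q - p by ring.
  exact: etrans (cancel _ _ _) (esym (duhamel_coef_sub _ sigma01 _ _ aw av t0)).
have [C20 hC] := hC2.
have [|||b hb] := hC G t i (2 * K * rho * D * E t) aG.
- by rewrite t0; case/andP: T01 => _; exact: le_trans.
- by rewrite !mulr_ge0.
- move=> s j k y st; have /andP[s0 s1] := st.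
  have sT : 0 < s <= T by rewrite s0 (le_trans (ltW s1)).
  have GE : `|G s j k y| <= 2 * K * D * E s * s `^ (- sigma).
    rewrite /G /quad (_ : _ - _ = - (v s y 0 j * (v s y 0 k - w s y 0 k) +
       (v s y 0 j - w s y 0 j) * w s y 0 k)); last by ring.
    rewrite normrN (le_trans (ler_normD _ _))// !normrM -powR_sigma.
    have h1 := tempered_bound tv s y j; have h2 := tempered_bound tw s y k.
    have h3 := hvw s y j sT; have h4 := hvw s y k sT.
    have := ler_pM (normr_ge0 _) (normr_ge0 _) h1 h4.
    have := ler_pM (normr_ge0 _) (normr_ge0 _) h3 h2.
    set p := s `^ _; lra.
  rewrite (le_trans (ler_wpM2l (powR_ge0 _ _) GE))//.
  have c0 : 0 <= 2 * K * D * s `^ (- sigma) by rewrite !mulr_ge0 ?powR_ge0.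
  rewrite [leLHS](_ : _ = 2 * K * D * s `^ (- sigma) * ((t - s) `^ (- a) * E s)); last by ring.
  apply: le_trans (ler_wpM2l c0 (hE s t st t1)) _.
  by rewrite le_eqVlt; apply/orP; left; apply/eqP; ring.
have hb' : block_bound (fun l => mild_coef v t i l - mild_coef w t i l) b
    (C2 * (2 * K * rho * D * E t) * t `^ (- gamma)).
  by rewrite (_ : (fun l => _) = duhamel_coef beta G t ^~ i)//; apply/funext.
apply: le_trans (rec_sub_le lp x hb1 hb2 hb') _.
rewrite !mild_coef0 subrr normr0 add0r.
by rewrite le_eqVlt; apply/orP; left; apply/eqP; ring.
Qed.

(** The weight exp(lambda t) with lambda large makes the map a contraction,
    whatever the size of the two fields, over the whole interval. *)
Lemma mild_map_unique K v w : 0 <= K -> tempered_field K v -> tempered_field K w ->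
  (forall t x, 0 < t <= T -> mild_map v t x = v t x) ->
  (forall t x, 0 < t <= T -> mild_map w t x = w t x) ->
  forall t x, 0 < t <= T -> v t x = w t x.
Proof.
move=> K0 tv tw fv fw t x tT; have [C20 _] := hC2; have /andP[dl0 dl1] := delta01.
pose q := C2 * (2 * K); have q0 : 0 <= q by rewrite !mulr_ge0.
(* This lambda makes the contraction factor q lambda^(- delta) at most 1/2. *)
pose lambda : R := (1 + 2 * q) `^ (delta^-1).
have q1 : 0 < 1 + 2 * q by lra.
have l0 : 0 < lambda by exact: powR_gt0.
have lq : lambda `^ (- delta) = (1 + 2 * q)^-1.
  by rewrite /lambda -powRrM mulrN mulVf ?gt_eqF// powR_inv1// ltW.
pose E (t : R) := expR (lambda * t).
have wE s t' : 0 < s < t' -> t' <= T -> (t' - s) `^ (- a) * E s <=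
    (1 + 2 * q)^-1 * E t' * (t' - s) `^ (- (a + delta)).
  move=> /andP[s0 st] _; have ts : 0 < t' - s by rewrite subr_gt0.
  have -> : (t' - s) `^ (- a) = (t' - s) `^ delta * (t' - s) `^ (- (a + delta)).
    rewrite -powRD ?(gt_eqF ts) ?implybT//; congr (_ `^ _); ring.
  rewrite mulrAC ler_wpM2r ?powR_ge0// -lq powRN.
  have -> : E t' = E s * expR (lambda * (t' - s)) by rewrite -expRD; congr expR; ring.
  rewrite ler_pdivlMl ?powR_gt0// mulrA [leRHS]mulrC ler_wpM2r ?expR_ge0//.
  rewrite -powRM ?(ltW l0) ?(ltW ts)//.
  (* y^delta <= 1 + y <= exp y. *)
  set y := lambda * _; have y0 : 0 < y by exact: mulr_gt0.
  apply: (@le_trans _ _ (1 + y)); last exact: expR_ge1Dx.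
  have [y1|y1] := leP y 1.
    have := @ge0_ler_powR _ delta (ltW dl0) y 1; rewrite !nnegrE powR1 => /(_ (ltW y0) ler01 y1).
    lra.
  by have := ler1_powR (ltW y1) dl1; lra.
have E1 s : 0 < s -> 1 <= E s by move=> s0; rewrite -expR0 ler_expR mulr_ge0// ltW.
have iter k : forall s y i, 0 < s <= T ->
    `|v s y 0 i - w s y 0 i| <= 2 * K * (1 / 2) ^+ k * E s * s `^ (- gamma).
  elim: k => [|k IH] s y i sT; have /andP[s0 _] := sT.
    rewrite expr0 mulr1 (le_trans (ler_normB _ _))//.
    have := tempered_bound tv s y i; have := tempered_bound tw s y i.
    have := E1 s s0; have : 0 <= K * s `^ (- gamma) by rewrite mulr_ge0 ?powR_ge0.
    set p := s `^ _; set e := E s; nra.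
  have D0 : 0 <= 2 * K * (1 / 2) ^+ k by rewrite !mulr_ge0// exprn_ge0// divr_ge0.
  have r0 : 0 <= (1 + 2 * q)^-1 by rewrite invr_ge0 ltW.
  have := mild_map_contract r0 D0 K0 (fun t => expR_ge0 _) wE tv tw IH y i sT.
  rewrite fv// fw// => /le_trans; apply.
  rewrite ler_wpM2r ?powR_ge0// ler_wpM2r ?expR_ge0//.
  rewrite exprS (_ : C2 * _ = q / (1 + 2 * q)); last by rewrite /q; ring.
  by rewrite [leRHS]mulrCA ler_wpM2r// ler_pdivrMr//; lra.
apply/rowP => i; apply/eqP; rewrite -subr_eq0; apply/eqP.
apply: (@eq0_geometric _ _ (2 * K * E t * t `^ (- gamma))) => k.
rewrite (le_trans (iter k t x i tT))//.
by rewrite le_eqVlt; apply/orP; left; apply/eqP; ring.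
Qed.

(** Hence a fixed point satisfies the mild equation, frequency by frequency. *)
Lemma fourier_coef_mild_map K v t : tempered_field K v -> 0 < t <= T ->
  forall i l, fourier_coef (dist_of_fun (fun x : point => mild_map v t x 0 i)) l = mild_coef v t i l.
Proof.
move=> tv tT i l; have [b hb] := mild_coef_bound i tv tT.
rewrite (_ : (fun x => _) = rec (mild_coef v t i)); last first.
  by apply/funext => x; exact: mild_mapE.
apply: (fourier_coef_rec lp l _ hb); apply: csym_mild_coef tv _.
by case/andP: tT.
Qed.

(** * Fixed points and solutions *)

Hypothesis sz : solenoidal z.

(** The range of the Leray projection is orthogonal to the frequency. *)
Lemma leray_solenoidal (l : freq) j : \sum_(i < d) (l 0 i)%:~R * leray l i j = 0 :> R.
Proof.
rewrite /leray; under eq_bigr do rewrite mulrBr.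
rewrite sumrB (bigD1 j)//= eqxx mulr1 big1 ?addr0; last first.
  by move=> i /negbTE ->; rewrite mulr0.
have [->|l0] := eqVneq l 0.
  by rewrite mxE mulr0z sub0r big1 ?oppr0// => i _; rewrite mxE mulr0z mul0r.
have q1 := sqnorm_real_freq (R := R) l0.
have -> : \sum_(i < d) (l 0 i)%:~R * ((l 0 i)%:~R * (l 0 j)%:~R / euclid (real_freq l) ^+ 2) =
   sqnorm (real_freq l) * ((l 0 j)%:~R / sqnorm (real_freq l)) :> R.
  rewrite euclid_sqnorm {2}/sqnorm big_distrl/=; apply: eq_bigr => i _.
  by rewrite mxE; ring.
by rewrite mulrCA mulfV ?mulr1 ?subrr// gt_eqF// (lt_le_trans ltr01).
Qed.

Lemma leray_div_solenoidal (F : forcing) : solenoidal (fun i (l : freq) => leray_div F l i).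
Proof.
move=> l; have H (X : 'I_d -> 'I_d -> R) : \sum_(i < d) (l 0 i)%:~R *
    (\sum_(j < d) \sum_(k < d) leray l i j * (2 * pi * (l 0 k)%:~R) * X j k) = 0.
  under eq_bigr do rewrite big_distrr/=.
  rewrite exchange_big big1// => j _; under eq_bigr do rewrite big_distrr/=.
  rewrite exchange_big big1// => k _.
  transitivity ((\sum_(i < d) (l 0 i)%:~R * leray l i j) * (2 * pi * (l 0 k)%:~R * X j k)).
    by rewrite big_distrl/=; apply: eq_bigr => i _; ring.
  by rewrite leray_solenoidal mul0r.
split; [under eq_bigr do rewrite Re_leray_div|under eq_bigr do rewrite Im_leray_div]; exact: H.
Qed.

Lemma duhamel_coef_solenoidal F t : admissible sigma F -> 0 < t ->
  solenoidal (fun i (l : freq) => duhamel_coef beta F t l i).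
Proof.
move=> aF t0 l; have [h1 h2] : 
    (forall i, (@lebesgue_measure R).-integrable `]0, t[ (fun s => (complex.Re (duhamel_term beta F t l i s))%:E)) /\
    (forall i, (@lebesgue_measure R).-integrable `]0, t[ (fun s => (complex.Im (duhamel_term beta F t l i s))%:E)).
  by split=> i; have [] := duhamel_term_integrable beta sigma01 l i aF t0.
split.
  transitivity (\sum_(i < d) \int[@lebesgue_measure R]_(s in `]0, t[)
      ((l 0 i)%:~R * complex.Re (duhamel_term beta F t l i s))).
    by apply: eq_bigr => i _; rewrite RintegralZl//; exact: h1.
  rewrite -Rintegral_sumR//; last by move=> i; apply: integrableZR => //; exact: h1.
  transitivity (\int[@lebesgue_measure R]_(s in `]0%R, t[) (0 : R)); last by rewrite Rintegral_cst ?mul0r.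
  apply: eq_Rintegral => s _; have [h _] := leray_div_solenoidal (F s) l.
  rewrite -[RHS](mulr0 (expR (- (t - s) * frac_laplacian beta l))) -[X in _ = _ * X]h big_distrr/=.
  by apply: eq_bigr => i _; rewrite /duhamel_term ReMr mulrCA.
transitivity (\sum_(i < d) \int[@lebesgue_measure R]_(s in `]0, t[)
    ((l 0 i)%:~R * complex.Im (duhamel_term beta F t l i s))).
  by apply: eq_bigr => i _; rewrite RintegralZl//; exact: h2.
rewrite -Rintegral_sumR//; last by move=> i; apply: integrableZR => //; exact: h2.
transitivity (\int[@lebesgue_measure R]_(s in `]0%R, t[) (0 : R)); last by rewrite Rintegral_cst ?mul0r.
apply: eq_Rintegral => s _; have [_ h] := leray_div_solenoidal (F s) l.
rewrite -[RHS](mulr0 (expR (- (t - s) * frac_laplacian beta l))) -[X in _ = _ * X]h big_distrr/=.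
by apply: eq_bigr => i _; rewrite /duhamel_term ImMr mulrCA.
Qed.

Lemma solenoidal_sub (z1 z2 : 'I_d -> freq -> R[i]) : solenoidal z1 -> solenoidal z2 ->
  solenoidal (fun i l => z1 i l - z2 i l).
Proof.
move=> s1 s2 l; have [h1 h2] := s1 l; have [h3 h4] := s2 l.
split; [under eq_bigr do rewrite ReB mulrBr|under eq_bigr do rewrite ImB mulrBr];
  by rewrite sumrB ?h1 ?h2 ?h3 ?h4 subrr.
Qed.

Lemma heat_solenoidal t : solenoidal (fun i => heat_evolution beta (z i) t).
Proof.
move=> l; have [h1 h2] := sz l; set e := expR (- t * frac_laplacian beta l).
split.
  rewrite -[RHS](mulr0 e) -[X in _ = _ * X]h1 big_distrr/=.
  by apply: eq_bigr => i _; rewrite /heat_evolution ReMr mulrCA.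
rewrite -[RHS](mulr0 e) -[X in _ = _ * X]h2 big_distrr/=.
by apply: eq_bigr => i _; rewrite /heat_evolution ImMr mulrCA.
Qed.

Lemma mild_coef_solenoidal K v t : tempered_field K v -> 0 < t -> solenoidal (mild_coef v t).
Proof.
move=> tv t0; exact: solenoidal_sub (heat_solenoidal t) (duhamel_coef_solenoidal (quad_admissible tv) t0).
Qed.

Lemma divergence_free_map K v t : tempered_field K v -> 0 < t <= T ->
  divergence_free (field_dist (mild_map v t)).
Proof.
move=> tv tT; have /andP[t0 _] := tT.
have /(@choice _ _) [b hb] : forall i, exists b, block_bound (mild_coef v t i) b
    ((C1 + C2 * (T `^ delta * (K * K))) * t `^ (- gamma)).
  by move=> i; exact: mild_coef_bound tv tT.
have := divergence_free_rec lp hb (mild_coef_solenoidal tv t0).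
congr divergence_free; apply/funext => i; rewrite /field_dist; congr dist_of_fun.
by apply/funext => x; rewrite mild_mapE.
Qed.

(** Asking for less decay in time, a - gamma instead of a, leaves blocks of
    size lam^(2 beta gamma) for the Duhamel term, the growth that the Besov norm
    allows. *)
Lemma besov_bound K : 0 <= K -> exists2 M : R, 0 <= M & forall v t i n x,
  tempered_field K v -> 0 < t <= T ->
  `|block phi (mild_coef v t i) n x| <= M * lam n `^ (2 * beta * gamma).
Proof.
move=> K0; have /andP[dl0 dl1] := delta01.
have g2 : gamma <= 1 / 2 by case/andP: sigma01 => _ h; lra.
have [CL CL0 hCL] := linear_block beta0 gamma0 g2 lp.
have [CD CD0 hCD] := duhamel_block beta0 lp sigma01.
pose e := 2 * beta * a - 1; have e0 : 0 < e by rewrite subr_gt0.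
pose b := betaC (a - gamma) sigma.
have sub := subcritical; have ga := gamma_a; have g0 := gamma0.
have b0 : 0 <= b by apply: betaC_ge0; [lra|case/andP: sigma01].
exists (CL * B + CD * lam 0 `^ (- e) * (K * K) * b).
  by rewrite addr_ge0 ?mulr_ge0// powR_ge0.
move=> v t i n x tv tT; have /andP[t0 tT'] := tT.
have t1 : t <= 1 by case/andP: T01 => _; exact: le_trans.
have L0 : 0 < lam n :> R by exact: lam_gt0.
rewrite (block_sub lp) (le_trans (ler_normB _ _))// mulrDl; apply: lerD.
  rewrite (le_trans (hCL _ _ B0 (cz i) (hz i) _ _ _ (ltW t0)))//.
  rewrite ler_wpM2l ?mulr_ge0// ler_piMr ?powR_ge0// invf_le1 ?lerDl ?mulr_ge0 ?powR_ge0 ?(ltW t0)//.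
  by rewrite ltr_pwDl// mulr_ge0 ?powR_ge0// ltW.
have th1 : 0 <= a - gamma <= 1 by apply/andP; split; lra.
have th2 : 0 <= a - gamma < 1 by apply/andP; split; lra.
have KK : 0 <= K * K by exact: mulr_ge0.
have hF s j k y : 0 < s < t -> (t - s) `^ (- (a - gamma)) * `|quad v s j k y| <=
    K * K * ((t - s) `^ (- (a - gamma)) * s `^ (- sigma)).
  by move=> _; rewrite [leRHS]mulrCA ler_wpM2l ?powR_ge0//; exact: quad_le.
apply: le_trans (hCD _ _ i n x _ _ _ (quad_admissible tv) t0 th1 th2 KK hF) _.
have p1 : t `^ (1 - (a - gamma) - sigma) <= 1.
  by rewrite -[leRHS](powRr0 t); apply: ger_powR; [rewrite t0|lra].
have lamE : lam n `^ (1 - 2 * beta * (a - gamma)) = lam n `^ (- e) * lam n `^ (2 * beta * gamma) :> R.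
  by rewrite -powRD ?(gt_eqF L0) ?implybT//; congr (_ `^ _); rewrite /e; ring.
have lam0 : lam n `^ (- e) <= lam 0 `^ (- e) :> R.
  rewrite !powRN lef_pV2 ?posrE ?powR_gt0 ?lam_gt0//.
  by apply: ge0_ler_powR; rewrite ?nnegrE ?(ltW (lam_gt0 _)) ?(ltW e0)//; exact: lam_mono.
rewrite lamE (mulrA CD) -/b.
set P := lam n `^ (2 * beta * gamma); have P0 : 0 <= P by exact: powR_ge0.
set q := t `^ _ in p1 *; have q0 : 0 <= q by exact: powR_ge0.
set A := lam n `^ _ in lam0 *; have A0 : 0 <= A by exact: powR_ge0.
rewrite (_ : CD * A * P * (K * K) * (b * q) = CD * (K * K) * b * P * (A * q)); last by ring.
rewrite (_ : CD * _ * (K * K) * b * P = CD * (K * K) * b * P * lam 0 `^ (- e)); last by ring.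
by rewrite ler_wpM2l ?mulr_ge0// (le_trans _ lam0)// ler_piMr.
Qed.

Lemma euclid_le (x : point) (U : R) : (forall i, `|x 0 i| <= U) -> 0 <= U -> euclid x <= d%:R * U.
Proof.
move=> xU U0; rewrite -[leRHS]ger0_norm ?mulr_ge0// -sqrtr_sqr ler_wsqrtr//.
apply: (@le_trans _ _ (\sum_(i < d) U ^+ 2)).
  apply: ler_sum => i _; rewrite -[x 0 i ^+ 2]real_normK ?num_real//.
  by rewrite lerXn2r ?nnegrE.
rewrite sumr_const card_ord exprMn -[leLHS]mulr_natl ler_wpM2r ?sqr_ge0//.
by rewrite -natrX ler_nat; case: (d) => // m; rewrite expnS leq_pmulr// expn_gt0.
Qed.

Lemma coord_le_euclid (x : point) i : `|x 0 i| <= euclid x.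
Proof.
rewrite -sqrtr_sqr ler_wsqrtr// (bigD1 i)//= lerDl.
by apply: sumr_ge0 => j _; exact: sqr_ge0.
Qed.

(** Fixed points satisfy the mild equation because the map is defined by its
    Fourier coefficients; the other properties are those of sums of blocks. *)
Lemma fixed_point_solution K v (v0 : 'I_d -> @functional R d) alpha : 0 <= K ->
  (forall i, z i = fourier_coef (v0 i)) -> 2 * beta * gamma = beta + alpha ->
  tempered_field K v -> (forall t x, mild_map v t x = v t x) ->
  gns_solution phi beta alpha T v0 v.
Proof.
move=> K0 zE gE tv fv.
have fvE : mild_map v = v by apply/funext => t; apply/funext => x.
have sE : - beta - alpha = - (2 * beta * gamma) by rewrite gE opprD.
have gE' : (beta + alpha) / (2 * beta) = gamma by rewrite -gE; field; rewrite gt_eqF.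
have fc t i l : 0 < t <= T -> fourier_coef (field_dist (v t) i) l = mild_coef v t i l.
  by move=> tT; rewrite -(fourier_coef_mild_map tv tT) fvE.
split.
- apply: measurable_funTS; apply: measurable_row => i.
  exact: (tempered_measurable tv).
- move=> t tT x l; rewrite -fvE; apply/rowP => i; rewrite !mild_mapE//.
  exact: rec_periodic.
- by move=> t tT; rewrite -fvE; exact: divergence_free_map tv tT.
- move=> t tT l i; have /andP[t0 _] := tT; split.
    exact: (duhamel_term_integrable beta sigma01 l i (quad_admissible tv) t0).
  by rewrite fc// /mild_coef /heat_evolution zE.
- rewrite sE; have [M M0 hM] := besov_bound K0; exists M.
  apply: nearW => t tT i; have bv := tempered_bmeas t i tv; split.
    exact: periodic_distribution_of_fun.
  apply: besov_norm_le => //; first exact: csym_fourier_coef.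
  move=> n x; rewrite (_ : fourier_coef _ = mild_coef v t i); first exact: hM tv tT.
  by apply/funext => l; exact: fc.
- rewrite gE'; apply: (@le_lt_trans _ _ (d%:R * K)%:E); last exact: ltry.
  apply/ereal_supP => _ [t /= /andP[t0 tT] <-].
  have tg : 0 < t `^ gamma by exact: powR_gt0.
  rewrite -lee_pdivlMl// -EFinM; apply/Linfty_norm_le; apply: nearW => x.
  rewrite ger0_norm ?sqrtr_ge0// -powRN mulrCA [t `^ _ * K]mulrC.
  apply: euclid_le; last by rewrite mulr_ge0// powR_ge0.
  by move=> i; exact: (tempered_bound tv).
Qed.

(** A solution w is clamped to a tempered field c, equal to w almost everywhere at
    each time.  The image v of c has the coefficients of w, hence v = c almost
    everywhere; and the map only sees fields up to null sets, so that v is a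
    fixed point. *)
Lemma solution_fixed_point (v0 : 'I_d -> @functional R d) alpha w :
  (forall i, z i = fourier_coef (v0 i)) -> 2 * beta * gamma = beta + alpha ->
  gns_solution phi beta alpha T v0 w ->
  exists K v, [/\ 0 <= K, tempered_field K v,
    (forall t x, 0 < t <= T -> mild_map v t x = v t x) &
    forall t, 0 < t <= T -> {ae mu, forall x, w t x = v t x}].
Proof.
move=> zE gE [mw _ _ sw _ bw].
have gE' : (beta + alpha) / (2 * beta) = gamma by rewrite -gE; field; rewrite gt_eqF.
rewrite gE' in bw.
have [M M0 hM] : exists2 M : R, 0 <= M & (weighted_sup gamma T w <= M%:E)%E.
  case: (weighted_sup gamma T w) bw => [r| |] //= _.
    by exists `|r|; rewrite // lee_fin ler_norm.
  by exists 0 => //; exact: leNye.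
have aew t : 0 < t <= T -> {ae mu, forall x, forall i, `|w t x 0 i| <= M * t `^ (- gamma)}.
  move=> tT; have /andP[t0 _] := tT; have tg : 0 < t `^ gamma by exact: powR_gt0.
  have /ereal_supP /(_ _ (ex_intro2 _ _ t tT erefl)) := hM.
  rewrite -lee_pdivlMl// -EFinM => /Linfty_norm_le; apply: filterS => x hx i.
  rewrite powRN mulrC (le_trans _ hx)// [leRHS]ger0_norm ?sqrtr_ge0//.
  exact: coord_le_euclid.
have mD : measurable (`]0, T] `*` setT : set (measurableTypeR R * point)).
  by apply: measurableX => //; exact: measurable_itv.
have mwi i : measurable_fun (`]0, T] `*` setT : set (measurableTypeR R * point))
    (fun p : measurableTypeR R * point => w p.1 p.2 0 i : R).
  exact: (measurableT_comp (measurable_coord i) mw).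
have mwt t i : 0 < t <= T -> measurable_fun setT (fun x : point => w t x 0 i : R).
  move=> tT; apply: (@measurable_comp _ _ _ _ _ _ (`]0, T] `*` setT : set (measurableTypeR R * point))
    (fun p => w p.1 p.2 0 i) setT (pair t)) => //.
  by move=> _ [x _ <-] /=; split => //=; rewrite in_itv.
pose inside (p : measurableTypeR R * point) := (0 < p.1) && (p.1 <= T).
pose c t x : point := if (0 < t) && (t <= T)
  then \row_i clamp (M * t `^ (- gamma)) (w t x 0 i) else 0.
have cE t x i : 0 < t <= T -> c t x 0 i = clamp (M * t `^ (- gamma)) (w t x 0 i).
  by move=> tT; rewrite /c tT mxE.
have tc : tempered_field M c.
  split.
  - move=> i; have mt : measurable_fun setT (fun p : measurableTypeR R * point => p.1 : R).
      exact: measurable_fst.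
    have mi : measurable_fun setT inside.
      by apply: measurable_and; [exact: measurable_fun_ltr|exact: measurable_fun_ler].
    have mg : measurable_fun setT (fun p : measurableTypeR R * point => M * p.1 `^ (- gamma) : R).
      apply: measurable_funM => //.
      exact: (measurableT_comp (measurable_powR _) mt).
    rewrite (_ : (fun p => _) = (fun p : measurableTypeR R * point => if inside p then
        clamp (M * p.1 `^ (- gamma)) (w p.1 p.2 0 i) else 0)); last first.
      by apply/funext => p; rewrite /c /inside; case: ifP; rewrite mxE.
    apply: measurable_fun_if => //; rewrite setTI (_ : inside @^-1` [set true] = `]0, T] `*` setT).
      apply: measurable_maxr; first by apply: measurableT_comp => //; exact: measurable_funTS.
      by apply: measurable_minr => //; exact: measurable_funTS.
    by apply/seteqP; split => p /=; rewrite /inside /= in_itv/=; [split|case].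
  - move=> s y i; have [sT|/negbTE sT] := boolP (0 < s <= T).
      by rewrite cE//; apply: clamp_le; rewrite mulr_ge0// powR_ge0.
    by rewrite /c sT mxE normr0 mulr_ge0// powR_ge0.
  - by move=> s y /negbTE sT; rewrite /c sT.
have cw t : 0 < t <= T -> {ae mu, forall x, w t x = c t x}.
  move=> tT; apply: filterS (aew t tT) => x hx; apply/rowP => i.
  by rewrite cE// clamp_id.
have bc t i := tempered_bmeas t i tc.
have fcE t i l : 0 < t <= T -> fourier_coef (field_dist (c t) i) l = mild_coef c t i l.
  move=> tT; have /andP[t0 _] := tT.
  have -> : fourier_coef (field_dist (c t) i) l = fourier_coef (field_dist (w t) i) l.
    apply: fourier_coef_ae; [by case: (bc t i)|exact: mwt|].
    by apply: filterS (cw t tT) => x ->.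
  have [_ ->] := sw t tT l i.
  have E s : s \in `]0, t[%classic -> duhamel_integrand beta w t l i s = duhamel_term beta (quad c) t l i s.
    rewrite inE/= in_itv/= => /andP[s0 st]; have sT : 0 < s <= T.
      by rewrite s0 (le_trans (ltW st))//; case/andP: tT.
    congr (_ * _); apply: eq_bigr => j _; congr (_ * _); apply: eq_bigr => k _; congr (_ * _).
    apply: fourier_coef_ae.
    - by apply: measurable_funM; exact: mwt.
    - by apply: measurable_funM; [case: (bc s j)|case: (bc s k)].
    - by apply: filterS (cw s sT) => x ->.
  by rewrite (eq_cintegral E) -zE.
pose v := mild_map c.
have [K' [K'0 tv]] : exists K', 0 <= K' /\ tempered_field K' v.
  exists (Num.max 0 (Z + C1 + C2 * (T `^ delta * (M * M)))); split.
    by rewrite le_max lexx.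
  by apply: tempered_mild_map tc _; rewrite le_max lexx orbT.
have vc t : 0 < t <= T -> {ae mu, forall x, v t x = c t x}.
  move=> tT; have H i : {ae mu, forall x, v t x 0 i - c t x 0 i = 0}.
    have bv := tempered_bmeas t i tv.
    apply: fourier_injective; first exact: bmeasB.
    move=> l; have := fcE t i l tT; rewrite -(fourier_coef_mild_map tc tT) -/v => /eqP.
    rewrite eq_complex => /andP[/eqP h1 /eqP h2].
    have bcl := bmeas_cosl (R := R) l; have bsl := bmeas_sinl (R := R) l.
    split.
      under eq_Rintegral do rewrite mulrBl.
      rewrite RintegralB_bmeas; [|exact: bmeasM..].
      by apply/eqP; rewrite subr_eq0; apply/eqP/esym; exact: h1.
    under eq_Rintegral do rewrite mulrBl.
    rewrite RintegralB_bmeas; [|exact: bmeasM..].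
    by apply/eqP; rewrite subr_eq0; apply/eqP/esym; apply: oppr_inj; exact: h2.
  have : {ae mu, forall x, forall i, v t x 0 i - c t x 0 i = 0}.
    exact: filter_forall.
  by apply: filterS => x hx; apply/rowP => i; apply/eqP; rewrite -subr_eq0 hx.
exists K', v; split; [exact: K'0|exact: tv| |].
- move=> t x tT; rewrite {2}/v; apply/rowP => i.
  apply: etrans (mild_mapE v x i tT) (etrans _ (esym (mild_mapE c x i tT))).
  apply: (congr1 (fun y => rec y x)); apply/funext => l.
  apply: (congr1 (fun y => heat_evolution beta (z i) t l - y)).
  have E s : s \in `]0, t[%classic -> duhamel_term beta (quad v) t l i s = duhamel_term beta (quad c) t l i s.
    rewrite inE/= in_itv/= => /andP[s0 st]; have sT : 0 < s <= T.
      by rewrite s0 (le_trans (ltW st))//; case/andP: tT.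
    congr (_ * _); apply: eq_bigr => j _; congr (_ * _); apply: eq_bigr => k _; congr (_ * _).
    apply: fourier_coef_ae.
    - by apply: measurable_funM; [case: (tempered_bmeas s j tv)|case: (tempered_bmeas s k tv)].
    - by apply: measurable_funM; [case: (bc s j)|case: (bc s k)].
    - by apply: filterS (vc s sT) => y; rewrite /quad => ->.
  exact: eq_cintegral E.
- by move=> t tT; apply: filterS2 (cw t tT) (vc t tT) => x -> ->.
Qed.

(** * Picard iteration *)

Variable K : R.
Hypothesis K0 : 0 <= K.
Hypothesis invariant : Z + C1 + C2 * (T `^ delta * (K * K)) <= K.
Hypothesis contraction : C2 * (2 * K * T `^ delta) <= 1 / 2.

Fixpoint picard (k : nat) : field :=
  if k is k'.+1 then mild_map (picard k') else fun _ _ => 0.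

Lemma tempered_picard k : tempered_field K (picard k).
Proof.
elim: k => [|k IH] /=; last exact: tempered_mild_map IH invariant.
split=> //.
- by move=> s y i; rewrite mxE normr0 mulr_ge0 ?powR_ge0.
Qed.

(** The weight is constant here and the small factor is T^delta. *)
Lemma short_time_contract v w (D : R) : 0 <= D -> tempered_field K v -> tempered_field K w ->
  (forall s y i, `|v s y 0 i - w s y 0 i| <= D * s `^ (- gamma)) ->
  forall t x i, `|mild_map v t x 0 i - mild_map w t x 0 i| <= D / 2 * t `^ (- gamma).
Proof.
move=> D0 tv tw h t x i; have [tT|/negbTE tT] := boolP (0 < t <= T); last first.
  by rewrite /mild_map tT mxE subrr normr0 mulr_ge0 ?powR_ge0// divr_ge0.
have := @mild_map_contract K v w (fun=> 1) (T `^ delta) D (powR_ge0 _ _) D0 K0.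
move=> /(_ (fun=> ler01) _ tv tw _ t x i tT) H.
rewrite (le_trans (H _ _))//.
- by move=> s t' st tT'; rewrite !mulr1; exact: heat_weight_le.
- by move=> s y j _; rewrite mulr1; exact: h.
rewrite mulr1 ler_wpM2r ?powR_ge0// [leRHS]mulrC ler_wpM2r// -[2^-1]div1r.
exact: contraction.
Qed.

Lemma picard_step k t x i :
  `|picard k.+1 t x 0 i - picard k t x 0 i| <= K * t `^ (- gamma) * (1 / 2) ^+ k.
Proof.
rewrite mulrAC; elim: k t x i => [|k IH] t x i.
  by rewrite expr0 mulr1 /= mxE subr0; exact: (tempered_bound (tempered_picard 1)).
have D0 : 0 <= K * (1 / 2) ^+ k by rewrite mulr_ge0// exprn_ge0// divr_ge0.
have := short_time_contract D0 (tempered_picard k.+1) (tempered_picard k) IH t x i.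
by rewrite exprS (_ : K * _ / 2 = K * (1 / 2 * (1 / 2) ^+ k))//; field.
Qed.

Definition solution : field := fun t x => \row_i limn (fun k => picard k t x 0 i).

Lemma cvg_picard t x i : picard k t x 0 i @[k --> \oo] --> solution t x 0 i.
Proof. by rewrite mxE; have [] := geometric_limit (fun k => picard_step k t x i). Qed.

Lemma solution_picard k t x i :
  `|solution t x 0 i - picard k t x 0 i| <= 2 * K * (1 / 2) ^+ k * t `^ (- gamma).
Proof.
rewrite mxE; have [_ /(_ k)] := geometric_limit (fun k => picard_step k t x i).
by move/le_trans; apply; rewrite le_eqVlt; apply/orP; left; apply/eqP; ring.
Qed.

Lemma tempered_solution : tempered_field K solution.
Proof.
split.
- move=> i; apply: (@measurable_fun_cvg _ _ R setT
    (fun k (p : measurableTypeR R * point) => picard k p.1 p.2 0 i)) => //.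
    by move=> k; exact: (tempered_measurable (tempered_picard k)).
  by move=> p _; exact: cvg_picard.
- move=> s y i; apply: (cvg_norm_le (@cvg_picard s y i)) => k.
  exact: (tempered_bound (tempered_picard k)).
- move=> s y sT; apply/rowP => i; rewrite !mxE.
  rewrite (_ : (fun k => _) = (fun=> 0)) ?lim_cst//.
  by apply/funext => k; rewrite (tempered_support (tempered_picard k))// mxE.
Qed.

(** Both sides are at distance O(2^-k) from the (k + 1)-st iterate. *)
Lemma solution_fixed t x : mild_map solution t x = solution t x.
Proof.
apply/rowP => i; apply/eqP; rewrite -subr_eq0; apply/eqP.
apply: (@eq0_geometric _ _ (2 * K * t `^ (- gamma))) => k.
have D0 : 0 <= 2 * K * (1 / 2) ^+ k by rewrite !mulr_ge0// exprn_ge0// divr_ge0.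
have h1 := short_time_contract D0 tempered_solution (tempered_picard k)
  (solution_picard k) t x i.
have h2 := solution_picard k.+1 t x i.
have := ler_normB (mild_map solution t x 0 i - mild_map (picard k) t x 0 i)
  (solution t x 0 i - picard k.+1 t x 0 i).
rewrite [picard k.+1]/= opprB addrA subrK.
move/le_trans; apply; move: h2; rewrite exprS; lra.
Qed.

End fixed_point.

(** * Local well-posedness *)

Theorem theorem1p4 (R : realType) (d : nat) (beta alpha : R)
    (phi : 'rV[R]_d -> R) (v0 : 'I_d -> @functional R d) :
  (2 <= d)%N ->
  1 / 2 < beta ->
  - beta < alpha ->
  alpha < Num.min 0 (beta - 1) ->
  littlewood_paley phi ->
  (forall i, besov phi (- beta - alpha) (v0 i)) ->
  divergence_free v0 ->
  exists T : R, 0 < T /\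
    exists v : R -> 'rV[R]_d -> 'rV[R]_d,
      gns_solution phi beta alpha T v0 v /\
      forall w : R -> 'rV[R]_d -> 'rV[R]_d,
        gns_solution phi beta alpha T v0 w ->
        forall t : R, 0 < t <= T ->
          {ae torus_measure R d, forall x, w t x = v t x}.
Proof.
move=> _ beta_half alpha_lo alpha_hi lp bv0 dv0.
have beta0 : 0 < beta by lra.
have [al0 al1] : alpha < 0 /\ alpha < beta - 1 by move: alpha_hi; rewrite lt_min => /andP[].
pose gamma := (beta + alpha) / (2 * beta).
have gE : 2 * beta * gamma = beta + alpha by rewrite /gamma; field; rewrite gt_eqF.
have gamma0 : 0 < gamma by rewrite divr_gt0//; lra.
(* Any a with a > 1 / (2 beta), a >= gamma and a + gamma < 1 would do; taking
   a > 1/2 ensures the second condition since gamma < 1/2. *)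
pose m := Num.max (1 / (2 * beta)) (1 / 2).
have m1 : m + gamma < 1.
  have b2 : 0 < 2 * beta by lra.
  suff : m < 1 - gamma by lra.
  rewrite /m gt_max; apply/andP; split.
    by rewrite ltr_pdivrMr// mulrBl mul1r [gamma * _]mulrC gE; lra.
  suff : gamma < 1 / 2 by lra.
  by rewrite ltr_pdivrMr//; lra.
have [mb m2] : 1 / (2 * beta) <= m /\ 1 / 2 <= m by rewrite /m !le_max !lexx orbT.
pose delta := (1 - m - gamma) / 3; pose a := m + delta.
have delta0 : 0 < delta by rewrite /delta divr_gt0//; lra.
have delta01 : 0 < delta <= 1 by rewrite delta0 /delta/=; lra.
have gamma_a : gamma <= a by rewrite /a; lra.
have subcritical : a + delta + gamma < 1 by rewrite /a /delta; lra.
have beta_a : 1 < 2 * beta * a.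
  have : 1 <= 2 * beta * m by rewrite mulrC -ler_pdivrMr//; lra.
  have : 0 < beta * delta by exact: mulr_gt0.
  by rewrite /a; lra.
pose z i := fourier_coef (v0 i).
have pd i : periodic_distribution (v0 i) by case: (bv0 i).
have cz i : csym (z i) by exact: csym_distribution.
have [||B B0 hz] := @uniform_constant R 'I_d (fun i B => forall m, {ae torus_measure R d,
    forall x, `|block phi (z i) m x| <= B * lam m `^ (2 * beta * gamma)}).
- move=> i C C' CC h k; apply: filterS (h k) => x hx; rewrite (le_trans hx)//.
  by rewrite ler_wpM2r// powR_ge0.
- move=> i; apply: besov_blocks => //.
  by have [_] := bv0 i; rewrite gE opprD.
have [C1 hC1] := ex_heat_constant beta0 gamma0 gamma_a delta01 subcritical lp B0 cz hz.
have [C2 hC2] := ex_duhamel_constant beta0 gamma0 beta_a gamma_a delta01 subcritical lp.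
have [C10 _] := hC1; have [C20 _] := hC2.
pose Z : R := \sum_(i < d) `|complex.Re (z i 0)|.
have hZ i : `|complex.Re (z i 0)| <= Z.
  by rewrite /Z (bigD1 i)//= lerDl; apply: sumr_ge0.
have Z0 : 0 <= Z by exact: sumr_ge0.
(* The ball has twice the size of the linear part, and T^delta = q^-1 is small
   enough for the quadratic part. *)
have [K KE] : exists K, K = 2 * (Z + C1) by exists (2 * (Z + C1)).
have K0 : 0 <= K by rewrite KE mulr_ge0// addr_ge0.
have [q qE] : exists q, q = 1 + 4 * C2 * K by exists (1 + 4 * C2 * K).
have q1 : 1 <= q by rewrite qE lerDl mulr_ge0// mulr_ge0.
pose T := q `^ (- delta^-1).
have q0 : 0 < q by exact: lt_le_trans q1.
have T01 : 0 < T <= 1.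
  rewrite /T powR_gt0//= powRN invf_le1 ?powR_gt0// -(powRr0 q).
  by apply: ler_powR => //; rewrite invr_ge0 ltW.
have Td : T `^ delta = q^-1.
  by rewrite /T -powRrM mulNr mulVf ?gt_eqF// powR_inv1// ltW.
have small : C2 * (2 * K * T `^ delta) <= 1 / 2.
  by rewrite Td !mulrA ler_pdivrMr// qE; lra.
have invariant : Z + C1 + C2 * (T `^ delta * (K * K)) <= K.
  by have := ler_wpM2r K0 small; lra.
have sz : solenoidal z by exact: solenoidal_distribution.
have zE i : z i = fourier_coef (v0 i) by [].
have /andP[T0 _] := T01.
exists T; split => //.
have tv := tempered_solution beta0 gamma0 gamma_a delta01 subcritical lp
  hC1 hC2 hZ T01 K0 invariant small.
have fv := solution_fixed beta0 gamma0 gamma_a delta01 subcritical lp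
  hC1 hC2 hZ T01 K0 invariant small.
set v := solution _ _ _ _ in tv fv.
exists v; split.
  exact: (fixed_point_solution beta0 gamma0 beta_a gamma_a delta01 subcritical lp
    B0 cz hz hC1 hC2 T01 sz K0 zE gE tv fv).
move=> w sw t tT.
have [K' [u [K'0 tu fu wu]]] := solution_fixed_point
  beta0 gamma0 gamma_a delta01 subcritical lp cz hC1 hC2 hZ T01 zE gE sw.
apply: filterS (wu t tT) => x ->.
have K1 : K <= Num.max K K' by rewrite le_max lexx.
have K2 : K' <= Num.max K K' by rewrite le_max lexx orbT.
exact: (mild_map_unique beta0 gamma0 gamma_a delta01 subcritical lp hC1 hC2 T01
  (le_trans K0 K1) (tempered_le K2 tu) (tempered_le K1 tv) fu (fun t x _ => fv t x)).
Qed.
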